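(* Let $\alpha\in(\tfrac12,1)$, $s=p^{1-\alpha}$, $A=\sqrt{2r\log p/n}$ with $0<r<\rho^*(\alpha)$, and $\mathbf X\in\mathrm{SubG}(\sigma^2)$. Then $$\lim_{p\to\infty}\frac{\log(1-\mathrm{Risk}(s,A))}{\log p}=\begin{cases} r-\left(\alpha-\tfrac12\right), & \text{if } 4r\le1 \text{ and } n/(p^{13/6}\log p)\to\infty,\\[2pt] 1-\alpha-(1-\sqrt r)^2, & \text{if } 4r>1 \text{ and } n/(p^{2}\log p)\to\infty.\end{cases}$$ The same conclusion holds (in both cases) for $\mathbf X\in\mathcal O_n(p)$ with any $n\ge p$.
   Context: Setting: for each $p$ one observes $(\mathbf y,\mathbf X)$ with $\mathbf y=\mathbf X\boldsymbol\beta+\boldsymbol\varepsilon$, where $\boldsymbol\varepsilon\sim\mathcal N(0,I_n)$, $\mathbf X$ is an $n\times p$ real matrix independent of $\boldsymbol\varepsilon$, $\boldsymbol\beta\in\mathbb R^p$ is unknown, and $n=n(p)\to\infty$ as $p\to\infty$. Design classes: $\mathbf X\in\mathrm{SubG}(\sigma^2)$ means the rows of $\mathbf X$ are i.i.d. centered isotropic ($\mathbb E[xx^T]=I_p$) sub-Gaussian random vectors with sub-Gaussian parameter $\sigma^2$ (for every unit $u$ and $t\in\mathbb R$, $\log\mathbb E e^{t\langle u,x\rangle}\le\sigma^2t^2/2$), and $\mathbf X^T\mathbf X$ is almost surely positive definite; $\mathbf X\in\mathcal O_n(p)$ means $\mathbf X^T\mathbf X=nI_p$. For an integer $s$ and $A>0$,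 $\Xi(s,A)=\{\boldsymbol\beta\in\mathbb R^p:|\mathrm{supp}(\boldsymbol\beta)|=s,\ |\beta_i|\ge A\text{ for }i\in\mathrm{supp}(\boldsymbol\beta)\}$. A test $T$ is a measurable $[0,1]$-valued function of $(\mathbf y,\mathbf X)$; $\mathbb P_{\boldsymbol\beta},\mathbb E_{\boldsymbol\beta}$ denote the law/expectation of $(\mathbf y,\mathbf X)$ (including the randomness of $\mathbf X$) under parameter $\boldsymbol\beta$, and $\mathbb P_0,\mathbb E_0$ those under $\boldsymbol\beta=0$. $\mathrm{Risk}(T,s,A)=\mathbb E_0[T]+\sup_{\boldsymbol\beta\in\Xi(s,A)}\mathbb E_{\boldsymbol\beta}[1-T]$ and $\mathrm{Risk}(s,A)=\inf_T\mathrm{Risk}(T,s,A)$. The sparsity is $s=p^{1-\alpha}$ (rounded to an integer) with $\alpha$ fixed; all limits are as $p\to\infty$. The detection threshold function is $\rho^*(\alpha)=\alpha-\tfrac12$ for $\tfrac12<\alpha<\tfrac34$ and $\rho^*(\alpha)=(1-\sqrt{1-\alpha})^2$ for $\tfrac34\le\alpha<1$. *)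

(* Defs.v *)
From HB Require Import structures.
From mathcomp Require Import all_boot all_order all_algebra.
From mathcomp Require Import all_classical all_reals all_analysis.
Set Implicit Arguments. Unset Strict Implicit. Unset Printing Implicit Defensive.
Import Order.TTheory GRing.Theory Num.Theory.
Import numFieldNormedType.Exports.
Local Open Scope classical_set_scope.
Local Open Scope ring_scope.

Section Defs.
Context {R : realType}.

Definition rho_star (alpha : R) : R :=
  if alpha < 3 / 4 then alpha - 1 / 2 else (1 - Num.sqrt (1 - alpha)) ^+ 2.

Definition posdef (p : nat) (M : 'M[R]_p) : Prop :=
  forall v : 'cV[R]_p, v != 0 -> 0 < (v^T *m M *m v) 0 0.

Definition mxtup (n p : nat) (M : 'M[R]_(n, p)) : n.-tuple (p.-tuple R) :=
  [tuple [tuple M i j | j < p] | i < n].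

Definition sigma_of {d d'} {O : measurableType d} {T : measurableType d'}
  (f : O -> T) : set (set O) :=
  [set A | exists2 B, measurable B & A = f @^-1` B].

Definition mutually_indep {d} {O : measurableType d} (P : probability O R)
  (I : finType) (G : I -> set (set O)) : Prop :=
  forall A : I -> set O, (forall i, G i (A i)) ->
    P (\bigcap_(i in [set: I]) A i) = (\prod_(i : I) fine (P (A i)))%:E.

Definition indep2 {d} {O : measurableType d} (P : probability O R)
  (G1 G2 : set (set O)) : Prop :=
  forall A B, G1 A -> G2 B -> P (A `&` B) = (fine (P A) * fine (P B))%:E.

Definition gauss_noise {d} {O : measurableType d} (P : probability O R) (n : nat)
  (eps : O -> n.-tuple R) : Prop :=
  [/\ measurable_fun setT eps,
      (forall (i : 'I_n) (B : set R), measurable B ->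
        P ((fun w => tnth (eps w) i) @^-1` B) = normal_prob 0 1 B) &
      mutually_indep P (fun i : 'I_n => sigma_of (fun w => tnth (eps w) i))].

Definition subG_design {d} {O : measurableType d} (P : probability O R) (n p : nat)
  (X : O -> 'M[R]_(n, p)) (sigma2 : R) : Prop :=
  [/\ measurable_fun setT (fun w => mxtup (X w)),
      mutually_indep P (fun i : 'I_n => sigma_of (fun w => tnth (mxtup (X w)) i)),
      (forall (i i' : 'I_n) (B : set (p.-tuple R)), measurable B ->
         P ((fun w => tnth (mxtup (X w)) i) @^-1` B) =
         P ((fun w => tnth (mxtup (X w)) i') @^-1` B)) &
    [/\ (forall i j, (\int[P]_w (X w i j)%:E = 0)%E),
      (forall i j k, (\int[P]_w (X w i j * X w i k)%:E = (j == k)%:R%:E)%E),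
      (forall i (u : 'I_p -> R), \sum_j u j ^+ 2 = 1 -> forall t : R,
         (\int[P]_w (expR (t * \sum_j u j * X w i j))%:E
            <= (expR (sigma2 * t ^+ 2 / 2))%:E)%E) &
      {ae P, forall w, posdef ((X w)^T *m X w)}]].

Definition orth_design {d} {O : measurableType d} (n p : nat)
  (X : O -> 'M[R]_(n, p)) : Prop :=
  measurable_fun setT (fun w => mxtup (X w)) /\
  forall w, (X w)^T *m X w = (n%:R)%:M.

Definition data_space (n p : nat) := (n.-tuple R * n.-tuple (p.-tuple R))%type.

Definition is_test (n p : nat) (T : data_space n p -> R) : Prop :=
  measurable_fun setT T /\ forall z, 0 <= T z <= 1.

Definition obs (n p : nat) (X : 'M[R]_(n, p)) (e : n.-tuple R) (b : 'cV[R]_p)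
  : data_space n p :=
  ([tuple (X *m b) i 0 + tnth e i | i < n], mxtup X).

Definition Etest {d} {O : measurableType d} (P : probability O R) (n p : nat)
  (X : O -> 'M[R]_(n, p)) (eps : O -> n.-tuple R) (T : data_space n p -> R)
  (b : 'cV[R]_p) : \bar R :=
  (\int[P]_w (T (obs (X w) (eps w) b))%:E)%E.

Definition Xi (p s : nat) (A : R) : set 'cV[R]_p :=
  [set b | #|[set i : 'I_p | b i 0 != 0]| = s /\
           forall i, b i 0 != 0 -> A <= `|b i 0|].



Definition risk_test {d} {O : measurableType d} (P : probability O R) (n p : nat)
  (X : O -> 'M[R]_(n, p)) (eps : O -> n.-tuple R) (s : nat) (A : R)
  (T : data_space n p -> R) : \bar R :=
  (Etest P X eps T 0 +
   ereal_sup [set Etest P X eps (fun z => (1 - T z)%R) b | b in @Xi p s A])%E.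

Definition minimax_risk {d} {O : measurableType d} (P : probability O R) (n p : nat)
  (X : O -> 'M[R]_(n, p)) (eps : O -> n.-tuple R) (s : nat) (A : R) : \bar R :=
  ereal_inf [set risk_test P X eps s A T | T in [set T | is_test T]].

End Defs.

(* Main.v *)
Require Import Defs.
From HB Require Import structures.
From mathcomp Require Import all_boot all_order all_algebra.
From mathcomp Require Import ring lra.
From mathcomp Require Import all_classical all_reals all_analysis.
From mathcomp Require Import measurable_realfun.
Set Implicit Arguments. Unset Strict Implicit. Unset Printing Implicit Defensive.
Import Order.TTheory GRing.Theory Num.Theory.
Import numFieldNormedType.Exports.
Local Open Scope classical_set_scope.
Local Open Scope ring_scope.

(* Both bounds are transferred to the Gaussian sequence model x_j = theta_j + xi_j, j < p.
   When the Gram matrix X^T X / n is entrywise within dl / p of the identity, a fixed multiple of X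
   times a sequence-model observation plus independent Gaussian noise has the law of y, so the risk
   cannot be smaller than in the sequence model with signal sqrt(2 r L / (1 - 2 dl)), L = log p;
   conversely the least-squares estimator plus independent Gaussian noise has the law of a
   sequence-model observation with signal sqrt(2 r L / (1 + 2 dl)). Such designs have overwhelming
   probability for sub-Gaussian rows and are certain for orthogonal ones, and dl can be taken
   arbitrarily small.

   In the sequence model, put one spike in a uniform position of each of s disjoint blocks. The
   second moment of the likelihood ratio, truncated at sqrt(2 L) when 4 r > 1, bounds 1 - Risk from
   above. For the other direction the test rejects with probability a clipped linear function of the
   number of |x_j| above sqrt(2 kap L), kap = min(4 r, 1): the mean of this number moves by less
   than its standard deviation, and the linear part of the clipping retains the ratio of the two. *)

(** * Product measures on tuples *)

(** Below the detection boundary 1 - Risk is a negative power of p of which only the exponent is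
    sought: factors p^o(1) are free, additive errors are not. Hence both transfers are exact in law
    once the design is fixed, and their whole price is a slightly altered r, which continuity of the
    exponent in r removes. Bad designs are an additive error when the risk is bounded below, so
    their probability must be a sufficiently negative power of p; in the other direction the test
    accepts on them and loses a constant factor.

    Blocks make the positions of the spikes independent, which turns the second moment into an exact
    s-th power. Without truncation it is dominated by observations near twice the signal, and for 4
    r > 1 these lie beyond sqrt(2 L), where null coordinates typically do not go.

    A sharp threshold on the count would need local information on its distribution to exhibit so
    small a gain; a ramp needs only a variance. The value of kap maximises 1 - alpha - (sqrt kap -
    sqrt r)^2 - (1 - kap)/2 over kap <= 1: the stationary point is sqrt kap = 2 sqrt r, again twice
    the signal. *)

Section prob_cst.
Local Open Scope ereal_scope.

Lemma integral_prob_cst {d} {T : measurableType d} {R : realType}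
    (P : probability T R) (c : \bar R) : \int[P]_x c = c.
Proof.
have /= -> := @integral_cst _ _ _ P setT measurableT c.
by rewrite (probability_setT P) mule1.
Qed.

End prob_cst.

Section integral_real.
Context {d} {T : measurableType d} {R : realType} (mu : {measure set T -> \bar R}).
Implicit Types f g : T -> R.
Local Open Scope ereal_scope.

Lemma le_integral_fin f g : measurable_fun setT f -> measurable_fun setT g ->
  (forall x, 0 <= f x)%R -> (forall x, f x <= g x)%R ->
  \int[mu]_x (f x)%:E <= \int[mu]_x (g x)%:E.
Proof.
move=> mf mg f0 fg; apply: ge0_le_integral => //.
- by move=> x _; rewrite lee_fin.
- exact/measurable_EFinP.
- exact/measurable_EFinP.
- by move=> x _; rewrite lee_fin.
Qed.

Lemma integral_finD f g : measurable_fun setT f -> measurable_fun setT g ->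
  (forall x, 0 <= f x)%R -> (forall x, 0 <= g x)%R ->
  \int[mu]_x (f x + g x)%:E = \int[mu]_x (f x)%:E + \int[mu]_x (g x)%:E.
Proof.
move=> mf mg f0 g0; under eq_integral do rewrite EFinD.
apply: ge0_integralD => //.
- by move=> x _; rewrite lee_fin.
- exact/measurable_EFinP.
- by move=> x _; rewrite lee_fin.
- exact/measurable_EFinP.
Qed.

Lemma integral_finZl f (k : R) : measurable_fun setT f -> (forall x, 0 <= f x)%R ->
  (0 <= k)%R -> \int[mu]_x (k * f x)%:E = k%:E * \int[mu]_x (f x)%:E.
Proof.
move=> mf f0 k0; under eq_integral do rewrite EFinM.
apply: ge0_integralZl => //.
- exact/measurable_EFinP.
- by move=> x _; rewrite lee_fin.
Qed.

Lemma integral_fin_sum (I : Type) (r : seq I) (f : I -> T -> R) :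
  (forall i, measurable_fun setT (f i)) -> (forall i x, 0 <= f i x)%R ->
  \int[mu]_x (\sum_(i <- r) f i x)%:E = \sum_(i <- r) \int[mu]_x (f i x)%:E.
Proof.
move=> mf f0; under eq_integral do rewrite -sumEFin.
apply: ge0_integral_sum => //.
- by move=> i; exact/measurable_EFinP.
- by move=> i x _; rewrite lee_fin.
Qed.

End integral_real.

Section iid_product.
Context {d} {T : measurableType d} {R : realType}.

Definition tuple_cons n (z : T * n.-tuple T) : n.+1.-tuple T :=
  [the n.+1.-tuple T of z.1 :: z.2].

Lemma measurable_tuple_cons n : measurable_fun setT (@tuple_cons n).
Proof. exact: measurable_cons. Qed.

HB.instance Definition _ n :=
  isMeasurableFun.Build _ _ _ _ (@tuple_cons n) (@measurable_tuple_cons n).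

Variable mu : probability T R.

(** Built by recursion on the arity, as the image of [mu \x iidm k] under [tuple_cons], so that
    Tonelli strips one coordinate at a time and inductions on the dimension follow the structure of
    tuples. *)
Fixpoint iidm n : probability (n.-tuple T) R :=
  match n with
  | 0 => (dirac (T := 0.-tuple T) [tuple] : probability _ R)
  | k.+1 => distribution (mu \x iidm k)%E (@tuple_cons k : {mfun _ >-> _})
  end.

Local Open Scope ereal_scope.

Lemma ge0_integral_iidmS n (f : n.+1.-tuple T -> \bar R) :
  measurable_fun setT f -> (forall x, 0 <= f x) ->
  \int[iidm n.+1]_x f x =
  \int[mu]_x \int[iidm n]_v f (tuple_cons (x, v)).
Proof.
move=> mf f0.
rewrite ge0_integral_distribution//.
rewrite (@fubini_tonelli1 _ _ _ _ _ mu (iidm n) (f \o @tuple_cons n))//.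
by apply: measurableT_comp => //; exact: measurable_tuple_cons.
by move=> x; exact: f0.
Qed.

Lemma measurable_integral_iidm n (f : n.+1.-tuple T -> \bar R) :
  measurable_fun setT f -> (forall x, 0 <= f x) ->
  measurable_fun setT (fun x => \int[iidm n]_v f (tuple_cons (x, v))).
Proof.
move=> mf f0.
apply: (@measurable_fun_fubini_tonelli_F _ _ _ _ _ (iidm n) (f \o @tuple_cons n)).
by apply: measurableT_comp => //; exact: measurable_tuple_cons.
by move=> x; exact: f0.
Qed.

Lemma integral_iidm0 (f : 0.-tuple T -> \bar R) :
  measurable_fun setT f -> \int[iidm 0]_x f x = f [tuple].
Proof. by move=> mf; rewrite /= integral_dirac// diracT mul1e. Qed.

Lemma integral_iidm_prod n (f : 'I_n -> T -> R) (c : 'I_n -> R) :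
  (forall i, measurable_fun setT (f i)) -> (forall i x, (0 <= f i x)%R) ->
  (forall i, \int[mu]_x (f i x)%:E = (c i)%:E) ->
  \int[iidm n]_x (\prod_i f i (tnth x i))%:E = (\prod_i c i)%:E.
Proof.
elim: n f c => [|n IH] f c mf f0 fc.
  rewrite integral_iidm0 ?big_ord0//.
  under eq_fun do rewrite big_ord0; exact: measurable_cst.
have mP m (g : 'I_m -> T -> R) : (forall i, measurable_fun setT (g i)) ->
    measurable_fun setT (fun x : m.-tuple T => (\prod_i g i (tnth x i))%:E).
  move=> mg; apply/measurable_EFinP; apply: measurable_prod => i _.
  by apply: measurableT_comp => //; exact: measurable_tnth.
have c0 i : (0 <= c i)%R.
  by rewrite -lee_fin -fc integral_ge0// => x _; rewrite lee_fin.
rewrite ge0_integral_iidmS//; last 2 first.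
- exact: mP.
- by move=> x; rewrite lee_fin prodr_ge0.
under eq_integral => x _.
  under eq_integral => v _.
    rewrite big_ord_recl EFinM /= (tnth_nth x)/=.
    under eq_bigr do rewrite tnthS.
    over.
  rewrite ge0_integralZl//; first last.
  - by rewrite lee_fin.
  - by move=> v _; rewrite lee_fin prodr_ge0.
  - exact: (mP n (fun i => f (lift ord0 i))).
  rewrite (IH (fun i => f (lift ord0 i)) (fun i => c (lift ord0 i)))//.
  over.
rewrite /= ge0_integralZr//; first last.
- by rewrite lee_fin prodr_ge0.
- by move=> x _; rewrite lee_fin.
- exact/measurable_EFinP.
by rewrite fc -EFinM big_ord_recl.
Qed.

Lemma iidm_box n (B : 'I_n -> set T) : (forall i, measurable (B i)) ->
  iidm n [set x | forall i, B i (tnth x i)] = (\prod_i fine (mu (B i)))%:E.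
Proof.
move=> mB.
rewrite -(@integral_iidm_prod _ (fun i => \1_(B i)) (fun i => fine (mu (B i)))); first last.
- move=> i; rewrite integral_indic// setIT fineK//; exact: fin_num_measure.
- by [].
- by move=> i; exact: measurable_indic.
have mb : measurable [set x : n.-tuple T | forall i, B i (tnth x i)].
  rewrite [X in measurable X](_ : _ = \bigcap_(i in [set: 'I_n])
      ((fun x : n.-tuple T => tnth x i) @^-1` B i)); last first.
    by apply/seteqP; split => x /=; [move=> h i _; exact: h|move=> h i; exact: h].
  apply: fin_bigcap_measurable; first exact: finite_finset.
  by move=> i _; rewrite -[X in measurable X]setTI; exact: measurable_tnth.
rewrite -[X in iidm n X]setIT -integral_indic//.
apply: eq_integral => x _; congr EFin.
rewrite indicE; case: (boolP (_ \in _)); rewrite ?inE/=.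
  move=> h; rewrite big1// => i _; rewrite indicE mem_set//; exact: h.
move=> /negP; rewrite inE/= => /existsNP[i Bi].
by rewrite (bigD1 i)//= indicE memNset// mul0r.
Qed.

(** Measurable boxes are stable under intersection and generate the sigma-algebra of tuples, a
    coordinate cylinder being a box whose other sides are full. Finite measures that agree on boxes
    are therefore equal. *)
Lemma iidm_unique n (nu : probability (n.-tuple T) R) :
  (forall B : 'I_n -> set T, (forall i, measurable (B i)) ->
    nu [set x | forall i, B i (tnth x i)] = (\prod_i fine (mu (B i)))%:E) ->
  forall A, measurable A -> nu A = iidm n A.
Proof.
move=> nuB.
pose G := [set A : set (n.-tuple T) | exists2 B : 'I_n -> set T,
  (forall i, measurable (B i)) & A = [set x | forall i, B i (tnth x i)]].
apply: (measure_unique G (fun=> setT)).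
- apply/seteqP; split.
    apply: smallest_sub; first exact: smallest_sigma_algebra.
    rewrite -bigcup_seq => A [i _ [B mB <-]].
    apply: sub_sigma_algebra; exists (fun j => if j == i then B else setT).
      by move=> j; case: ifP.
    rewrite setTI; apply/seteqP; split => x /=.
      by move=> Bx j; case: ifPn => // /eqP ->.
    by move=> /(_ i); rewrite eqxx.
  apply: smallest_sub; first exact: sigma_algebra_measurable.
  move=> A [B mB ->].
  rewrite [X in _ X](_ : _ = \bigcap_(i in [set: 'I_n])
      ((fun x : n.-tuple T => tnth x i) @^-1` B i)); last first.
    by apply/seteqP; split => x /=; [move=> h i _; exact: h|move=> h i; exact: h].
  apply: fin_bigcap_measurable; first exact: finite_finset.
  by move=> i _; rewrite -[X in measurable X]setTI; exact: measurable_tnth.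
- move=> _ _ [B mB ->] [C mC ->]; exists (fun i => B i `&` C i).
    by move=> i; exact: measurableI.
  apply/seteqP; split => x /=; last by move=> h; split => i; case: (h i).
  by move=> [h k] i; split.
- by move=> _; exists (fun=> setT) => //; apply/seteqP; split.
- by rewrite bigcup_const//; exists 0%N.
- by move=> A [B mB ->]; exact: etrans (nuB B mB) (esym (iidm_box mB)).
- by move=> k; rewrite -ge0_fin_numE// fin_num_measure.
Qed.

End iid_product.

(** * Laws, densities and translations *)

Section law.
Context {d d'} {T : measurableType d} {Om : measurableType d'} {R : realType}.
Variables (mu : probability T R) (P : probability Om R).
Local Open Scope ereal_scope.

Lemma ge0_integral_law (Z : Om -> T) (f : T -> \bar R) :
  measurable_fun setT Z -> (forall A, measurable A -> P (Z @^-1` A) = mu A) ->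
  measurable_fun setT f -> (forall x, 0 <= f x) ->
  \int[P]_w f (Z w) = \int[mu]_x f x.
Proof.
move=> mZ lawZ mf f0.
have := @ge0_integral_pushforward _ _ _ _ R Z mZ P setT f measurableT mf (fun x _ => f0 x).
rewrite preimage_setT => <-.
by apply: eq_measure_integral => A mA _; exact: lawZ.
Qed.

(** Converts the coordinatewise hypotheses of [gauss_noise] and [subG_design] into one joint law,
    the form in which the noise vector and the family of rows are integrated later. *)
Lemma law_iidm n (Y : Om -> n.-tuple T) : measurable_fun setT Y ->
  (forall (i : 'I_n) B, measurable B ->
    P ((fun w => tnth (Y w) i) @^-1` B) = mu B) ->
  mutually_indep P (fun i : 'I_n => sigma_of (fun w => tnth (Y w) i)) ->
  forall A, measurable A -> P (Y @^-1` A) = iidm mu n A.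
Proof.
move=> mY lawY indY A mA.
pose mYi := isMeasurableFun.Build _ _ _ _ Y mY.
pose Y' : {mfun Om >-> n.-tuple T} := HB.pack Y mYi.
rewrite -[LHS]/(distribution P Y' A); apply: iidm_unique => // B mB.
rewrite -[LHS]/(P (Y @^-1` [set x | forall i, B i (tnth x i)])).
have := indY (fun i => (fun w => tnth (Y w) i) @^-1` B i) (fun i => ex_intro2 _ _ (B i) (mB i) erefl).
rewrite [X in P X = _ -> _](_ : _ = Y @^-1` [set x | forall i, B i (tnth x i)]); last first.
  by apply/seteqP; split => w /= h i => [|_]; exact: h.
by move=> ->; congr EFin; apply: eq_bigr => i _; rewrite lawY.
Qed.

End law.

Section density.
Context {d} {T : measurableType d} {R : realType}.
Variables (mu nu : {measure set T -> \bar R}) (h : T -> R).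
Hypotheses (mh : measurable_fun setT h) (h0 : forall x, 0 <= h x).
Hypothesis nuE : forall A, measurable A -> nu A = (\int[mu]_(x in A) (h x)%:E)%E.
Local Open Scope ereal_scope.
Import HBNNSimple.

Let density_indic A : measurable A ->
  \int[nu]_x (\1_A x)%:E = \int[mu]_x ((\1_A x)%:E * (h x)%:E).
Proof.
move=> mA; rewrite integral_indic// setIT nuE// integral_mkcond.
apply: eq_integral => x _; rewrite patchE indicE.
by case: ifP => _; rewrite ?mul1e ?mul0e.
Qed.

Let density_nnsfun (f : {nnsfun T >-> R}) :
  \int[nu]_x (f x)%:E = \int[mu]_x ((f x)%:E * (h x)%:E).
Proof.
have pos (r : R) x : 0 <= (r * \1_(f @^-1` [set r]) x)%:E.
  by rewrite EFinM nnfun_muleindic_ge0.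
under [LHS]eq_integral do rewrite fimfunE -fsumEFin//.
rewrite [LHS]ge0_integral_fsum//; last first.
  by move=> r; exact/measurable_EFinP/measurableT_comp.
under [RHS]eq_integral.
  move=> x xD; rewrite fimfunE -fsumEFin// muleC ge0_mule_fsumr//.
  over.
rewrite [RHS]ge0_integral_fsum//; last 2 first.
  - move=> r; apply: emeasurable_funM; first exact/measurable_EFinP.
    by apply/measurable_EFinP; do 2 apply/measurableT_comp => //.
  - by move=> n x _; rewrite mule_ge0// lee_fin.
apply: eq_fsbigr => r _.
rewrite integralZl_indic_nnsfun// density_indic//.
have [r0|r0] := leP 0%R r; last first.
  have -> : f @^-1` [set r] = set0.
    by apply/seteqP; split => // x /= fxr; move: r0; rewrite -fxr ltNge fun_ge0.
  under eq_integral do rewrite indic0 mul0e.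
  under [RHS]eq_integral do rewrite indic0 mulr0 mule0.
  by rewrite !integral0 mule0.
rewrite -ge0_integralZl//.
- by apply: eq_integral => x _; rewrite EFinM [RHS]muleC muleA.
- apply: emeasurable_funM; last exact/measurable_EFinP.
  exact/measurable_EFinP.
- by move=> x _; rewrite mule_ge0// lee_fin.
Qed.

(** The standard extension: indicators, then nonnegative simple functions, then monotone limits. *)
Lemma ge0_integral_density (f : T -> \bar R) :
  measurable_fun setT f -> (forall x, 0 <= f x) ->
  \int[nu]_x f x = \int[mu]_x (f x * (h x)%:E).
Proof.
move=> mf f0; pose f_ := nnsfun_approx measurableT mf.
transitivity (lim (\int[nu]_x (f_ n x)%:E @[n --> \oo])).
  rewrite -monotone_convergence//=.
  - apply: eq_integral => ? /[!inE] xD; apply/esym/cvg_lim => //=.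
    exact: cvg_nnsfun_approx.
  - by move=> n; exact/measurable_EFinP/measurable_funTS.
  - by move=> n ? _; rewrite lee_fin.
  - by move=> ? _ ? ? mn; rewrite lee_fin; exact/lefP/nd_nnsfun_approx.
transitivity (lim (\int[mu]_x ((f_ n x)%:E * (h x)%:E) @[n --> \oo])).
  by apply: congr_lim; apply/funext => n /=; exact: density_nnsfun.
rewrite -monotone_convergence//=.
- apply: eq_integral => x _; apply/cvg_lim => //.
  apply: cvgeZr => //; exact: cvg_nnsfun_approx.
- move=> n; apply: emeasurable_funM; exact/measurable_EFinP.
- by move=> n x _; rewrite mule_ge0// lee_fin.
- move=> x _ m n mn; rewrite lee_wpmul2r// ?lee_fin//.
  exact/lefP/nd_nnsfun_approx.
Qed.

End density.

Section lebesgue_shift.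
Context {R : realType}.
Local Open Scope ereal_scope.
Notation leb := (@lebesgue_measure R).

(** The image of Lebesgue measure under a translation gives half-open intervals their length, and
    this characterises Lebesgue measure. *)
Lemma ge0_integral_shift (a : R) (f : R -> \bar R) :
  measurable_fun setT f -> (forall x, 0 <= f x) ->
  \int[leb]_x f (x + a)%R = \int[leb]_x f x.
Proof.
move=> mf f0.
have mS : measurable_fun setT (fun x : measurableTypeR R => (x + a)%R : measurableTypeR R).
  exact: measurable_funD.
have := @ge0_integral_pushforward _ _ _ _ R _ mS leb setT f measurableT mf (fun x _ => f0 x).
rewrite preimage_setT => <-.
apply: eq_measure_integral => A mA _; apply/esym.
apply: (@lebesgue_measure_unique R
  (measure_function_pushforward__canonical__measure_function_Measure leb mS)) => //.
move=> X [[x y] _ <-] /=; rewrite /pushforward.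
rewrite [X in _ = leb X](_ : _ = `](x - a)%R, (y - a)%R]%classic); last first.
  by apply/seteqP; split => z /=; rewrite !in_itv/= ltrBlDr lerBrDr.
rewrite !lebesgue_measure_itv/= !lte_fin ltrD2r.
by case: ifP => // _; rewrite -!EFinD; congr EFin; ring.
Qed.

End lebesgue_shift.

(** * The standard Gaussian measure *)

Section gauss1.
Context {R : realType}.
Local Open Scope ereal_scope.
Notation leb := (@lebesgue_measure R).

(* [normal_prob] lives on [measurableTypeR R], whose display is not the one of the canonical structure on [R] used by the tuples in [Defs]. *)
Let toR (x : measurableTypeR R) : R := x.
Let measurable_toR : measurable_fun setT toR. Proof. by move=> mT A mA; rewrite setTI. Qed.
HB.instance Definition _ := isMeasurableFun.Build _ _ _ _ toR measurable_toR.

Definition gauss : probability R R :=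
  distribution (normal_prob (0 : R) 1) (toR : {mfun _ >-> R}).

Definition gpdf : R -> R := normal_pdf 0%R 1%R.

Lemma gpdfE x : gpdf x = (normal_peak 1 * expR (- x ^+ 2 / 2))%R.
Proof.
by rewrite /gpdf normal_pdfE ?oner_neq0// /normal_fun subr0 expr1n.
Qed.

Lemma gpdf_ge0 x : (0 <= gpdf x)%R. Proof. exact: normal_pdf_ge0. Qed.

Lemma measurable_gpdf : measurable_fun setT gpdf.
Proof. exact: measurable_normal_pdf. Qed.

Lemma ge0_integral_gauss (f : R -> \bar R) :
  measurable_fun setT f -> (forall x, 0 <= f x) ->
  \int[gauss]_x f x = \int[leb]_x (f x * (gpdf x)%:E).
Proof.
move=> mf f0; rewrite ge0_integral_distribution//.
apply: (@ge0_integral_density _ (measurableTypeR R) R leb) => //.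
exact: measurable_gpdf.
exact: gpdf_ge0.
Qed.

(** One-dimensional Cameron-Martin formula: after translating Lebesgue measure, the two densities
    differ by the exponential factor. The likelihood ratios below come from it. *)
Lemma ge0_integral_gauss_shift (a : R) (f : R -> \bar R) :
  measurable_fun setT f -> (forall x, 0 <= f x) ->
  \int[gauss]_x f (x + a)%R = \int[gauss]_x (f x * (expR (a * x - a ^+ 2 / 2))%:E).
Proof.
move=> mf f0.
have mE : measurable_fun setT (fun x : R => expR (a * x - a ^+ 2 / 2)).
  by apply: measurableT_comp => //; apply: measurable_funB.
have mS (b : R) : measurable_fun setT (fun x : R => (x + b)%R).
  exact: measurable_funD.
rewrite [LHS]ge0_integral_gauss//; last exact: measurableT_comp.
rewrite [RHS]ge0_integral_gauss; last 2 first.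
- by apply: emeasurable_funM => //; exact/measurable_EFinP.
- by move=> x; rewrite mule_ge0// lee_fin expR_ge0.
rewrite -[RHS](@ge0_integral_shift R a); first last.
- by move=> x; rewrite !mule_ge0// lee_fin ?expR_ge0// gpdf_ge0.
- apply: emeasurable_funM; last by apply/measurable_EFinP; exact: measurable_gpdf.
  by apply: emeasurable_funM => //; exact/measurable_EFinP.
apply: eq_integral => x _; rewrite -muleA; congr (_ * _); rewrite -EFinM.
congr EFin; rewrite !gpdfE mulrCA -expRD; congr (_ * expR _)%R.
by field.
Qed.

(** The shift formula with f = 1: the exponential tilt has total mass 1. *)
Lemma integral_gauss_mgf (a : R) :
  \int[gauss]_x (expR (a * x))%:E = (expR (a ^+ 2 / 2))%:E.
Proof.
have mE : measurable_fun setT (fun x : R => expR (a * x)).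
  by apply: measurableT_comp => //; apply: measurable_funM.
have := @ge0_integral_gauss_shift a (cst 1) (measurable_cst _) (fun=> lee01).
under [RHS]eq_integral => x _ do rewrite /= mul1e expRB EFinM.
rewrite ge0_integralZr//; last exact/measurable_EFinP.
have /= -> := @integral_cst _ _ _ gauss setT measurableT 1.
rewrite mul1e (probability_setT gauss).
move=> /(congr1 (fun z => z * (expR (a ^+ 2 / 2))%:E)).
by rewrite mul1e -muleA -EFinM mulVf ?mule1// gt_eqF// expR_gt0.
Qed.

Lemma gauss_upper_tail (t : R) : (0 <= t)%R ->
  gauss `]t, +oo[%classic <= (expR (- t ^+ 2 / 2))%:E.
Proof.
move=> t0.
have mE : measurable_fun setT (fun x : R => (expR (t * x))).
  by apply: measurableT_comp => //; apply: measurable_funM.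
rewrite -[X in gauss X]setIT -integral_indic//.
(* Chernoff bound with the optimal tilt t: the indicator of x > t is at most exp(t x - t^2). *)
apply: (@le_trans _ _ (\int[gauss]_x ((expR (- t ^+ 2))%:E * (expR (t * x))%:E))).
  apply: ge0_le_integral => //.
  - by apply/measurable_EFinP; exact: measurable_indic.
  - by apply/measurable_EFinP; apply: measurable_funM.
  - move=> x _; rewrite -EFinM lee_fin indicE.
    case: (boolP (_ \in _)) => [|_]; last by rewrite mulr_ge0 ?expR_ge0.
    rewrite inE/= in_itv/= andbT => tx.
    rewrite -expRD -[X in (X <= _)%R]expR0 ler_expR.
    by rewrite addrC expr2 -mulrBr mulr_ge0// subr_ge0 ltW.
rewrite ge0_integralZl//.
- rewrite integral_gauss_mgf -EFinM -expRD lee_fin ler_expR; lra.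
- exact/measurable_EFinP.
Qed.

Lemma gauss_lower_tail (t : R) : (0 <= t)%R ->
  gauss `]-oo, (- t)%R[%classic <= (expR (- t ^+ 2 / 2))%:E.
Proof.
move=> t0.
have mE : measurable_fun setT (fun x : R => (expR (- t * x))).
  by apply: measurableT_comp => //; apply: measurable_funM.
rewrite -[X in gauss X]setIT -integral_indic//.
apply: (@le_trans _ _ (\int[gauss]_x ((expR (- t ^+ 2))%:E * (expR (- t * x))%:E))).
  apply: ge0_le_integral => //.
  - by apply/measurable_EFinP; exact: measurable_indic.
  - by apply/measurable_EFinP; apply: measurable_funM.
  - move=> x _; rewrite -EFinM lee_fin indicE.
    case: (boolP (_ \in _)) => [|_]; last by rewrite mulr_ge0 ?expR_ge0.
    rewrite inE/= in_itv/= => tx.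
    rewrite -expRD -[X in (X <= _)%R]expR0 ler_expR.
    by nra.
rewrite ge0_integralZl//.
- rewrite integral_gauss_mgf -EFinM -expRD lee_fin ler_expR; lra.
- exact/measurable_EFinP.
Qed.

Lemma gauss_itv_ge (a b : R) (M : R) : (a <= b)%R ->
  (forall x, a < x < b -> x ^+ 2 <= M)%R ->
  ((b - a) * normal_peak 1 * expR (- M / 2))%:E <= gauss `]a, b[%classic.
Proof.
move=> ab hM.
rewrite /= /normal_prob.
apply: (@le_trans _ _ (\int[leb]_(x in `]a, b[) (normal_peak 1 * expR (- M / 2))%:E)).
  rewrite integral_cst//= lebesgue_measure_itv/= lte_fin.
  have [_|ba] := ltP a b; first by rewrite -EFinB -EFinM lee_fin -mulrA mulrC.
  by rewrite (@le_anti _ _ a b) ?ab// subrr !mul0r mule0.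
apply: ge0_le_integral => //.
- by move=> x _; rewrite lee_fin mulr_ge0// ?expR_ge0// normal_peak_ge0.
- by apply/measurable_funTS/measurable_EFinP; exact: measurable_gpdf.
- move=> x /=; rewrite in_itv/= => /hM xM.
  rewrite lee_fin -/(gpdf x) gpdfE ler_wpM2l ?normal_peak_ge0// ler_expR.
  by rewrite ler_pM2r// lerN2.
Qed.

(** Keeps the mass of ]t, t + 1[ alone. Replacing t by t + 1 costs a factor exp(O(t)), which is
    p^o(1) for thresholds of order sqrt(log p). *)
Lemma gauss_upper_tail_ge (t : R) : (0 <= t)%R ->
  (normal_peak 1 * expR (- (t + 1) ^+ 2 / 2))%:E <= gauss `]t, +oo[%classic.
Proof.
move=> t0; apply: (@le_trans _ _ (gauss `]t, (t + 1)%R[%classic)).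
  have := @gauss_itv_ge t (t + 1)%R ((t + 1) ^+ 2)%R.
  rewrite (_ : t + 1 - t = 1)%R ?mul1r; last by ring.
  by apply; [lra|move=> x xt; nra].
apply: le_measure; rewrite ?inE//.
by move=> x /=; rewrite !in_itv/= andbT => /andP[].
Qed.

Lemma gauss_lower_tail_ge (t : R) : (0 <= t)%R ->
  (normal_peak 1 * expR (- (t + 1) ^+ 2 / 2))%:E <= gauss `]-oo, (- t)%R[%classic.
Proof.
move=> t0; apply: (@le_trans _ _ (gauss `](- t - 1)%R, (- t)%R[%classic)).
  have := @gauss_itv_ge (- t - 1) (- t)%R ((t + 1) ^+ 2)%R.
  rewrite (_ : - t - (- t - 1) = 1)%R ?mul1r; last by ring.
  by apply; [lra|move=> x xt; nra].
apply: le_measure; rewrite ?inE//.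
by move=> x /=; rewrite !in_itv/= => /andP[].
Qed.

End gauss1.

(** * Orthogonal invariance of Gaussian vectors *)

Section rotation2.
Context {R : realType}.
Local Open Scope ereal_scope.
Notation leb := (@lebesgue_measure R).

(** With z.2 frozen, a shear is a translation of z.1; Tonelli reduces it to translation invariance
    on the line. *)
Lemma ge0_integral_shear1 (a : R) (h : R * R -> \bar R) :
  measurable_fun setT h -> (forall z, 0 <= h z) ->
  \int[leb \x leb]_z h (z.1 + a * z.2, z.2)%R = \int[leb \x leb]_z h z.
Proof.
move=> mh h0.
have mS : measurable_fun setT (fun z : R * R => (z.1 + a * z.2, z.2)%R : R * R).
  apply: measurable_fun_pair => //.
  by apply: measurable_funD => //; exact: measurable_funM.
have mhS : measurable_fun setT (fun z : R * R => h (z.1 + a * z.2, z.2)%R).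
  exact: (measurableT_comp mh mS).
apply: etrans (@fubini_tonelli2 _ _ _ _ _ leb leb _ mhS (fun=> h0 _)) _.
apply: etrans (esym (@fubini_tonelli2 _ _ _ _ _ leb leb _ mh h0)).
apply: eq_integral => y _.
apply: (@ge0_integral_shift R (a * y)%R (fun x => h (x, y))) => //.
exact: measurable_fun_pair1.
Qed.

Lemma ge0_integral_shear2 (a : R) (h : R * R -> \bar R) :
  measurable_fun setT h -> (forall z, 0 <= h z) ->
  \int[leb \x leb]_z h (z.1, z.2 + a * z.1)%R = \int[leb \x leb]_z h z.
Proof.
move=> mh h0.
have mS : measurable_fun setT (fun z : R * R => (z.1, z.2 + a * z.1)%R : R * R).
  apply: measurable_fun_pair => //.
  by apply: measurable_funD => //; exact: measurable_funM.
have mhS : measurable_fun setT (fun z : R * R => h (z.1, z.2 + a * z.1)%R).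
  exact: (measurableT_comp mh mS).
apply: etrans (@fubini_tonelli1 _ _ _ _ _ leb leb _ mhS (fun=> h0 _)) _.
apply: etrans (esym (@fubini_tonelli1 _ _ _ _ _ leb leb _ mh h0)).
apply: eq_integral => y _.
apply: (@ge0_integral_shift R (a * y)%R (fun x => h (y, x))) => //.
exact: measurable_fun_pair2.
Qed.

Lemma ge0_integral_rot_leb (c s : R) (h : R * R -> \bar R) :
  measurable_fun setT h -> (forall z, 0 <= h z) ->
  (c ^+ 2 + s ^+ 2 = 1)%R -> s != 0%R ->
  \int[leb \x leb]_z h (c * z.1 - s * z.2, s * z.1 + c * z.2)%R =
  \int[leb \x leb]_z h z.
Proof.
move=> mh h0 cs s0.
(* A rotation is the product of three shears with parameters a, s, a; for the angle phi, a = -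
   tan(phi / 2). This division is where s <> 0 enters. *)
pose a : R := ((c - 1) / s)%R.
have mS1 : measurable_fun setT (fun z : R * R => (z.1 + a * z.2, z.2)%R : R * R).
  apply: measurable_fun_pair => //.
  by apply: measurable_funD => //; exact: measurable_funM.
have mS2 : measurable_fun setT (fun z : R * R => (z.1, z.2 + s * z.1)%R : R * R).
  apply: measurable_fun_pair => //.
  by apply: measurable_funD => //; exact: measurable_funM.
rewrite -[RHS](@ge0_integral_shear1 a)//.
rewrite -[RHS](@ge0_integral_shear2 s)//; last exact: (measurableT_comp mh mS1).
rewrite -[RHS](@ge0_integral_shear1 a)//; last first.
  apply: (measurableT_comp (measurableT_comp mh mS1) mS2).
apply: eq_integral => -[x y] _ /=; congr h; congr pair.
  rewrite /a; apply: (mulfI s0).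
  transitivity (s * c * x + (c ^+ 2 + s ^+ 2 - 1) * c * 0 - s ^+ 2 * y)%R; first by ring.
  have -> : (s ^+ 2 = 1 - c ^+ 2)%R by rewrite -cs; ring.
  by field.
by rewrite /a; field.
Qed.

(** The product density depends on x^2 + y^2 only, so the invariance passes from Lebesgue measure to
    the Gaussian one. *)
Lemma ge0_integral_rot_gauss (c s : R) (f : R * R -> \bar R) :
  measurable_fun setT f -> (forall z, 0 <= f z) ->
  (c ^+ 2 + s ^+ 2 = 1)%R -> s != 0%R ->
  \int[gauss]_x \int[gauss]_y f (c * x - s * y, s * x + c * y)%R =
  \int[gauss]_x \int[gauss]_y f (x, y).
Proof.
move=> mf f0 cs s0.
have mkg (k : R * R -> \bar R) : measurable_fun setT k ->
    measurable_fun setT (fun z : R * R => k z * (gpdf z.1 * gpdf z.2)%:E).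
  move=> mk; apply: emeasurable_funM => //; apply/measurable_EFinP; apply: measurable_funM.
    exact: (measurableT_comp measurable_gpdf measurable_fst).
  exact: (measurableT_comp measurable_gpdf measurable_snd).
have kg0 (k : R * R -> \bar R) : (forall z, 0 <= k z) ->
    forall z, 0 <= k z * (gpdf z.1 * gpdf z.2)%:E.
  by move=> k0 z; rewrite mule_ge0// lee_fin mulr_ge0 ?gpdf_ge0.
have gE (k : R * R -> \bar R) : measurable_fun setT k -> (forall z, 0 <= k z) ->
    \int[gauss]_x \int[gauss]_y k (x, y) =
    \int[leb \x leb]_z (k z * (gpdf z.1 * gpdf z.2)%:E).
  move=> mk k0.
  rewrite ge0_integral_gauss//; last 2 first.
  - exact: (@measurable_fun_fubini_tonelli_F _ _ _ _ _ gauss k).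
  - by move=> x; exact: integral_ge0.
  apply: etrans (esym (@fubini_tonelli1 _ _ _ _ _ leb leb _ (mkg k mk) (kg0 k k0))).
  apply: eq_integral => x _; rewrite /fubini_F/=.
  rewrite ge0_integral_gauss//; last exact: measurable_fun_pair2.
  rewrite -ge0_integralZr//.
  - by apply: eq_integral => y _; rewrite -muleA -EFinM [(gpdf y * _)%R]mulrC.
  - apply: emeasurable_funM; first exact: measurable_fun_pair2.
    by apply/measurable_EFinP; exact: measurable_gpdf.
  - by move=> y _; rewrite mule_ge0// lee_fin gpdf_ge0.
  - by rewrite lee_fin gpdf_ge0.
have mrot : measurable_fun setT
    (fun z : R * R => (c * z.1 - s * z.2, s * z.1 + c * z.2)%R : R * R).
  by apply: measurable_fun_pair; [apply: measurable_funB|apply: measurable_funD];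
    exact: measurable_funM.
rewrite (gE (fun z => f (c * z.1 - s * z.2, s * z.1 + c * z.2)%R)) ?gE//; last first.
  exact: measurableT_comp mf mrot.
apply: etrans (@ge0_integral_rot_leb c s _ (mkg f mf) (kg0 f f0) cs s0).
apply: eq_integral => -[x y] _ /=; congr (_ * EFin _).
rewrite !gpdfE mulrACA -expRD [RHS]mulrACA -expRD; congr (_ * expR _)%R.
transitivity (- (c ^+ 2 + s ^+ 2) * (x ^+ 2 + y ^+ 2) / 2)%R; last by field.
by rewrite cs; field.
Qed.

End rotation2.

Section tuple_matrix.
Context {R : realType}.

Lemma scalar_mx_add n (a b : R) : (a + b)%:M = a%:M + b%:M :> 'M[R]_n.
Proof. by rewrite raddfD. Qed.

(** Tuples carry the sigma-algebra and columns the matrix algebra, hence the two conversions [tcol]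
    and [ctup]. *)
Definition tcol n (x : n.-tuple R) : 'cV[R]_n := \col_i tnth x i.
Definition ctup n (c : 'cV[R]_n) : n.-tuple R := [tuple c i 0 | i < n].
Definition lin m n (W : 'M[R]_(m, n)) (x : n.-tuple R) : m.-tuple R :=
  ctup (W *m tcol x).

Lemma ctupK n (c : 'cV[R]_n) : tcol (ctup c) = c.
Proof. by apply/colP => i; rewrite mxE tnth_mktuple. Qed.

Lemma tcolK n (x : n.-tuple R) : ctup (tcol x) = x.
Proof. by apply: eq_from_tnth => i; rewrite tnth_mktuple mxE. Qed.

Lemma tcol_cons n (a : R) (v : n.-tuple R) :
  tcol (tuple_cons (a, v)) = col_mx a%:M (tcol v) :> 'cV[R]_(1 + n).
Proof.
apply/colP => i; rewrite !mxE; case: splitP => j ij.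
  rewrite !ord1 !mxE eqxx mulr1n (_ : i = ord0) ?(tnth_nth 0)//.
  by apply/val_inj; rewrite /= ij !ord1.
rewrite mxE (_ : i = lift ord0 j); last by apply/val_inj; rewrite /= ij.
by rewrite tnthS; congr tnth; apply/val_inj.
Qed.

Lemma ctup_col n (a : R) (c : 'cV[R]_n) :
  ctup (col_mx a%:M c : 'cV[R]_(1 + n)) = tuple_cons (a, ctup c).
Proof. by rewrite -[RHS]tcolK tcol_cons ctupK. Qed.

Lemma linM m n k (W : 'M[R]_(m, n)) (V : 'M[R]_(n, k)) (x : k.-tuple R) :
  lin (W *m V) x = lin W (lin V x).
Proof. by rewrite /lin ctupK mulmxA. Qed.

Lemma lin1 n (x : n.-tuple R) : lin 1%:M x = x.
Proof. by rewrite /lin mul1mx tcolK. Qed.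

Lemma measurable_tupleP d (T : measurableType d) n (f : T -> n.-tuple R) :
  (forall i, measurable_fun setT (fun w => tnth (f w) i)) -> measurable_fun setT f.
Proof. by move=> h; apply/measurable_fun_tnthP. Qed.

Lemma measurable_lin m n (W : 'M[R]_(m, n)) : measurable_fun setT (lin W).
Proof.
apply: measurable_tupleP => i.
under eq_fun do rewrite tnth_mktuple mxE.
apply: measurable_sum => j; apply: measurable_funM => //.
under eq_fun do rewrite mxE.
exact: measurable_tnth.
Qed.

Local Open Scope ereal_scope.
Notation gaussn := (iidm (@gauss R)).

(** In this form the property composes along matrix products; it is proved for plane rotations, sign
    flips and block extensions, which generate what is needed. *)
Definition ginv n (Q : 'M[R]_n) := forall f : n.-tuple R -> \bar R,
  measurable_fun setT f -> (forall x, 0 <= f x) ->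
  \int[gaussn n]_x f (lin Q x) = \int[gaussn n]_x f x.

Lemma ginv1 n : ginv (1%:M : 'M[R]_n).
Proof. by move=> f _ _; apply: eq_integral => x _; rewrite lin1. Qed.

Lemma ginvM n (Q Q' : 'M[R]_n) : ginv Q -> ginv Q' -> ginv (Q *m Q').
Proof.
move=> hQ hQ' f mf f0.
under eq_integral do rewrite linM.
rewrite (hQ' (fun x => f (lin Q x)))// ?hQ//.
by apply: measurableT_comp => //; exact: measurable_lin.
Qed.

Lemma measurable_f_lin m n (W : 'M[R]_(m, n)) (f : m.-tuple R -> \bar R) :
  measurable_fun setT f -> measurable_fun setT (fun x => f (lin W x)).
Proof. by move=> mf; apply: measurableT_comp => //; exact: measurable_lin. Qed.

Lemma measurable_f_cons n x (f : n.+1.-tuple R -> \bar R) :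
  measurable_fun setT f -> measurable_fun setT (fun v => f (tuple_cons (x, v))).
Proof.
move=> mf; apply: measurableT_comp => //.
exact: (measurableT_comp (@measurable_tuple_cons _ _ n) (pair1_measurable x)).
Qed.

Lemma lin_block n (a : R) (Q : 'M[R]_n) x v :
  lin (block_mx a%:M 0 0 Q : 'M[R]_(1 + n)) (tuple_cons (x, v)) =
  tuple_cons (a * x, lin Q v)%R.
Proof.
rewrite /lin tcol_cons mul_block_col !mul0mx addr0 add0r -scalar_mxM.
exact: ctup_col.
Qed.

Lemma ginv_block n (Q : 'M[R]_n) : ginv Q -> ginv (block_mx 1%:M 0 0 Q : 'M[R]_(1 + n)).
Proof.
move=> hQ f mf f0.
rewrite ge0_integral_iidmS//; last exact: measurable_f_lin.
rewrite [RHS](ge0_integral_iidmS _ mf f0); apply: eq_integral => x _.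
under eq_integral do rewrite lin_block mul1r.
by rewrite (hQ (fun v => f (tuple_cons (x, v))))//; exact: measurable_f_cons.
Qed.

(** Plane rotation of the first two coordinates, in the block shape that matches two nested
    [tuple_cons]. *)
Definition givens n (c s : R) : 'M[R]_(1 + (1 + n)) :=
  block_mx c%:M (row_mx (- s)%:M 0) (col_mx s%:M 0) (block_mx c%:M 0 0 1%:M).

Lemma lin_givens n c s a b (v : n.-tuple R) :
  lin (givens n c s) (tuple_cons (a, tuple_cons (b, v))) =
  tuple_cons (c * a - s * b, tuple_cons (s * a + c * b, v))%R.
Proof.
rewrite /lin !tcol_cons /givens mul_block_col mul_row_col mul_col_mx mul_block_col.
rewrite !mul0mx !addr0 add0r mul1mx -!scalar_mxM add_col_mx add0r -!scalar_mx_add.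
by rewrite mulNr !ctup_col tcolK.
Qed.

Lemma tr_givens n c s : (givens n c s)^T = givens n c (- s).
Proof.
by rewrite /givens !tr_block_mx tr_row_mx tr_col_mx !tr_scalar_mx !trmx0 opprK.
Qed.

Lemma lin_inj m n (W V : 'M[R]_(m, n)) : (forall x, lin W x = lin V x) -> W = V.
Proof.
move=> WV; apply/matrixP => i j.
have := congr1 (fun t => tnth t i) (WV (ctup (delta_mx j ord0))).
rewrite /lin !tnth_mktuple ctupK -!colE !mxE.
by [].
Qed.

Lemma tuple2P n (x : n.+2.-tuple R) :
  exists a b (v : n.-tuple R), x = tuple_cons (a, tuple_cons (b, v)).
Proof.
case/tupleP: x => a x; case/tupleP: x => b v; exists a, b, v.
exact/val_inj.
Qed.

Lemma givens_orth n (c s : R) : (c ^+ 2 + s ^+ 2 = 1)%R ->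
  givens n c s *m givens n c (- s) = 1%:M.
Proof.
move=> cs; apply: lin_inj => x; rewrite linM lin1.
have [a [b [v ->]]] := tuple2P x; rewrite !lin_givens.
congr (tuple_cons (_, tuple_cons (_, _))).
  by transitivity ((c ^+ 2 + s ^+ 2) * a)%R; [ring|rewrite cs mul1r].
by transitivity ((c ^+ 2 + s ^+ 2) * b)%R; [ring|rewrite cs mul1r].
Qed.

Lemma row_givens n (c s a b : R) :
  row_mx a%:M (row_mx b%:M 0) *m givens n c s =
  row_mx (a * c + b * s)%:M (row_mx (- a * s + b * c)%:M 0).
Proof.
rewrite /givens; set B := block_mx _ _ _ _.
rewrite (@mul_row_block _ 1 1 (1 + n) 1 (1 + n)) mul_row_col mul0mx addr0.
rewrite -!scalar_mxM -scalar_mx_add; congr row_mx.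
rewrite mul_mx_row mulmx0 -scalar_mxM /B.
rewrite (@mul_row_block _ 1 1 n 1 n) !mulmx0 !mul0mx !addr0 -scalar_mxM.
by rewrite add_row_mx addr0 -scalar_mx_add mulrN mulNr.
Qed.

Lemma ginv_givens n c s : (c ^+ 2 + s ^+ 2 = 1)%R -> s != 0%R -> ginv (givens n c s).
Proof.
move=> cs s0 f mf f0.
have mF : measurable_fun setT (fun z : R * R * n.-tuple R =>
    f (tuple_cons (z.1.1, tuple_cons (z.1.2, z.2)))).
  apply: measurableT_comp => //.
  apply: (measurableT_comp (@measurable_tuple_cons _ _ n.+1)).
  apply: measurable_fun_pair; first exact: measurableT_comp measurable_fst measurable_fst.
  apply: (measurableT_comp (@measurable_tuple_cons _ _ n)).
  apply: measurable_fun_pair => //; exact: measurableT_comp measurable_snd measurable_fst.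
pose F (z : R * R) := \int[gaussn n]_v f (tuple_cons (z.1, tuple_cons (z.2, v))).
have mF2 : measurable_fun setT F.
  exact: (@measurable_fun_fubini_tonelli_F _ _ _ _ _ (gaussn n) _ mF).
have F0 z : 0 <= F z by apply: integral_ge0.
have step (k : n.+2.-tuple R -> \bar R) : measurable_fun setT k -> (forall x, 0 <= k x) ->
    \int[gaussn n.+2]_x k x = \int[gauss]_x \int[gauss]_y
      \int[gaussn n]_v k (tuple_cons (x, tuple_cons (y, v))).
  move=> mk k0; rewrite ge0_integral_iidmS//; apply: eq_integral => x _.
  by rewrite ge0_integral_iidmS//; exact: measurable_f_cons.
rewrite [LHS]step//; last exact: measurable_f_lin.
rewrite [RHS](step f mf f0).
apply: etrans _ (ge0_integral_rot_gauss mF2 F0 cs s0).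
apply: eq_integral => x _; apply: eq_integral => y _.
by rewrite /F/=; apply: eq_integral => v _; rewrite lin_givens.
Qed.

Lemma ge0_integral_gauss_opp (f : R -> \bar R) :
  measurable_fun setT f -> (forall x, 0 <= f x) ->
  \int[gauss]_x f (- x)%R = \int[gauss]_x f x.
Proof.
move=> mf f0.
(* Quarter turn: the first coordinate becomes minus the second. *)
have := @ge0_integral_rot_gauss R 0 1 (fun z => f z.1).
rewrite expr0n/= expr1n add0r oner_neq0.
move=> /(_ (measurableT_comp mf measurable_fst) (fun=> f0 _) erefl isT).
under eq_integral do under eq_integral do rewrite mul0r mul1r add0r.
rewrite integral_prob_cst => ->.
by apply: eq_integral => x _; rewrite integral_prob_cst.
Qed.

Lemma ginv_flip n : ginv (block_mx (- 1)%:M 0 0 1%:M : 'M[R]_(1 + n)).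
Proof.
move=> f mf f0.
rewrite ge0_integral_iidmS//; last exact: measurable_f_lin.
rewrite [RHS](ge0_integral_iidmS _ mf f0).
rewrite -[RHS](ge0_integral_gauss_opp); last 2 first.
- exact: measurable_integral_iidm.
- by move=> x; exact: integral_ge0.
apply: eq_integral => x _; apply: eq_integral => v _.
by rewrite lin_block mulN1r lin1.
Qed.

Local Close Scope ereal_scope.

(** Givens elimination: by induction the tail of v is carried to a multiple b of its first unit
    vector, then a plane rotation merges b into the leading entry. *)
Lemma ginv_align n (v : 'rV[R]_(1 + n)) : exists Q : 'M[R]_(1 + n),
  [/\ ginv Q, Q *m Q^T = 1%:M & exists2 a : R, (0 <= a)%R & v *m Q = row_mx a%:M 0].
Proof.
elim: n v => [|n IH] v.
  pose v0 := lsubmx v 0 0.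
  have vE : v = row_mx v0%:M 0.
    by rewrite -[LHS](@hsubmxK _ 1 1 0) (thinmx0 (rsubmx v)) (mx11_scalar (lsubmx v)).
  have [v0p|v0n] := leP 0 v0.
    exists 1%:M; split; [exact: ginv1|by rewrite trmx1 mulmx1|exists v0 => //].
    by rewrite mulmx1.
  exists (block_mx (-1)%:M 0 0 1%:M); split; first exact: ginv_flip.
    rewrite tr_block_mx mulmx_block !tr_scalar_mx !trmx0 !mul0mx !mulmx0 !addr0 !add0r.
    by rewrite mulmx1 -scalar_mxM mulrNN mulr1 -scalar_mx_block.
  exists (- v0); first by rewrite oppr_ge0 ltW.
  by rewrite vE mul_row_block !mulmx0 mul0mx !addr0 -scalar_mxM mulrN1.
pose v0 : R := v 0 0; pose v' : 'rV[R]_(1 + n) := rsubmx (v : 'rV[R]_(1 + (1 + n))).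
have vE : v = row_mx v0%:M v' :> 'rV[R]_(1 + (1 + n)).
  rewrite -[LHS](@hsubmxK _ 1 1); congr row_mx.
  apply/rowP => i; rewrite !mxE !ord1 eqxx mulr1n; congr (v _ _); exact/val_inj.
have [Q' [gQ' oQ' [b b0 vQ']]] := IH v'.
pose Q1 : 'M[R]_(1 + (1 + n)) := block_mx 1%:M 0 0 Q'.
have oQ1 : Q1 *m Q1^T = 1%:M.
  rewrite /Q1 tr_block_mx mulmx_block trmx1 !trmx0 !mul0mx !mulmx0 !addr0 !add0r.
  by rewrite oQ' mulmx1 -scalar_mx_block.
have vQ1 : v *m Q1 = row_mx v0%:M (row_mx b%:M 0).
  by rewrite vE /Q1 mul_row_block !mulmx0 addr0 add0r mulmx1 vQ'.
have gQ1 : ginv Q1 by exact: ginv_block.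
(* For b = 0 the rotation would have sine 0, which [ginv_givens] excludes; at most a sign flip
   remains to be done. *)
have [bz|bz] := eqVneq b 0%R.
  have [v0p|v0n] := leP 0%R v0.
    exists Q1; split => //; exists v0 => //.
    by rewrite vQ1 bz raddf0 row_mx0.
  exists (Q1 *m block_mx (-1)%:M 0 0 1%:M); split.
  - by apply: ginvM => //; exact: ginv_flip.
  - rewrite trmx_mul mulmxA -[X in X *m _](mulmxA Q1).
    rewrite tr_block_mx mulmx_block !tr_scalar_mx !trmx0 !mul0mx !mulmx0 !addr0 !add0r.
    by rewrite mulmx1 -scalar_mxM mulrNN mulr1 -scalar_mx_block mulmx1.
  - exists (- v0); first by rewrite oppr_ge0 ltW.
    rewrite mulmxA vQ1 bz raddf0 row_mx0.
    by rewrite mul_row_block !mulmx0 mul0mx !addr0 -scalar_mxM mulrN1.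
pose rho := Num.sqrt (v0 ^+ 2 + b ^+ 2).
have rho2 : (rho ^+ 2 = v0 ^+ 2 + b ^+ 2)%R by rewrite sqr_sqrtr// addr_ge0// sqr_ge0.
have rho0 : (0 < rho)%R.
  rewrite sqrtr_gt0 ltr_wpDl ?sqr_ge0// lt0r sqr_ge0 andbT.
  by rewrite expf_neq0.
pose c := (v0 / rho)%R; pose s := (b / rho)%R.
have cs : (c ^+ 2 + s ^+ 2 = 1)%R.
  rewrite /c /s !exprMn -mulrDl -rho2 exprVn divff// expf_neq0// gt_eqF//.
have s0 : s != 0%R by rewrite mulf_neq0// invr_neq0// gt_eqF.
exists (Q1 *m givens n c s); split.
- by apply: ginvM => //; exact: ginv_givens.
- rewrite trmx_mul mulmxA -[X in X *m _](mulmxA Q1).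
  have -> : givens n c s *m (givens n c s)^T = 1%:M.
    by rewrite tr_givens givens_orth.
  by rewrite mulmx1.
- exists rho; first exact: ltW.
  rewrite mulmxA vQ1 row_givens; congr row_mx.
    congr (_%:M); rewrite /c /s; transitivity (rho ^+ 2 / rho)%R; last first.
      by rewrite expr2 mulfK// gt_eqF.
    by rewrite rho2; field; rewrite gt_eqF.
  rewrite [X in X%:M](_ : _ = 0)%R; last by rewrite /c /s; field; rewrite gt_eqF.
  by rewrite raddf0 row_mx0.
Qed.

Local Open Scope ereal_scope.

(** Induction on the number of rows. Aligned with the first axis, the first row becomes (1, 0),
    since it has norm 1 and a >= 0; orthogonality empties the first column of the other rows, and
    the remaining block again has orthonormal rows. *)
Lemma ge0_integral_gaussn_lin m n (W : 'M[R]_(m, n)) (f : m.-tuple R -> \bar R) :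
  W *m W^T = 1%:M -> measurable_fun setT f -> (forall x, 0 <= f x) ->
  \int[gaussn n]_x f (lin W x) = \int[gaussn m]_x f x.
Proof.
elim: m n W f => [|m IH] n W f oW mf f0.
  rewrite integral_iidm0//.
  under eq_integral do rewrite (tuple0 (lin W _)).
  exact: integral_prob_cst.
case: n => [|n] in W oW *.
  move: oW; rewrite (flatmx0 W^T) mulmx0 => /matrixP /(_ ord0 ord0)/eqP.
  by rewrite !mxE eqxx eq_sym mulr1n oner_eq0.
pose w : 'rV[R]_(1 + n) := usubmx (W : 'M[R]_(1 + m, 1 + n)).
have [Q [gQ oQ [a a0 wQ]]] := ginv_align w.
pose U : 'M[R]_(1 + m, 1 + n) := W *m Q.
have oU : U *m U^T = 1%:M by rewrite trmx_mul mulmxA -[X in X *m _](mulmxA W) oQ mulmx1.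
have uU : usubmx U = row_mx a%:M 0 by rewrite /U -mul_usub_mx.
have UE : U = block_mx a%:M 0 (dlsubmx U) (drsubmx U).
  rewrite -[LHS]submxK; congr block_mx; rewrite /ulsubmx /ursubmx uU.
    by rewrite row_mxKl.
  by rewrite row_mxKr.
move: (oU); rewrite UE tr_block_mx mulmx_block !trmx0 !mul0mx !mulmx0 !addr0.
rewrite (@scalar_mx_block _ 1 m) => /eq_block_mx[aa _ dla drr].
have a1 : a = 1%R.
  move: aa => /matrixP /(_ ord0 ord0); rewrite tr_scalar_mx -scalar_mxM !mxE eqxx !mulr1n.
  by move=> /eqP; rewrite -expr2 sqrf_eq1 => /orP[/eqP->//|/eqP a1]; lra.
have dl0 : dlsubmx U = 0%R.
  by move: dla; rewrite a1 tr_scalar_mx mulmx1.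
apply: etrans (esym (gQ (fun x => f (lin W x)) (measurable_f_lin _ mf) (fun=> f0 _))) _.
have {}UE : W *m Q = block_mx 1%:M 0 0 (drsubmx U) :> 'M[R]_(1 + m, 1 + n).
  by rewrite -[LHS]/U {1}UE dl0 a1.
transitivity (\int[gaussn n.+1]_x
    f (lin (block_mx 1%:M 0 0 (drsubmx U) : 'M[R]_(1 + m, 1 + n)) x)).
  by apply: eq_integral => x _; rewrite -UE linM.
rewrite ge0_integral_iidmS//; last exact: measurable_f_lin.
rewrite [RHS](ge0_integral_iidmS _ mf f0); apply: eq_integral => x _.
rewrite -(IH n (drsubmx U) (fun v => f (tuple_cons (x, v))))//; first last.
- exact: measurable_f_cons.
- by move: drr; rewrite dl0 mul0mx add0r.
apply: eq_integral => v _; congr f.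
rewrite /lin tcol_cons mul_block_col !mul0mx addr0 add0r mul1mx.
by rewrite ctup_col.
Qed.

End tuple_matrix.

(** * Concatenation and shifts of Gaussian tuples *)

Section iid_cat.
Context {d} {T : measurableType d} {R : realType} (mu : probability T R).
Local Open Scope ereal_scope.

Lemma measurable_cat_tuple a b :
  measurable_fun setT (fun z : a.-tuple T * b.-tuple T => [tuple of z.1 ++ z.2]).
Proof.
apply/measurable_fun_tnthP => i.
case: (splitP i) => j ij.
  rewrite (_ : _ \o _ = fun z : a.-tuple T * b.-tuple T => tnth z.1 j).
    by apply: (measurableT_comp (measurable_tnth j)).
  apply/funext => -[x y] /=; rewrite -(tnth_lshift x y j); congr tnth.
  exact/val_inj.
rewrite (_ : _ \o _ = fun z : a.-tuple T * b.-tuple T => tnth z.2 j).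
  by apply: (measurableT_comp (measurable_tnth j)).
apply/funext => -[x y] /=; rewrite -(tnth_rshift x y j); congr tnth.
exact/val_inj.
Qed.

Lemma measurable_f_cat a b (f : (a + b).-tuple T -> \bar R) :
  measurable_fun setT f ->
  measurable_fun setT (fun z : a.-tuple T * b.-tuple T => f [tuple of z.1 ++ z.2]).
Proof. by move=> mf; exact: (measurableT_comp mf (@measurable_cat_tuple a b)). Qed.

Lemma ge0_integral_iidm_cat a b (f : (a + b).-tuple T -> \bar R) :
  measurable_fun setT f -> (forall x, 0 <= f x) ->
  \int[iidm mu (a + b)]_x f x =
  \int[iidm mu a]_x \int[iidm mu b]_y f [tuple of x ++ y].
Proof.
elim: a f => [|a IH] f mf f0.
  rewrite integral_iidm0//; last first.
    apply: (@measurable_fun_fubini_tonelli_F _ _ _ _ _ (iidm mu b)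
      (fun z : 0.-tuple T * b.-tuple T => f [tuple of z.1 ++ z.2])) => //.
    exact: (@measurable_f_cat 0 b f mf).
  by apply: eq_integral => y _; congr f; exact/val_inj.
have mfc : measurable_fun setT
    (fun z : a.+1.-tuple T * b.-tuple T => f [tuple of z.1 ++ z.2]).
  exact: (@measurable_f_cat a.+1 b f mf).
rewrite [RHS]ge0_integral_iidmS; last 2 first.
- exact: (@measurable_fun_fubini_tonelli_F _ _ _ _ _ (iidm mu b) _ mfc).
- by move=> x; exact: integral_ge0.
rewrite [LHS](@ge0_integral_iidmS _ _ _ mu (a + b))//.
apply: eq_integral => x _.
rewrite (IH (fun v => f (tuple_cons (x, v)))); [|  |by []].
  apply: eq_integral => u _; apply: eq_integral => y _; congr f; exact/val_inj.
apply: measurableT_comp => //.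
exact: (measurableT_comp (@measurable_tuple_cons _ _ (a + b)) (pair1_measurable x)).
Qed.

Lemma integral_iidm_marginal n (j : 'I_n) (g : T -> R) (c : R) :
  measurable_fun setT g -> (forall x, (0 <= g x)%R) ->
  \int[mu]_x (g x)%:E = c%:E ->
  \int[iidm mu n]_x (g (tnth x j))%:E = c%:E.
Proof.
move=> mg g0 gc.
pose h (i : 'I_n) x : R := if i == j then g x else 1%R.
have := @integral_iidm_prod _ _ _ mu n h (fun i => if i == j then c else 1%R).
have pE (F : 'I_n -> R) : (\prod_(i < n) (if i == j then F i else 1) = F j)%R.
  by rewrite -big_mkcond big_pred1_eq.
rewrite (pE (fun=> c)) => <-.
- by apply: eq_integral => x _; rewrite /h (pE (fun i => g (tnth x i))).
- by move=> i; rewrite /h; case: (i == j) => //; exact: measurable_cst.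
- by move=> i x; rewrite /h; case: ifP.
- move=> i; rewrite /h; case: (i == j) => //.
  exact: integral_prob_cst.
Qed.

End iid_cat.

Section gaussn.
Context {R : realType}.
Local Open Scope ereal_scope.
Notation gaussn := (iidm (@gauss R)).

(** The block row [M B] has orthonormal rows. This is how independent noise B y completes a vector M
    x of too small covariance to a standard Gaussian one. *)
Lemma ge0_integral_gaussn_lin2 m a b (M : 'M[R]_(m, a)) (B : 'M[R]_(m, b))
    (f : m.-tuple R -> \bar R) :
  (M *m M^T + B *m B^T)%R = 1%:M -> measurable_fun setT f -> (forall x, 0 <= f x) ->
  \int[gaussn a]_x \int[gaussn b]_y f (ctup (M *m tcol x + B *m tcol y)%R) =
  \int[gaussn m]_x f x.
Proof.
move=> MB mf f0.
rewrite -(@ge0_integral_gaussn_lin R m (a + b) (row_mx M B))//; last first.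
  by rewrite tr_row_mx mul_row_col.
rewrite (ge0_integral_iidm_cat _ (measurable_f_lin (row_mx M B) mf) (fun x => f0 _)).
apply: eq_integral => x _; apply: eq_integral => y _; congr f; congr ctup.
rewrite -mul_row_col; congr mulmx; apply/colP => i; rewrite !mxE.
case: splitP => j ij; rewrite mxE !(tnth_nth 0%R)/= nth_cat size_tuple ij.
  by rewrite ltn_ord.
by rewrite ltnNge leq_addr/= addKn.
Qed.

Definition tadd n (x : n.-tuple R) (t : 'I_n -> R) : n.-tuple R :=
  [tuple (tnth x i + t i)%R | i < n].

Lemma measurable_tadd n (t : 'I_n -> R) : measurable_fun setT (fun x : n.-tuple R => tadd x t).
Proof.
apply: measurable_tupleP => i; under eq_fun do rewrite tnth_mktuple.
by apply: measurable_funD => //; exact: measurable_tnth.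
Qed.

Lemma tadd_cons n (t : 'I_n.+1 -> R) x v :
  tadd (tuple_cons (x, v)) t = tuple_cons (x + t ord0, tadd v (fun i => t (lift ord0 i)))%R.
Proof.
apply: eq_from_tnth => i; rewrite tnth_mktuple.
case: (unliftP ord0 i) => [j|] ->; last by rewrite !(tnth_nth 0%R).
by rewrite !tnthS tnth_mktuple.
Qed.

Lemma ge0_integral_gaussn_shift n (t : 'I_n -> R) (f : n.-tuple R -> \bar R) :
  measurable_fun setT f -> (forall x, 0 <= f x) ->
  \int[gaussn n]_x f (tadd x t) =
  \int[gaussn n]_x (f x * (\prod_i expR (t i * tnth x i - t i ^+ 2 / 2))%:E).
Proof.
have mE m (u : 'I_m -> R) : measurable_fun setT
    (fun x : m.-tuple R => (\prod_i expR (u i * tnth x i - u i ^+ 2 / 2))%:E).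
  apply/measurable_EFinP; apply: measurable_prod => i _.
  apply: measurableT_comp => //; apply: measurable_funB => //.
  by apply: measurable_funM => //; exact: measurable_tnth.
have E0 m (u : 'I_m -> R) (x : m.-tuple R) :
    (0 <= \prod_i expR (u i * tnth x i - u i ^+ 2 / 2))%R.
  by apply: prodr_ge0 => i _; exact: expR_ge0.
elim: n t f => [|n IH] t f mf f0.
  rewrite !integral_iidm0//.
  - by rewrite big_ord0 mule1 (tuple0 (tadd _ _)).
  - by apply: emeasurable_funM => //; exact: mE.
  - by apply: measurableT_comp => //; exact: measurable_tadd.
rewrite ge0_integral_iidmS//; last first.
  by apply: measurableT_comp => //; exact: measurable_tadd.
rewrite [RHS]ge0_integral_iidmS; last 2 first.
- by apply: emeasurable_funM => //; exact: mE.
- by move=> x; rewrite mule_ge0// lee_fin.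
under eq_integral do under eq_integral do rewrite tadd_cons.
pose g := fun x => \int[gaussn n]_v
  f (tuple_cons (x, tadd v (fun i => t (lift ord0 i)))).
have mg : measurable_fun setT g.
  apply: (@measurable_fun_fubini_tonelli_F _ _ _ _ _ (gaussn n)
    (fun z : R * n.-tuple R => f (tuple_cons (z.1, tadd z.2 (fun i => t (lift ord0 i)))))) => //.
  apply: measurableT_comp => //.
  apply: (measurableT_comp (@measurable_tuple_cons _ _ n)).
  apply: measurable_fun_pair => //; apply: (measurableT_comp (measurable_tadd _)) => //.
rewrite (@ge0_integral_gauss_shift R (t ord0) g mg)//; last by move=> x; exact: integral_ge0.
apply: eq_integral => x _; rewrite /g.
rewrite (IH (fun i => t (lift ord0 i)) (fun v => f (tuple_cons (x, v))))//; last first.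
  exact: measurable_f_cons.
rewrite -ge0_integralZr//; last 2 first.
- by apply: emeasurable_funM; [exact: measurable_f_cons|exact: mE].
- by move=> v _; rewrite mule_ge0// lee_fin.
apply: eq_integral => v _; rewrite -muleA -EFinM; congr (_ * EFin _).
rewrite big_ord_recl [RHS]mulrC; congr (_ * _)%R.
by apply: eq_bigr => i _; rewrite tnthS.
Qed.

End gaussn.

(** * Truncated second moment for a sparse block prior *)

Section block_prior.
Context {R : realType} {s b p : nat} (pos : 'I_s -> 'I_b -> 'I_p).
Hypothesis pos_inj : forall i k i' k', pos i k = pos i' k' -> i = i' /\ k = k'.
Implicit Types f g : {ffun 'I_s -> 'I_b}.

Definition hit f (j : 'I_p) : bool := [exists i, j == pos i (f i)].

Lemma hit_pos f i k : hit f (pos i k) = (f i == k).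
Proof.
apply/existsP/eqP => [[i' /eqP /pos_inj[<- ->]//]|<-].
by exists i.
Qed.

Lemma prod_hit f (F : 'I_p -> R) :
  \prod_j (if hit f j then F j else 1) = \prod_i F (pos i (f i)).
Proof.
rewrite -big_mkcond/=.
rewrite (eq_bigl (fun j => j \in [set pos i (f i) | i in [set: 'I_s]]%SET)); last first.
  move=> j; apply/existsP/imsetP => [[i /eqP ->]|[i _ ->]]; first by exists i.
  by exists i.
rewrite big_imset/=; last by move=> i i' _ _ /pos_inj[].
by apply: eq_bigl => i; rewrite inE.
Qed.

(** For two draws f and g of the prior, a coordinate hit by both contributes v and one hit by a
    single draw contributes m. Grouped by block, equal positions give v and different ones m
    twice. *)
Lemma prod_hit2 f g (v m : R) :
  \prod_j (if hit f j then (if hit g j then v else m) else if hit g j then m else 1) =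
  \prod_i (if f i == g i then v else m ^+ 2).
Proof.
transitivity (\prod_j ((if hit f j then (if hit g j then v else m) else 1) *
   (if hit g j then (if hit f j then 1 else m) else 1))).
  by apply: eq_bigr => j _; case: (hit f j); case: (hit g j); rewrite ?mulr1 ?mul1r.
rewrite big_split/= (prod_hit f (fun j => if hit g j then v else m)).
rewrite (prod_hit g (fun j => if hit f j then 1 else m)) -big_split/=.
by apply: eq_bigr => i _; rewrite !hit_pos eq_sym; case: ifP => _; rewrite ?mulr1 ?expr2.
Qed.

(** Whatever f is, the values of g are chosen independently in the blocks, so the sum over g is a
    product of s equal sums: one agreement and b - 1 disagreements. *)
Lemma sum_overlap (v m : R) :
  \sum_(f : {ffun 'I_s -> 'I_b}) \sum_(g : {ffun 'I_s -> 'I_b}) \prod_i (if f i == g i then v else m ^+ 2) =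
  (b%:R * (v + b.-1%:R * m ^+ 2)) ^+ s.
Proof.
under eq_bigr => f _.
  rewrite -(bigA_distr_bigA (fun i k => if f i == k then v else m ^+ 2))/=.
  under eq_bigr => i _.
    rewrite (bigD1 (f i))//= eqxx.
    under eq_bigr => k /negbTE kf do rewrite eq_sym kf.
    rewrite sumr_const cardC1 card_ord -[_ *+ _]mulr_natl.
    over.
  over.
rewrite /= !prodr_const sumr_const card_ffun !card_ord exprMn -[_ *+ _]mulr_natl natrX.
by [].
Qed.

Variables (theta t : R).

Definition spike f : 'I_p -> R := fun j => if hit f j then theta else 0.

(* Likelihood ratio of N(theta, 1) against N(0, 1), truncated at level t. *)
Definition trlik (z : R) : R := expR (theta * z - theta ^+ 2 / 2) * \1_[set z | z <= t] z.

Lemma trlik_ge0 z : 0 <= trlik z.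
Proof. by rewrite mulr_ge0 ?expR_ge0. Qed.

Lemma measurable_le_set : measurable ([set z : R | z <= t] : set R).
Proof. by rewrite -set_itvNyc. Qed.

Lemma measurable_gt_set (u : R) : measurable ([set z : R | u < z] : set R).
Proof. by rewrite -set_itvoy. Qed.

Lemma measurable_trlik : measurable_fun setT trlik.
Proof.
apply: measurable_funM; last by apply: measurable_indic; exact: measurable_le_set.
by apply: measurableT_comp => //; apply: measurable_funB.
Qed.

Local Open Scope ereal_scope.
Notation gaussn := (iidm (@gauss R)).

Variables (m v q a : R).
Hypotheses (mE : \int[gauss]_z (trlik z)%:E = m%:E)
  (vE : \int[gauss]_z (trlik z ^+ 2)%:E = v%:E)
  (qE : \int[gauss]_z (\1_[set z : R | (t - theta < z)%R] z)%:E = q%:E).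

Definition Lf f (x : p.-tuple R) : R := (\prod_j (if hit f j then trlik (tnth x j) else 1))%R.

Lemma Lf_ge0 f x : (0 <= Lf f x)%R.
Proof. by apply: prodr_ge0 => j _; case: ifP => // _; exact: trlik_ge0. Qed.

Lemma measurable_Lf f : measurable_fun setT (Lf f).
Proof.
apply: measurable_prod => j _; case: (hit f j); last exact: measurable_cst.
exact: (measurableT_comp measurable_trlik (measurable_tnth j)).
Qed.

Lemma integral_Lf f : \int[gaussn p]_x (Lf f x)%:E = (m ^+ s)%:E.
Proof.
rewrite /Lf (@integral_iidm_prod _ _ _ _ p (fun j z => if hit f j then trlik z else 1%R)
  (fun j => if hit f j then m else 1%R)).
- by rewrite (prod_hit f (fun=> m)) prodr_const card_ord.
- by move=> j; case: (hit f j); [exact: measurable_trlik|exact: measurable_cst].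
- by move=> j z; case: ifP => // _; exact: trlik_ge0.
- by move=> j; case: (hit f j); [exact: mE|exact: integral_prob_cst].
Qed.

Lemma integral_LfLg f g : \int[gaussn p]_x (Lf f x * Lf g x)%:E =
  (\prod_i (if f i == g i then v else m ^+ 2))%:E.
Proof.
rewrite -(prod_hit2 f g) /Lf.
under eq_integral do rewrite -big_split/=.
rewrite (@integral_iidm_prod _ _ _ _ p
  (fun j z => (if hit f j then trlik z else 1) * (if hit g j then trlik z else 1))%R
  (fun j => if hit f j then (if hit g j then v else m) else if hit g j then m else 1%R)) //.
- move=> j; apply: measurable_funM; case: (hit _ j);
    by [exact: measurable_trlik|exact: measurable_cst].
- by move=> j z; rewrite mulr_ge0//; case: ifP => // _; exact: trlik_ge0.
- move=> j; case: (hit f j); case: (hit g j).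
  + by rewrite -vE; apply: eq_integral => z _; rewrite expr2.
  + by rewrite -mE; apply: eq_integral => z _; rewrite mulr1.
  + by rewrite -mE; apply: eq_integral => z _; rewrite mul1r.
  + by rewrite mulr1; exact: integral_prob_cst.
Qed.

Hypotheses (b0 : (0 < b)%N) (m01 : (0 <= m <= 1)%R) (a0 : (0 < a)%R).
Hypothesis aE : (((v + b.-1%:R * m ^+ 2) / b%:R) ^+ s - m ^+ (2 * s) <= a ^+ 2)%R.

Let K : R := (b ^ s)%:R.
Let K0 : (0 < K)%R. Proof. by rewrite /K ltr0n expn_gt0 b0. Qed.
(** Likelihood ratio of the prior mixture, up to truncation; the truncation makes its null mean m ^
    s instead of 1, so it is centred at m ^ s below. *)
Definition Lbar x : R := ((\sum_(f : {ffun 'I_s -> 'I_b}) Lf f x) / K)%R.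

Lemma measurable_Lbar : measurable_fun setT Lbar.
Proof.
apply: measurable_funM => //; apply: measurable_sum => f; exact: measurable_Lf.
Qed.

Lemma Lbar_ge0 x : (0 <= Lbar x)%R.
Proof.
by apply: divr_ge0; [apply: sumr_ge0 => f _; exact: Lf_ge0|exact: ltW].
Qed.

Lemma integral_Lbar : \int[gaussn p]_x (Lbar x)%:E = (m ^+ s)%:E.
Proof.
rewrite /Lbar; under eq_integral do rewrite mulrC.
rewrite integral_finZl; last 3 first.
- by apply: measurable_sum => f; exact: measurable_Lf.
- by move=> x; apply: sumr_ge0 => f _; exact: Lf_ge0.
- by rewrite invr_ge0 ltW.
rewrite integral_fin_sum; [|exact: measurable_Lf|exact: Lf_ge0].
under eq_bigr do rewrite integral_Lf.
rewrite sumEFin -EFinM; congr EFin.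
rewrite sumr_const card_ffun !card_ord -[(_ *+ _)%R]mulr_natl mulrA mulVf ?mul1r//.
by rewrite gt_eqF.
Qed.

Lemma integral_Lbar2 : \int[gaussn p]_x (Lbar x ^+ 2)%:E =
  (((v + b.-1%:R * m ^+ 2) / b%:R) ^+ s)%:E.
Proof.
have E x : (Lbar x ^+ 2 = (K ^+ 2)^-1 *
    \sum_(f : {ffun 'I_s -> 'I_b}) \sum_(g : {ffun 'I_s -> 'I_b}) (Lf f x * Lf g x))%R.
  rewrite /Lbar exprMn exprVn mulrC; congr (_ * _)%R.
  rewrite expr2 mulr_suml; apply: eq_bigr => f _.
  by rewrite mulr_sumr.
under eq_integral do rewrite E.
have mL f g : measurable_fun setT (fun x => Lf f x * Lf g x)%R.
  by apply: measurable_funM; exact: measurable_Lf.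
have L0 f g x : (0 <= Lf f x * Lf g x)%R by rewrite mulr_ge0 ?Lf_ge0.
rewrite integral_finZl; last 3 first.
- by apply: measurable_sum => f; exact: measurable_sum.
- by move=> x; apply: sumr_ge0 => f _; exact: sumr_ge0.
- by rewrite invr_ge0 sqr_ge0.
rewrite integral_fin_sum; last 2 first.
- by move=> f; exact: measurable_sum.
- by move=> f x; exact: sumr_ge0.
under eq_bigr => f _.
  rewrite integral_fin_sum//.
  under eq_bigr do rewrite integral_LfLg.
  rewrite sumEFin; over.
rewrite sumEFin sum_overlap -EFinM; congr EFin.
rewrite /K natrX -exprM mulnC exprM -exprVn -exprMn; congr (_ ^+ _)%R.
by field; rewrite pnatr_eq0 -lt0n.
Qed.

Lemma integral_Lbar_sqr : \int[gaussn p]_x ((Lbar x - m ^+ s) ^+ 2)%:E <= (a ^+ 2)%:E.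
Proof.
have m0 : (0 <= m ^+ s)%R by case/andP: m01 => ? _; rewrite exprn_ge0.
have mL := measurable_Lbar.
(* The square is expanded with its cross term on the left, so that only nonnegative functions are
   integrated. *)
have H : \int[gaussn p]_x ((Lbar x - m ^+ s) ^+ 2)%:E + (2 * m ^+ s * m ^+ s)%:E =
    (((v + b.-1%:R * m ^+ 2) / b%:R) ^+ s + (m ^+ s) ^+ 2)%:E.
  rewrite EFinM -integral_Lbar -integral_finZl//; last 2 first.
  - exact: Lbar_ge0.
  - by rewrite mulr_ge0.
  rewrite -integral_finD; last 4 first.
  - by apply: measurable_funX; apply: measurable_funB.
  - by apply: measurable_funM.
  - by move=> x; rewrite sqr_ge0.
  - by move=> x; apply: mulr_ge0; [exact: mulr_ge0|exact: Lbar_ge0].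
  rewrite EFinD -integral_Lbar2 -[X in _ = _ + X](integral_prob_cst (gaussn p)).
  rewrite -integral_finD; last 4 first.
  - by apply: measurable_funX.
  - exact: measurable_cst.
  - by move=> x; rewrite sqr_ge0.
  - by move=> x; rewrite sqr_ge0.
  by apply: eq_integral => x _; congr EFin; ring.
rewrite -(leeD2rE _ _ (_ : (2 * m ^+ s * m ^+ s)%:E \is a fin_num))// H -EFinD lee_fin.
by move: aE; rewrite mulnC exprM; lra.
Qed.

(** Truncation costs q per spike by a union bound. On what remains, the shift formula turns the
    average power into the null mean of T [Lbar]; there m ^ s <= 1 leaves the size of T, and the
    fluctuation of [Lbar] around m ^ s adds at most a. *)
Lemma block_prior_upper (T : p.-tuple R -> R) :
  measurable_fun setT T -> (forall x, 0 <= T x <= 1)%R ->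
  K^-1%:E * \sum_(f : {ffun 'I_s -> 'I_b}) \int[gaussn p]_x (T (tadd x (spike f)))%:E <=
  \int[gaussn p]_x (T x)%:E + (s%:R * q + a)%:E.
Proof.
move=> mT T01.
have T0 x : (0 <= T x)%R by case/andP: (T01 x).
have T1 x : (T x <= 1)%R by case/andP: (T01 x).
(* T restricted to the event that no spiked coordinate exceeds t. *)
pose F f x : R := (T x * \prod_j (if hit f j then \1_[set z : R | z <= t] (tnth x j) else 1))%R.
have mF f : measurable_fun setT (F f).
  apply: measurable_funM => //; apply: measurable_prod => j _.
  case: (hit f j); last exact: measurable_cst.
  apply: (measurableT_comp _ (measurable_tnth j)).
  by apply: measurable_indic; exact: measurable_le_set.
have F0 f x : (0 <= F f x)%R.
  by rewrite mulr_ge0// prodr_ge0// => j _; case: ifP.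
have mg : measurable_fun setT (\1_[set z : R | (t - theta < z)%R] : R -> R).
  by apply: measurable_indic; exact: measurable_gt_set.
have step1 f : \int[gaussn p]_x (T (tadd x (spike f)))%:E <=
    \int[gaussn p]_x (T x * Lf f x)%:E + (s%:R * q)%:E.
  have E1 : \int[gaussn p]_x (F f (tadd x (spike f)))%:E =
      \int[gaussn p]_x (T x * Lf f x)%:E.
    rewrite (@ge0_integral_gaussn_shift R p (spike f) (fun x => (F f x)%:E))//.
    + apply: eq_integral => x _; rewrite -EFinM /F -mulrA; congr ((_ * _)%R%:E).
      rewrite -big_split/=; apply: eq_bigr => j _; rewrite /spike.
      case: ifP => _; first by rewrite mulrC.
      by rewrite !mul0r expr0n/= mul0r subr0 expR0 mulr1.
    + exact/measurable_EFinP.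
    + by move=> x; rewrite lee_fin.
  pose S f x : R := (\sum_i \1_[set z : R | (t - theta < z)%R] (tnth x (pos i (f i))))%R.
  have mSi i : measurable_fun setT
      (fun x : p.-tuple R => \1_[set z : R | (t - theta < z)%R] (tnth x (pos i (f i))) : R).
    exact: (measurableT_comp mg (measurable_tnth _)).
  have mS : measurable_fun setT (S f) by apply: measurable_sum.
  have S0 x : (0 <= S f x)%R by apply: sumr_ge0.
  have E2 : \int[gaussn p]_x (S f x)%:E = (s%:R * q)%:E.
    rewrite /S integral_fin_sum//.
    under eq_bigr => i _.
      rewrite (@integral_iidm_marginal _ _ _ _ p (pos i (f i)) _ q mg)//.
      over.
    by rewrite sumEFin sumr_const card_ord -[(_ *+ _)%R]mulr_natl.
  have mFs := measurableT_comp (mF f) (measurable_tadd (spike f)).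
  rewrite -E1 -E2 -(integral_finD (gaussn p) mFs mS (fun x => F0 f _) S0).
  apply: le_integral_fin => //.
  - exact: (measurableT_comp mT (measurable_tadd _)).
  - by apply: measurable_funD.
  move=> x; rewrite /S /F.
  have /= -> := prod_hit f (fun j => \1_[set z : R | (z <= t)%R] (tnth (tadd x (spike f)) j) : R).
  (* Either some spiked coordinate is above t, so its noise is above t - theta and [S] is at least
     1, or [F] agrees with T. *)
  have [/existsP[i hi]|/existsPn hi] :=
      boolP [exists i, t < tnth (tadd x (spike f)) (pos i (f i))]%R.
    apply: (le_trans (T1 _)); rewrite -[leLHS]add0r lerD//.
      by rewrite mulr_ge0// prodr_ge0.
    rewrite (bigD1 i)//= indicE mem_set/=; first by rewrite lerDl sumr_ge0.
    by move: hi; rewrite tnth_mktuple /spike hit_pos eqxx ltrBlDr.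
  rewrite big1 ?mulr1 ?lerDl ?sumr_ge0// => i _.
  by rewrite indicE mem_set//= leNgt; exact: hi.
have step2 : K^-1%:E * \sum_(f : {ffun 'I_s -> 'I_b}) \int[gaussn p]_x (T (tadd x (spike f)))%:E <=
    \int[gaussn p]_x (T x * Lbar x)%:E + (s%:R * q)%:E.
  apply: (@le_trans _ _ (K^-1%:E * \sum_(f : {ffun 'I_s -> 'I_b}) (\int[gaussn p]_x (T x * Lf f x)%:E + (s%:R * q)%:E))).
    rewrite lee_wpmul2l ?lee_fin ?invr_ge0 ?(ltW K0)//.
    by apply: lee_sum => f _; exact: step1.
  have mTL f : measurable_fun setT (fun x => T x * Lf f x)%R.
    by apply: measurable_funM => //; exact: measurable_Lf.
  have TL0 f x : (0 <= T x * Lf f x)%R by rewrite mulr_ge0// Lf_ge0.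
  have q0 : (0 <= q)%R.
    by rewrite -lee_fin -qE; apply: integral_ge0 => z _; rewrite lee_fin.
  rewrite big_split/= ge0_muleDr; last 2 first.
  - by apply: sume_ge0 => f _; apply: integral_ge0 => x _; rewrite lee_fin.
  - by apply: sume_ge0 => f _; rewrite lee_fin mulr_ge0.
  rewrite leeD//.
    rewrite -integral_fin_sum// -integral_finZl; last 3 first.
    - exact: measurable_sum.
    - by move=> x; apply: sumr_ge0.
    - by rewrite invr_ge0 ltW.
    rewrite le_eqVlt; apply/orP; left; apply/eqP; apply: eq_integral => x _.
    by congr EFin; rewrite -mulr_sumr /Lbar mulrC -mulrA.
  rewrite sumEFin sumr_const card_ffun !card_ord -EFinM lee_fin.
  by rewrite -[(_ *+ _)%R]mulr_natl mulrA mulVf ?mul1r// gt_eqF.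
apply: (le_trans step2); rewrite (addrC (s%:R * q)%R) EFinD addeA leeD2r//.
have m0 : (0 <= m ^+ s <= 1)%R.
  by case/andP: m01 => ? ?; rewrite exprn_ge0// exprn_ile1.
have mLB := measurable_Lbar.
have mD : measurable_fun setT (fun x => (Lbar x - m ^+ s) ^+ 2)%R.
  by apply: measurable_funX; apply: measurable_funB.
have a20 : (0 <= (2 * a)^-1)%R by rewrite invr_ge0 mulr_ge0// ltW.
(* Cauchy-Schwarz in pointwise form: |D| <= a / 2 + D^2 / (2 a), whose mean is at most a. *)
apply: (@le_trans _ _ (\int[gaussn p]_x (T x + (a / 2 +
    (2 * a)^-1 * (Lbar x - m ^+ s) ^+ 2))%:E)).
  apply: le_integral_fin => //.
  - by apply: measurable_funM.
  - by apply: measurable_funD => //; apply: measurable_funD => //; apply: measurable_funM.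
  - by move=> x; rewrite mulr_ge0// Lbar_ge0.
  - move=> x.
    set D := (Lbar x - m ^+ s)%R.
    have -> : Lbar x = (m ^+ s + D)%R by rewrite /D; ring.
    have h1 : (T x * D <= a / 2 + (2 * a)^-1 * D ^+ 2)%R.
      apply: (@le_trans _ _ `|D|%R).
        rewrite (le_trans (ler_norm _))// normrM (ger0_norm (T0 x)).
        by rewrite ler_piMl.
      rewrite -subr_ge0 -(real_normK (num_real D)).
      rewrite (_ : (_ - _)%R = ((2 * a)^-1 * (a - `|D|) ^+ 2)%R).
        by rewrite mulr_ge0 ?sqr_ge0// invr_ge0 mulr_ge0// ltW.
      by field; rewrite gt_eqF.
    rewrite mulrDr lerD// mulrC ler_piMl//.
    by case/andP: m0.
have D0 x : (0 <= (2 * a)^-1 * (Lbar x - m ^+ s) ^+ 2)%R by rewrite mulr_ge0// sqr_ge0.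
have mD2 : measurable_fun setT (fun x => (2 * a)^-1 * (Lbar x - m ^+ s) ^+ 2)%R.
  by apply: measurable_funM.
rewrite integral_finD//; last 2 first.
- by apply: measurable_funD.
- by move=> x; rewrite addr_ge0// divr_ge0// ltW.
rewrite leeD2l// integral_finD//; last by move=> x; rewrite divr_ge0// ltW.
rewrite integral_prob_cst integral_finZl//; last by move=> x; rewrite sqr_ge0.
apply: (@le_trans _ _ ((a / 2)%:E + ((2 * a)^-1)%:E * (a ^+ 2)%:E)).
  rewrite leeD2l// lee_wpmul2l// ?lee_fin ?invr_ge0 ?mulr_ge0 ?(ltW a0)//.
  exact: integral_Lbar_sqr.
rewrite -EFinM -EFinD lee_fin le_eqVlt; apply/orP; left; apply/eqP.
by field; rewrite gt_eqF.
Qed.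

End block_prior.

Section seq_upper.
Context {R : realType}.

(** The increment of the power grows with x, so x = 1 is the worst case. This removes the unknown m
    from the variance bound. *)
Lemma exprD_subX_le (x h : R) s : 0 <= x <= 1 -> 0 <= h ->
  (x + h) ^+ s - x ^+ s <= (1 + h) ^+ s - 1.
Proof.
move=> /andP[x0 x1] h0; elim: s => [|s IH]; first by rewrite !expr0 subrr.
have h1 : 0 <= (x + h) ^+ s - x ^+ s.
  by rewrite subr_ge0 lerXn2r ?nnegrE ?addr_ge0// lerDl.
have h2 : x ^+ s <= 1 by rewrite exprn_ile1.
rewrite !exprS.
have -> : (x + h) * (x + h) ^+ s - x * x ^+ s =
  (x + h) * ((x + h) ^+ s - x ^+ s) + h * x ^+ s by ring.
have -> : (1 + h) * (1 + h) ^+ s - 1 = (1 + h) * ((1 + h) ^+ s - 1) + h * 1 by ring.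
apply: lerD; last exact: ler_wpM2l.
by apply: ler_pM => //; [exact: addr_ge0|rewrite lerD2r].
Qed.

(** (1 + h)^s <= exp(s h) <= 1 / (1 - s h), and the last is at most 1 + 2 s h while s h <= 1/2. *)
Lemma expr1D_le (h : R) s : 0 <= h -> s%:R * h <= 1 / 2 ->
  (1 + h) ^+ s - 1 <= 2 * (s%:R * h).
Proof.
move=> h0 sh.
have h1 : (1 + h) ^+ s <= expR (s%:R * h).
  rewrite expRM_natl lerXn2r ?nnegrE ?addr_ge0 ?expR_ge0//.
  exact: expR_ge1Dx.
have h2 := expR_ge1Dx (- (s%:R * h)); rewrite expRN in h2.
have h3 := expR_gt0 (s%:R * h).
have sh0 : 0 <= s%:R * h by rewrite mulr_ge0.
have h4 : (1 - s%:R * h) * expR (s%:R * h) <= 1.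
  by rewrite -ler_pdivlMr// div1r.
nra.
Qed.

Local Open Scope ereal_scope.

(** The indicator of z <= t is at most exp(l (t - z)). For l = 0 this is the untruncated moment
    exp(theta^2); the bound is smallest at l = 2 theta - t. *)
Lemma trlik_sqr_le (theta t l : R) : (0 <= l)%R ->
  \int[gauss]_z (trlik theta t z ^+ 2)%:E <=
  (expR (- theta ^+ 2 + l * t + (2 * theta - l) ^+ 2 / 2))%:E.
Proof.
move=> l0.
have mE : measurable_fun setT (fun z : R => expR ((2 * theta - l) * z)).
  by apply: measurableT_comp => //; apply: measurable_funM.
apply: (@le_trans _ _ (\int[gauss]_z (expR (- theta ^+ 2 + l * t) * expR ((2 * theta - l) * z))%:E)).
  apply: le_integral_fin.
  - by apply: measurable_funX; exact: measurable_trlik.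
  - exact: measurable_funM.
  - by move=> z; exact: sqr_ge0.
  - move=> z; rewrite /trlik indicE; have [|_] := boolP (_ \in _).
      rewrite inE/= => zt; rewrite mulr1 expr2 -!expRD ler_expR; nra.
    by rewrite mulr0 expr0n/= mulr_ge0 ?expR_ge0.
rewrite integral_finZl//.
by rewrite integral_gauss_mgf -EFinM -expRD.
Qed.

Lemma integral_trlik_le1 (theta t : R) : \int[gauss]_z (trlik theta t z)%:E <= 1.
Proof.
have mE : measurable_fun setT (fun z : R => expR (theta * z)).
  by apply: measurableT_comp => //; apply: measurable_funM.
apply: (@le_trans _ _ (\int[gauss]_z (expR (- theta ^+ 2 / 2) * expR (theta * z))%:E)).
  apply: le_integral_fin.
  - exact: measurable_trlik.
  - exact: measurable_funM.
  - by move=> z; exact: trlik_ge0.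
  - move=> z; rewrite -expRD /trlik indicE.
    rewrite (_ : - _ ^+ 2 / 2 + _ = theta * z - theta ^+ 2 / 2)%R; last by field.
    by rewrite ler_piMr ?expR_ge0// lern1 leq_b1.
rewrite integral_finZl//.
by rewrite integral_gauss_mgf -EFinM -expRD mulNr addNr expR0.
Qed.

Lemma block_prior_bound s b p (pos : 'I_s -> 'I_b -> 'I_p) (theta t l a : R)
    (T : p.-tuple R -> R) :
  (forall i k i' k', pos i k = pos i' k' -> i = i' /\ k = k') -> (0 < b)%N ->
  (0 <= l)%R -> (theta <= t)%R -> (0 < a)%R ->
  (s%:R * (expR (- theta ^+ 2 + l * t + (2 * theta - l) ^+ 2 / 2) / b%:R) <= 1 / 2)%R ->
  (2 * (s%:R * (expR (- theta ^+ 2 + l * t + (2 * theta - l) ^+ 2 / 2) / b%:R)) <= a ^+ 2)%R ->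
  measurable_fun setT T -> (forall x, 0 <= T x <= 1)%R ->
  ((b ^ s)%:R^-1)%:E * \sum_(f : {ffun 'I_s -> 'I_b})
    \int[iidm (@gauss R) p]_x (T (tadd x (spike pos theta f)))%:E <=
  \int[iidm (@gauss R) p]_x (T x)%:E + (s%:R * expR (- (t - theta) ^+ 2 / 2) + a)%:E.
Proof.
move=> posi b0 l0 tt a0; set V := expR _ => sV1 sV2 mT T01.
have vV : \int[gauss]_z (trlik theta t z ^+ 2)%:E <= V%:E by exact: trlik_sqr_le.
have m1 := integral_trlik_le1 theta t.
have fin (x y : R) (z : \bar R) : 0 <= z -> z <= y%:E -> z = (fine z)%:E.
  move=> z0 zy; rewrite fineK// ge0_fin_numE//; exact: le_lt_trans zy (ltry _).
have v0 : 0 <= \int[gauss]_z (trlik theta t z ^+ 2)%:E.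
  by apply: integral_ge0 => z _; rewrite lee_fin sqr_ge0.
have m0 : 0 <= \int[gauss]_z (trlik theta t z)%:E.
  by apply: integral_ge0 => z _; rewrite lee_fin trlik_ge0.
have vE := fin 0%R _ _ v0 vV; have mE := fin 0%R 1%R _ m0 m1.
have qQ : \int[gauss]_z (\1_[set z : R | (t - theta < z)%R] z)%:E <=
    (expR (- (t - theta) ^+ 2 / 2))%:E.
  rewrite integral_indic ?setIT//; last exact: measurable_gt_set.
  rewrite -set_itvoy; apply: gauss_upper_tail; by rewrite subr_ge0.
have q0 : 0 <= \int[gauss]_z (\1_[set z : R | (t - theta < z)%R] z)%:E.
  by apply: integral_ge0 => z _; rewrite lee_fin.
have qE := fin 0%R _ _ q0 qQ.
move: vV v0 m1 m0 qQ q0; rewrite vE mE qE !lee_fin.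
move: (fine _) vE (fine _) mE (fine _) qE => v vE m mE q qE vV v0 m1 m0 qQ q0.
have Vb : (0 <= V / b%:R)%R by rewrite divr_ge0// expR_ge0.
have m2 : (0 <= m ^+ 2 <= 1)%R by rewrite sqr_ge0 exprn_ile1.
have b0' : (0 < b%:R :> R)%R by rewrite ltr0n.
have H : (((v + b.-1%:R * m ^+ 2) / b%:R) ^+ s - m ^+ (2 * s) <= a ^+ 2)%R.
  apply: (le_trans _ sV2); apply: (le_trans _ (expr1D_le Vb sV1)).
  apply: (le_trans _ (exprD_subX_le s m2 Vb)).
  have h0 : (0 <= (v + b.-1%:R * m ^+ 2) / b%:R)%R.
    by rewrite divr_ge0// addr_ge0// mulr_ge0// sqr_ge0.
  have h1 : ((v + b.-1%:R * m ^+ 2) / b%:R <= m ^+ 2 + V / b%:R)%R.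
    rewrite ler_pdivrMr// mulrDl divfK ?gt_eqF//.
    rewrite -[in X in (_ <= X)%R](prednK b0) -natr1 mulrDr mulr1.
    rewrite [(_ * m ^+ 2)%R]mulrC; have := sqr_ge0 m; lra.
  by rewrite exprM lerD2r lerXn2r// nnegrE addr_ge0// sqr_ge0.
have m01 : (0 <= m <= 1)%R by rewrite m0.
have := @block_prior_upper R s b p pos posi theta t m v q a mE vE qE b0 m01 a0 H T mT T01.
move=> /le_trans; apply; rewrite leeD2l// lee_fin lerD2r.
by rewrite ler_wpM2l.
Qed.

End seq_upper.

(** * Gain of the clipped counting test *)

Section poisson_binomial.
Context {R : realType}.
Implicit Types (phi : R -> R) (l m : seq R).

(* [bern phi [:: p1; ...; pn]] is the expectation of [phi (B1 + ... + Bn)] for independent Bernoulli variables Bi of parameter pi. *)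
Fixpoint bern phi l : R :=
  if l is a :: l' then a * bern (fun x => phi (1 + x)) l' + (1 - a) * bern phi l'
  else phi 0.

Definition probs l := all (fun a => 0 <= a <= 1) l.

Lemma eq_bern phi psi l : phi =1 psi -> bern phi l = bern psi l.
Proof. by move=> e; congr bern; exact/funext. Qed.

Lemma le_bern phi psi l : probs l -> (forall x, phi x <= psi x) -> bern phi l <= bern psi l.
Proof.
elim: l phi psi => [|a l IH] phi psi //= /andP[/andP[a0 a1] pl] le.
by apply: lerD; apply: ler_wpM2l; rewrite ?subr_ge0// IH.
Qed.

Lemma bern_ge0 phi l : probs l -> (forall x, 0 <= phi x) -> 0 <= bern phi l.
Proof.
elim: l phi => [|a l IH] phi //= /andP[/andP[a0 a1] pl] le.
by rewrite addr_ge0// mulr_ge0 ?subr_ge0// IH.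
Qed.

Lemma bern_insert phi l1 l2 a b :
  bern phi (l1 ++ b :: l2) - bern phi (l1 ++ a :: l2) =
  (b - a) * bern (fun x => phi (1 + x) - phi x) (l1 ++ l2).
Proof.
have lin phi' psi l : bern (fun x => phi' x - psi x) l = bern phi' l - bern psi l.
  elim: l phi' psi => [|c l IH] phi' psi //=; rewrite !IH; ring.
elim: l1 phi => [|c l1 IH] phi /=.
  rewrite lin.
  by ring.
set lb := l1 ++ b :: l2; set la := l1 ++ a :: l2.
transitivity (c * (bern (fun x => phi (1 + x)) lb - bern (fun x => phi (1 + x)) la) +
  (1 - c) * (bern phi lb - bern phi la)); first by ring.
by rewrite !IH; ring.
Qed.

Lemma bern_sqr l (c : R) :
  bern (fun x => (x - c) ^+ 2) l =
  \sum_(a <- l) a * (1 - a) + (\sum_(a <- l) a - c) ^+ 2.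
Proof.
elim: l c => [|a l IH] c /=.
  by rewrite !big_nil; ring.
rewrite (@eq_bern _ (fun x => (x - (c - 1)) ^+ 2)); last by move=> x; congr (_ ^+ 2); ring.
by rewrite !IH !big_cons; ring.
Qed.

Lemma bern_quad l (c h w : R) :
  bern (fun x => h * (1 - (x - c) ^+ 2 / w)) l = h * (1 - bern (fun x => (x - c) ^+ 2) l / w).
Proof.
have E phi : bern (fun x => h * (1 - phi x / w)) l = h * (1 - bern phi l / w).
  by elim: l phi => [|a l IH] phi //=; rewrite !IH; ring.
exact: E.
Qed.

(** Lindeberg-type replacement: the parameters are raised one at a time, [l1] holding those still
    kept low. The family m that surrounds the current variable has lost a parameter of at most 1,
    whence the - 1 in the lower condition. *)
Lemma bern_hybrid phi (lo hi k : R) :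
  (forall m, probs m -> lo <= \sum_(a <- m) a <= hi ->
    k <= bern (fun x => phi (1 + x) - phi x) m) ->
  forall l1 l l', probs l1 -> probs l -> probs l' -> all2 <=%R l l' ->
  lo <= \sum_(a <- l1) a + \sum_(a <- l) a - 1 ->
  \sum_(a <- l1) a + \sum_(a <- l') a <= hi ->
  k * (\sum_(a <- l') a - \sum_(a <- l) a) <= bern phi (l1 ++ l') - bern phi (l1 ++ l).
Proof.
move=> H l1 l; elim: l l1 => [|a l IH] l1 [|a' l']//=.
  by rewrite !big_nil !subrr mulr0.
move=> pl1 /andP[/andP[a0 a1] pl] /andP[/andP[a0' a1'] pl'] /andP[aa' ll'].
rewrite !big_cons => hlo hhi.
have sl : \sum_(a <- l) a <= \sum_(a <- l') a.
  elim: l l' ll' {IH pl pl' hlo hhi} => [|c l IH] [|c' l']//= /andP[cc' /IH ll'].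
  by rewrite !big_cons lerD.
have sE (x : R) (u v : seq R) : \sum_(y <- u ++ v) y = \sum_(y <- u) y + \sum_(y <- v) y.
  by rewrite big_cat.
have -> : bern phi (l1 ++ a' :: l') - bern phi (l1 ++ a :: l) =
   (bern phi (l1 ++ a' :: l') - bern phi (l1 ++ a :: l')) +
   (bern phi ((rcons l1 a) ++ l') - bern phi ((rcons l1 a) ++ l)).
  by rewrite !cat_rcons; ring.
have -> : k * (a' + \sum_(j <- l') j - (a + \sum_(j <- l) j)) =
  (a' - a) * k + k * (\sum_(j <- l') j - \sum_(j <- l) j) by ring.
apply: lerD.
  rewrite bern_insert ler_wpM2l ?subr_ge0//; apply: H.
    by rewrite /probs all_cat; apply/andP.
  by rewrite sE//; apply/andP; split; lra.
apply: IH => //.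
- by rewrite /probs all_rcons a0 a1.
- by rewrite -cats1 sE// big_seq1; lra.
- by rewrite -cats1 sE// big_seq1; lra.
Qed.

(** A ramp of half-width M around c rather than a jump: the gain from one more success is then
    bounded below by second moments alone. *)
Definition clip (c M x : R) : R := Num.max 0 (Num.min 1 (1 / 2 + (x - c) / (2 * M))).

Lemma le_clamp (y z : R) : y <= z -> Num.max 0 (Num.min 1 y) <= Num.max 0 (Num.min 1 z).
Proof.
move=> yz; rewrite ge_max !le_max lexx/=; apply/orP; right.
by rewrite le_min !ge_min lexx yz orbT.
Qed.

Lemma clip01 c M x : 0 <= clip c M x <= 1.
Proof.
by rewrite /clip le_max lexx/= ge_max ler01/= ge_min lexx.
Qed.

(** If |x - c| <= M - 1, both points lie on the ramp and the increment is 1 / (2 M); otherwise the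
    left side is nonpositive and monotonicity suffices. The minorant is quadratic so that its mean
    is a variance computation. *)
Lemma clip_diff c M x : 1 < M ->
  1 / (2 * M) * (1 - (x - c) ^+ 2 / (M - 1) ^+ 2) <= clip c M (1 + x) - clip c M x.
Proof.
move=> M1.
have M0 : 0 < M by lra.
have Mi : 0 < (2 * M)^-1 by rewrite invr_gt0 mulr_gt0.
have MM : (2 * M) * (2 * M)^-1 = 1 by rewrite divff// gt_eqF// mulr_gt0.
have [h|h] := lerP (`|x - c|) (M - 1).
  have e y : c - M <= y <= c + M -> clip c M y = 1 / 2 + (y - c) / (2 * M).
    move=> /andP[y1 y2].
    have : -1 / 2 <= (y - c) / (2 * M) <= 1 / 2.
      by rewrite ler_pdivlMr ?mulr_gt0// ler_pdivrMr ?mulr_gt0//; apply/andP; split; lra.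
    by move=> /andP[z1 z2]; rewrite /clip min_r ?max_r//; lra.
  move: h; rewrite ler_norml => /andP[h1 h2].
  rewrite !e; [|by apply/andP; split; lra|by apply/andP; split; lra].
  have -> : 1 / 2 + (1 + x - c) / (2 * M) - (1 / 2 + (x - c) / (2 * M)) = 1 / (2 * M) by ring.
  rewrite ler_piMr ?divr_ge0 ?mulr_ge0//; try lra.
  by rewrite gerBl divr_ge0// sqr_ge0.
apply: (@le_trans _ _ 0).
  rewrite mulr_ge0_le0 ?divr_ge0 ?mulr_ge0//; try lra.
  rewrite subr_le0 ler_pdivlMr ?exprn_gt0 ?subr_gt0// mul1r -[leRHS]real_normK ?num_real//.
  by rewrite lerXn2r ?nnegrE//; lra.
rewrite subr_ge0 /clip; apply: le_clamp.
rewrite lerD2l ler_pM2r//; lra.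
Qed.

Lemma bern_clip_gain (mu U : R) l l' : 1 <= U -> mu = \sum_(a <- l) a -> mu <= U ->
  probs l -> probs l' -> all2 <=%R l l' ->
  \sum_(a <- l') a - mu <= Num.sqrt U ->
  (\sum_(a <- l') a - mu) / (16 * Num.sqrt U) <=
  bern (clip mu (3 * Num.sqrt U + 1)) l' - bern (clip mu (3 * Num.sqrt U + 1)) l.
Proof.
move=> U1 muE muU pl pl' ll' gap.
set q := Num.sqrt U in gap *.
have q2 : q ^+ 2 = U by rewrite sqr_sqrtr//; lra.
have q1 : 1 <= q by rewrite -(sqrtr1 R) ler_wsqrtr.
(* Then (M - 1)^2 = 9 U, whereas any hybrid family has variance at most 2 U and squared bias at most
   U, so the parenthesis in [clip_diff] keeps a mean of at least 1/2. Since M <= 4 q, the slope 1 /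
   (2 M) yields 1 / (16 q). *)
set M := 3 * q + 1.
have M1 : 1 < M by rewrite /M; lra.
have := @bern_hybrid (clip mu M) (mu - 1) (mu + q) (1 / (16 * q)).
move=> /(_ _ [::] l l' isT pl pl' ll').
rewrite !big_nil !add0r muE => H; rewrite mulrC -[X in X * _]div1r.
apply: H; [|lra|lra].
move=> m pm; rewrite -muE => /andP[m1 m2].
apply: (@le_trans _ _ (bern (fun x => 1 / (2 * M) * (1 - (x - mu) ^+ 2 / (M - 1) ^+ 2)) m)); last first.
  by apply: le_bern => // x; exact: clip_diff.
rewrite bern_quad bern_sqr.
have v : \sum_(a <- m) a * (1 - a) <= \sum_(a <- m) a.
  elim: m pm {m1 m2} => [|a m IH]; first by rewrite !big_nil.
  move=> /andP[/andP[a0 a1] /IH h]; rewrite !big_cons; apply: lerD => //.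
  by rewrite ler_piMr// gerBl.
have d2 : (\sum_(a <- m) a - mu) ^+ 2 <= q ^+ 2.
  rewrite -[leLHS]real_normK ?num_real// lerXn2r ?nnegrE//; first by lra.
  by rewrite ler_norml; apply/andP; split; lra.
have e9 : (M - 1) ^+ 2 = 9 * U by rewrite /M addrK exprMn q2; ring.
rewrite e9.
have x2 : (\sum_(a <- m) a * (1 - a) + (\sum_(a <- m) a - mu) ^+ 2) / (9 * U) <= 1 / 2.
  by rewrite ler_pdivrMr; nra.
have Mq : M <= 4 * q by rewrite /M; lra.
apply: (@le_trans _ _ (1 / (2 * M) * (1 / 2))).
  have -> : 1 / (2 * M) * (1 / 2) = 1 / (4 * M) by field; lra.
  rewrite !div1r lef_pV2 ?posrE; lra.
rewrite ler_wpM2l ?divr_ge0//; lra.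
Qed.

Lemma le_bern_probs phi l l' : (forall x y, x <= y -> phi x <= phi y) ->
  probs l -> probs l' -> all2 <=%R l l' -> bern phi l <= bern phi l'.
Proof.
move=> mono pl pl' ll'.
have := @bern_hybrid phi (\sum_(a <- l) a - 1) (\sum_(a <- l') a) 0.
move=> /(_ _ [::] l l' isT pl pl' ll'); rewrite !big_nil !add0r mul0r subr_ge0; apply => //.
move=> m pm _; apply: bern_ge0 => // x; rewrite subr_ge0 mono// lerDr//.
Qed.

Lemma clip_mono c M x y : 0 < M -> x <= y -> clip c M x <= clip c M y.
Proof.
move=> M0 xy; apply: le_clamp.
by rewrite lerD2l ler_pM2r ?invr_gt0 ?mulr_gt0//; lra.
Qed.

End poisson_binomial.

(** * Exceedance counts *)

Section count_test.
Context {R : realType}.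
Local Open Scope ereal_scope.
Notation gaussn := (iidm (@gauss R)).
Variable t : R.

Definition exc (z : R) : R := \1_[set y : R | (t < `|y|)%R] z.
Definition cnt n (x : n.-tuple R) : R := (\sum_(i < n) exc (tnth x i))%R.
Definition excprob (theta : R) : R := fine (\int[gauss]_z (exc (z + theta))%:E).

Lemma measurable_exc : measurable_fun setT exc.
Proof.
apply: measurable_indic.
have mn : measurable_fun setT (fun y : R => `|y|%R) by [].
have := mn measurableT `]t, +oo[%classic (measurable_itv _).
rewrite setTI; congr measurable; apply/seteqP; split => y /=; rewrite in_itv/= andbT//.
Qed.

Lemma measurable_cnt n : measurable_fun setT (@cnt n).
Proof.
apply: measurable_sum => i.
exact: (measurableT_comp measurable_exc (measurable_tnth i)).
Qed.

Lemma exc_ge0 z : (0 <= exc z)%R. Proof. by []. Qed.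
Lemma exc_le1 z : (exc z <= 1)%R. Proof. by rewrite /exc indicE lern1 leq_b1. Qed.

Lemma measurable_exc_shift (theta : R) : measurable_fun setT (fun z : R => exc (z + theta)).
Proof. by apply: (measurableT_comp measurable_exc); exact: measurable_funD. Qed.

Lemma excprobE theta : \int[gauss]_z (exc (z + theta))%:E = (excprob theta)%:E.
Proof.
rewrite fineK// ge0_fin_numE; last first.
  by apply: integral_ge0 => z _; rewrite lee_fin exc_ge0.
apply: (@le_lt_trans _ _ (\int[@gauss R]_z 1%:E)); last by rewrite integral_prob_cst ltry.
apply: le_integral_fin; [exact: measurable_exc_shift|exact: measurable_cst| |].
  by move=> z; exact: exc_ge0.
by move=> z; exact: exc_le1.
Qed.

Lemma excprobCE theta : \int[gauss]_z (1 - exc (z + theta))%:E = (1 - excprob theta)%:E.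
Proof.
have mC : measurable_fun setT (fun z : R => 1 - exc (z + theta))%R.
  by apply: measurable_funB => //; exact: measurable_exc_shift.
have C0 z : (0 <= 1 - exc (z + theta))%R by rewrite subr_ge0 exc_le1.
have := integral_finD (@gauss R) (measurable_exc_shift theta) mC (fun z => exc_ge0 _) C0.
under eq_integral do rewrite addrC subrK.
rewrite integral_prob_cst excprobE.
move=> H; have {}H : 1%:E - (excprob theta)%:E = \int[gauss]_z (1 - exc (z + theta))%:E.
  by rewrite H addrAC subee// add0e.
by rewrite -H EFinB.
Qed.

Lemma excprob01 theta : (0 <= excprob theta <= 1)%R.
Proof.
apply/andP; split.
  by rewrite -lee_fin -excprobE; apply: integral_ge0 => z _; rewrite lee_fin.
rewrite -subr_ge0 -lee_fin -excprobCE; apply: integral_ge0 => z _.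
by rewrite lee_fin subr_ge0 exc_le1.
Qed.

Definition excprobs n (theta : 'I_n -> R) := [seq excprob (theta i) | i <- enum 'I_n].

Lemma probs_excprobs n (theta : 'I_n -> R) : probs (excprobs theta).
Proof. by apply/allP => x /mapP[i _ ->]; exact: excprob01. Qed.

(** The number of exceedances is Poisson-binomial: integrating the first coordinate adds one
    Bernoulli variable, which is the recursion of [bern]. *)
Lemma integral_cnt n (theta : 'I_n -> R) (phi : R -> R) :
  measurable_fun setT phi -> (forall x, (0 <= phi x)%R) ->
  \int[gaussn n]_x (phi (cnt (tadd x theta)))%:E = (bern phi (excprobs theta))%:E.
Proof.
elim: n theta phi => [|n IH] theta phi mphi phi0.
  rewrite /excprobs enum_ord0/= integral_dirac//; last first.
    apply/measurable_EFinP; apply: (measurableT_comp mphi).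
    exact: (measurableT_comp (@measurable_cnt 0) (measurable_tadd theta)).
  by rewrite diracT mul1e /cnt big_ord0.
have mf : measurable_fun setT (fun x : n.+1.-tuple R => (phi (cnt (tadd x theta)))%:E).
  apply/measurable_EFinP; apply: (measurableT_comp mphi).
  exact: (measurableT_comp (@measurable_cnt n.+1) (measurable_tadd theta)).
rewrite (ge0_integral_iidmS _ mf); last by move=> x; rewrite lee_fin.
pose th i := theta (lift ord0 i).
have E x : \int[gaussn n]_v (phi (cnt (tadd (tuple_cons (x, v)) theta)))%:E =
    (bern (fun y => phi (1 + y)) (excprobs th) * exc (x + theta ord0) +
     bern phi (excprobs th) * (1 - exc (x + theta ord0)))%:E.
  transitivity (\int[gaussn n]_v (phi (exc (x + theta ord0) + cnt (tadd v th)))%:E).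
    apply: eq_integral => v _; congr (phi _)%:E.
    rewrite /cnt big_ord_recl tadd_cons; congr (exc _ + _)%R.
    by apply: eq_bigr => i _; rewrite tnthS.
  rewrite (IH th (fun y => phi (exc (x + theta ord0) + y))%R)//; last first.
    by apply: measurableT_comp => //; exact: measurable_funD.
  rewrite /exc indicE; case: (_ \in _).
    by rewrite subrr mulr0 addr0 mulr1.
  rewrite subr0 mulr0 add0r mulr1; congr EFin; apply: eq_bern => y.
  by rewrite add0r.
under eq_integral do rewrite E.
have pb := probs_excprobs th.
have b1 : (0 <= bern (fun y => phi (1 + y)) (excprobs th))%R by apply: bern_ge0.
have b2 : (0 <= bern phi (excprobs th))%R by apply: bern_ge0.
have me := measurable_exc_shift (theta ord0).
have mC : measurable_fun setT (fun z : R => 1 - exc (z + theta ord0))%R.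
  by apply: measurable_funB.
have C0 z : (0 <= 1 - exc (z + theta ord0))%R by rewrite subr_ge0 exc_le1.
rewrite integral_finD; last 4 first.
- exact: measurable_funM.
- exact: measurable_funM.
- by move=> z; rewrite mulr_ge0.
- by move=> z; rewrite mulr_ge0.
rewrite !integral_finZl// excprobE excprobCE -!EFinM -EFinD; congr EFin.
rewrite /excprobs enum_ordSl/= -map_comp.
by rewrite mulrC; congr (_ + _)%R; rewrite mulrC.
Qed.

Lemma measurable_clip (c M : R) : measurable_fun setT (clip c M).
Proof.
apply: measurable_maxr => //; apply: measurable_minr => //.
by apply: measurable_funD => //; apply: measurable_funM => //; exact: measurable_funB.
Qed.

Lemma count_test_gain p s (pi1 U : R) (theta : 'I_p -> R) :
  let c := (p%:R * excprob 0)%R in let M := (3 * Num.sqrt U + 1)%R in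
  (1 <= U)%R -> (c <= U)%R -> (excprob 0 <= pi1)%R -> (pi1 <= 1)%R ->
  (s%:R * (pi1 - excprob 0) <= Num.sqrt U)%R ->
  #|[set i | theta i != 0%R]%SET| = s ->
  (forall i, theta i != 0%R -> pi1 <= excprob (theta i))%R ->
  \int[gaussn p]_x (clip c M (cnt x))%:E + (s%:R * (pi1 - excprob 0) / (16 * Num.sqrt U))%:E
  <= \int[gaussn p]_x (clip c M (cnt (tadd x theta)))%:E.
Proof.
move=> c M U1 cU p01 p11 gap sE hpi.
have phi0 x : (0 <= clip c M x)%R by case/andP: (clip01 c M x).
rewrite (integral_cnt theta (@measurable_clip c M) phi0).
have E0 : \int[gaussn p]_x (clip c M (cnt x))%:E =
    (bern (clip c M) (excprobs (fun _ : 'I_p => 0%R)))%:E.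
  rewrite -(integral_cnt _ (@measurable_clip c M) phi0).
  apply: eq_integral => x _; congr (clip _ _ (cnt _))%:E.
  by apply: eq_from_tnth => i; rewrite tnth_mktuple addr0.
rewrite E0 -EFinD lee_fin.
set l := excprobs (fun _ => 0%R).
(* Intermediate family with the smallest allowed exceedance probability at each spike:
   [bern_clip_gain] leads from l to l', monotonicity from l' to the true probabilities. *)
pose l' := [seq (if theta i != 0%R then pi1 else excprob 0) | i <- enum 'I_p].
have le2 (f g : 'I_p -> R) : (forall i, f i <= g i)%R ->
    all2 <=%R [seq f i | i <- enum 'I_p] [seq g i | i <- enum 'I_p].
  by move=> fg; elim: (enum 'I_p) => //= i e ->; rewrite fg.
have pl' : probs l'.
  apply/allP => x /mapP[i _ ->]; case: ifP => _; last exact: excprob01.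
  by rewrite p11 andbT (le_trans _ p01)//; case/andP: (excprob01 0).
have suml : (\sum_(a <- l) a = c)%R.
  rewrite big_map big_enum/= sumr_const card_ord /c [RHS]mulr_natl.
  by [].
have suml' : (\sum_(a <- l') a = c + s%:R * (pi1 - excprob 0))%R.
  rewrite big_map big_enum/= (eq_bigr (fun i => excprob 0 + (if theta i != 0 then pi1 - excprob 0 else 0)))%R; last first.
    by move=> i _; case: ifP => _; ring.
  rewrite big_split/= sumr_const card_ord -[(excprob 0 *+ p)%R]mulr_natl; congr (_ + _)%R.
  rewrite -big_mkcond/= -sE [RHS]mulr_natl -sumr_const.
  by apply: eq_bigl => i; rewrite inE.
have gain := @bern_clip_gain R c U l l' U1 (esym suml) cU (probs_excprobs _) pl'.
rewrite suml' (addrC c) addrK in gain.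
have {}gain := gain (le2 _ _ _) gap.
rewrite addrC -lerBrDr; apply: (le_trans (gain _)).
  by move=> i; case: ifP => _.
rewrite lerD2r; apply: le_bern_probs => //.
- by move=> x y xy; apply: clip_mono => //; rewrite /M; have := sqrtr_ge0 U; lra.
- exact: probs_excprobs.
- by apply: le2 => i; case: ifPn => [/hpi//|/negPn/eqP ->].
Qed.

Lemma excprob0_le : (0 <= t)%R -> (excprob 0 <= 2 * expR (- t ^+ 2 / 2))%R.
Proof.
move=> t0; rewrite -lee_fin -excprobE mulr2n mulrDl mul1r EFinD.
apply: (@le_trans _ _ (gauss `]t, +oo[%classic + gauss `]-oo, (- t)%R[%classic)); last first.
  by apply: leeD; [exact: gauss_upper_tail|exact: gauss_lower_tail].
rewrite -[X in gauss X + _]setIT -[X in _ + gauss X]setIT -!integral_indic//.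
rewrite -integral_finD//; try by apply: measurable_indic.
apply: le_integral_fin => //.
- exact: measurable_exc_shift.
- by apply: measurable_funD; apply: measurable_indic.
move=> z; rewrite addr0 /exc !indicE.
case: (boolP (z \in [set y : R | (t < `|y|)%R])) => [|_]; last by rewrite addr_ge0.
rewrite inE/= lter_normr => /orP[tz|tz].
  have -> : z \in `]t, +oo[%classic by rewrite inE/= in_itv/= tz.
  by rewrite lerDl.
have -> : z \in `]-oo, (- t)%R[%classic by rewrite inE/= in_itv/= ltrNr.
by rewrite lerDr.
Qed.

Lemma excprob_ge (a theta : R) : (a <= `|theta|)%R -> (a <= t)%R ->
  (normal_peak 1 * expR (- (t - a + 1) ^+ 2 / 2) <= excprob theta)%R.
Proof.
move=> ath at_; rewrite -lee_fin -excprobE.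
have ta : (0 <= t - a)%R by rewrite subr_ge0.
have [th0|th0] := leP 0%R theta.
  apply: (le_trans (gauss_upper_tail_ge ta)).
  rewrite -[X in gauss X]setIT -integral_indic//.
  apply: le_integral_fin => //; first exact: measurable_exc_shift.
  move=> z; rewrite /exc !indicE.
  case: (boolP (z \in `](t - a)%R, +oo[%classic)) => [|_]; last by [].
  rewrite inE/= in_itv/= andbT => tz.
  rewrite mem_set//= lter_normr; apply/orP; left.
  by move: ath; rewrite ger0_norm//; lra.
apply: (le_trans (gauss_lower_tail_ge ta)).
rewrite -[X in gauss X]setIT -integral_indic//.
apply: le_integral_fin => //; first exact: measurable_exc_shift.
move=> z; rewrite /exc !indicE.
case: (boolP (z \in `]-oo, (- (t - a))%R[%classic)) => [|_]; last by [].
rewrite inE/= in_itv/= => tz.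
rewrite mem_set//= lter_normr; apply/orP; right.
by move: ath; rewrite ltr0_norm//; lra.
Qed.

End count_test.

(** * Whitening a well-conditioned design *)

Section diag_dominant.
Context {R : rcfType} {p : nat}.
Implicit Types (K : 'M[R]_p) (i j k : 'I_p).

(* Explicit square root of a diagonally dominant symmetric matrix: K is the sum over ordered pairs j <> k of |K j k| / 2 times the rank one matrix of e_j + sgn (K j k) e_k, plus a nonnegative diagonal. *)
Definition ddfac K : 'M[R]_(p, #|{: 'I_p * 'I_p}|) := \matrix_(i, c)
  let: (j, k) := enum_val c in
  if j == k then (i == j)%:R * Num.sqrt (K j j - \sum_(l | l != j) `|K j l|)
  else Num.sqrt (`|K j k| / 2) * ((i == j)%:R + Num.sg (K j k) * (i == k)%:R).

Lemma sum_delta i (F : 'I_p -> R) : \sum_j (i == j)%:R * F j = F i.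
Proof.
rewrite (bigD1 i)//= eqxx mul1r big1 ?addr0// => j ji.
by rewrite eq_sym (negbTE ji) mul0r.
Qed.

(** Off the diagonal, the two ordered pairs contribute half of the entry each. On the diagonal they
    contribute the row sum [D i] of absolute values, which the slack K i i - [D i] completes. *)
Lemma ddfacK K : K^T = K -> (forall i, \sum_(j | j != i) `|K i j| <= K i i) ->
  ddfac K *m (ddfac K)^T = K.
Proof.
move=> Ksym Kdd; apply/matrixP => i i'; rewrite mxE.
have Ks j k : K j k = K k j by rewrite -[in LHS]Ksym mxE.
pose F jk := (if jk.1 == jk.2 then
    (i == jk.1)%:R * Num.sqrt (K jk.1 jk.1 - \sum_(l | l != jk.1) `|K jk.1 l|)
  else Num.sqrt (`|K jk.1 jk.2| / 2) * ((i == jk.1)%:R + Num.sg (K jk.1 jk.2) * (i == jk.2)%:R)) *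
  (if jk.1 == jk.2 then
    (i' == jk.1)%:R * Num.sqrt (K jk.1 jk.1 - \sum_(l | l != jk.1) `|K jk.1 l|)
  else Num.sqrt (`|K jk.1 jk.2| / 2) * ((i' == jk.1)%:R + Num.sg (K jk.1 jk.2) * (i' == jk.2)%:R)).
transitivity (\sum_(c < #|{: 'I_p * 'I_p}|) F (enum_val c)).
  by apply: eq_bigr => c _; rewrite !mxE /F; case: (enum_val c).
rewrite -(big_enum_val F)/=.
rewrite -(pair_bigA _ (fun j k => F (j, k)))/=.
pose a j k : R := if j == k then 0 else K j k.
pose D j : R := \sum_(l | l != j) `|K j l|.
have aS j k : a j k = a k j by rewrite /a eq_sym Ks.
have aK j : \sum_k `|a j k| = D j.
  rewrite /D [RHS]big_mkcond; apply: eq_bigr => k _; rewrite /a eq_sym.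
  by case: eqVneq => // _; rewrite normr0.
have FE j k : F (j, k) = (if j == k then (i == j)%:R * ((i' == j)%:R * (K j j - D j)) else 0) +
   ((i == j)%:R * ((i' == j)%:R * (`|a j k| / 2)) + (i == k)%:R * ((i' == k)%:R * (`|a j k| / 2)) +
    ((i == j)%:R * ((i' == k)%:R * (a j k / 2)) + (i == k)%:R * ((i' == j)%:R * (a j k / 2)))).
  rewrite /F /= /a; have [<-|jk] := eqVneq j k.
    have := Kdd j; rewrite -subr_ge0 => /sqr_sqrtr E.
    rewrite normr0 mul0r !mulr0 !addr0 mulrACA -expr2 E -/(D j); ring.
  have E : Num.sqrt (`|K j k| / 2) ^+ 2 = `|K j k| / 2 by rewrite sqr_sqrtr// divr_ge0.
  rewrite add0r mulrACA -expr2 E.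
  have s1 : Num.sg (K j k) * `|K j k| = K j k by rewrite -numEsg.
  have s2 : Num.sg (K j k) ^+ 2 * `|K j k| = `|K j k|.
    by rewrite expr2 -mulrA s1 [RHS]normrEsg.
  set g := Num.sg _ in s1 s2 *; set N := `|_| in s1 s2 *.
  transitivity (N / 2 * (i == j)%:R * (i' == j)%:R + (g ^+ 2 * N) / 2 * (i == k)%:R * (i' == k)%:R +
    ((g * N) / 2 * (i == j)%:R * (i' == k)%:R + (g * N) / 2 * (i == k)%:R * (i' == j)%:R)).
    by ring.
  by rewrite s1 s2; ring.
under eq_bigr => j _ do under eq_bigr => k _ do rewrite FE.
under eq_bigr => j _ do rewrite !big_split/=.
rewrite !big_split/=.
have t1 : \sum_j \sum_k (if j == k then (i == j)%:R * ((i' == j)%:R * (K j j - D j)) else 0) =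
    (i' == i)%:R * (K i i - D i).
  under eq_bigr => j _.
    rewrite -big_mkcond/= (big_pred1 j); last by move=> k; rewrite /= eq_sym.
    over.
  by rewrite sum_delta.
have t2 : \sum_j \sum_k (i == j)%:R * ((i' == j)%:R * (`|a j k| / 2)) = (i' == i)%:R * (D i / 2).
  under eq_bigr => j _ do rewrite -!mulr_sumr -mulr_suml aK.
  by rewrite sum_delta.
have t3 : \sum_j \sum_k (i == k)%:R * ((i' == k)%:R * (`|a j k| / 2)) = (i' == i)%:R * (D i / 2).
  rewrite exchange_big/= -t2; apply: eq_bigr => j _; apply: eq_bigr => k _.
  by rewrite aS.
have t4 : \sum_j \sum_k (i == j)%:R * ((i' == k)%:R * (a j k / 2)) = a i i' / 2.
  under eq_bigr => j _ do rewrite -mulr_sumr sum_delta.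
  by rewrite sum_delta.
have t5 : \sum_j \sum_k (i == k)%:R * ((i' == j)%:R * (a j k / 2)) = a i i' / 2.
  rewrite exchange_big/= -t4; apply: eq_bigr => j _; apply: eq_bigr => k _.
  by rewrite aS.
rewrite t1 t2 t3 t4 t5 /a eq_sym; have [->|ii] := eqVneq i i'.
  by rewrite /= mulr1n; field.
by rewrite /= mulr0n; field.
Qed.

End diag_dominant.

Section good_design.
Context {R : realType} {p : nat}.
Variables (S : 'M[R]_p) (dl : R).
Hypotheses (Ssym : S^T = S) (dl0 : 0 <= dl) (dl1 : dl <= 1 / 2).
Hypothesis Sgood : forall i j, `|S i j - (i == j)%:R| <= dl / p%:R.

Let D : 'M[R]_p := S - 1%:M.
Let DE i j : `|D i j| <= dl / p%:R.
Proof. by rewrite /D !mxE; exact: Sgood. Qed.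

Lemma sum_norm_mul_le m (u : 'rV[R]_p) (B : 'M[R]_(p, m)) (c : R) j :
  (forall i, `|B i j| <= c) -> `|(u *m B) 0 j| <= c * \sum_i `|u 0 i|.
Proof.
move=> Bc; rewrite mxE (le_trans (ler_norm_sum _ _ _))// mulr_sumr.
by apply: ler_sum => i _; rewrite normrM mulrC ler_wpM2r.
Qed.

(** The factor 1 / p in the entrywise bound makes right multiplication by D contract the l1 norm by
    [dl]. *)
Lemma sum_row_le (u : 'rV[R]_p) : \sum_j `|(u *m D) 0 j| <= dl * \sum_i `|u 0 i|.
Proof.
have [p0|p0] := posnP p.
  rewrite big1 ?mulr_ge0 ?sumr_ge0// => j; have := ltn_ord j.
  by rewrite [X in (_ < X)%N]p0.
apply: (@le_trans _ _ (\sum_(j < p) (dl / p%:R * \sum_i `|u 0 i|))).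
  by apply: ler_sum => j _; apply: sum_norm_mul_le => i; exact: DE.
rewrite sumr_const card_ord -[_ *+ _]mulr_natl mulrA.
by rewrite [p%:R * _]mulrC divfK ?pnatr_eq0 -?lt0n.
Qed.

(** A kernel vector satisfies u D = - u, and the contraction forces it to vanish. *)
Lemma good_unitmx : S \in unitmx.
Proof.
rewrite -row_free_unit; apply: inj_row_free => u uS.
have uD : u *m D = - u by rewrite mulmxBr uS mulmx1 sub0r.
have := sum_row_le u; rewrite uD.
under eq_bigr do rewrite mxE normrN.
move=> h; have s0 : \sum_i `|u 0 i| = 0.
  apply: le_anti; rewrite sumr_ge0 ?andbT//.
  have s0 : 0 <= \sum_i `|u 0 i| by exact: sumr_ge0.
  have := ler_wpM2r s0 dl1; lra.
apply/rowP => i; rewrite mxE; apply/eqP; rewrite -normr_eq0.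
by move/eqP: s0; rewrite psumr_eq0// => /allP /(_ i); rewrite mem_index_enum => /(_ isT).
Qed.

Let H := invmx S.

Lemma inv_sym : H^T = H.
Proof. by rewrite /H trmx_inv Ssym. Qed.

(** H - 1 = - H D, and the l1 norm x of a row of H is at most 2 because x <= 1 + dl x. *)
Lemma inv_good i j : `|H i j - (i == j)%:R| <= 2 * dl / p%:R.
Proof.
have HD : H - 1%:M = - (H *m D).
  by rewrite /D mulmxBr mulVmx ?good_unitmx// mulmx1 opprB.
have r2 : \sum_j `|H i j| <= 2.
  have e : row i H = row i 1%:M - row i H *m D.
    by rewrite -row_mul -raddfB/= -HD addrC subrK.
  have h1 : \sum_j `|H i j| <= 1 + dl * \sum_j `|H i j|.
    apply: (@le_trans _ _ (\sum_j (`|(1%:M : 'M[R]_p) i j| + `|(row i H *m D) 0 j|))).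
      apply: ler_sum => k _; rewrite [H i k](_ : _ = row i H 0 k); last by rewrite mxE.
      have -> : row i H 0 k = (1%:M : 'M[R]_p) i k - (row i H *m D) 0 k.
        by rewrite {1}e mxE [in X in X + _]mxE [in X in _ + X]mxE.
      exact: ler_normB.
    rewrite big_split/= lerD//.
      rewrite (bigD1 i)//= big1 ?addr0; first by rewrite mxE eqxx normr1.
      by move=> k ki; rewrite mxE eq_sym (negbTE ki) normr0.
    apply: (le_trans (sum_row_le _)); rewrite ler_wpM2l//.
    by apply: ler_sum => k _; rewrite mxE.
  have h0 : 0 <= \sum_j `|H i j| by exact: sumr_ge0.
  have := ler_wpM2r h0 dl1; lra.
have -> : H i j - (i == j)%:R = - (row i H *m D) 0 j.
  by rewrite -row_mul mxE; move/matrixP: HD => /(_ i j); rewrite !mxE.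
rewrite normrN; apply: (le_trans (sum_norm_mul_le _ (fun k => DE k j))).
rewrite mulrC -mulrA ler_wpM2r ?divr_ge0//.
by apply: (le_trans _ r2); apply: ler_sum => k _; rewrite mxE.
Qed.

(** The diagonal entry is at least 2 dl - 2 dl / p, exactly the sum of the p - 1 off-diagonal bounds
    2 dl / p. *)
Lemma dd_criterion (K : 'M[R]_p) : (forall i j, `|K i j - 2 * dl * (i == j)%:R| <= 2 * dl / p%:R) ->
  forall i, \sum_(j | j != i) `|K i j| <= K i i.
Proof.
move=> h i.
have p0 : (0 < p)%N by apply: leq_ltn_trans (ltn_ord i).
have pR : 0 < p%:R :> R by rewrite ltr0n.
apply: (@le_trans _ _ (\sum_(j | j != i) 2 * dl / p%:R)).
  by apply: ler_sum => j ji; have := h i j; rewrite eq_sym (negbTE ji) mulr0 subr0.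
rewrite sumr_const cardC1 card_ord -[_ *+ _]mulr_natl.
have := h i i; rewrite eqxx mulr1 ler_norml => /andP[h1 _].
have e : p.-1%:R * (2 * dl / p%:R) = 2 * dl - 2 * dl / p%:R.
  have e0 : p.-1%:R = p%:R - 1 :> R by rewrite -[in RHS](prednK p0) -natr1 addrK.
  by rewrite e0; field; rewrite gt_eqF.
by rewrite e; lra.
Qed.

(** With [noise_fac_lower]: H lies between 1 - 2 dl and 1 + 2 dl times the identity, with explicit
    square roots of both differences. The auxiliary Gaussian noises are built from these roots. *)
Lemma noise_fac_upper : let K := (1 + 2 * dl)%:M - H in ddfac K *m (ddfac K)^T = K.
Proof.
move=> K; apply: ddfacK; first by rewrite raddfB/= tr_scalar_mx inv_sym.
apply: dd_criterion => i j; rewrite /K !mxE -normrN.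
rewrite (_ : - _ = H i j - (i == j)%:R) ?inv_good//.
by case: (i == j); rewrite ?mulr1n ?mulr0n; ring.
Qed.

Lemma noise_fac_lower : let K := H - (1 - 2 * dl)%:M in ddfac K *m (ddfac K)^T = K.
Proof.
move=> K; apply: ddfacK; first by rewrite raddfB/= tr_scalar_mx inv_sym.
apply: dd_criterion => i j; rewrite /K !mxE.
rewrite (_ : H i j - _ - _ = H i j - (i == j)%:R) ?inv_good//.
by case: (i == j); rewrite ?mulr1n ?mulr0n; ring.
Qed.

End good_design.

Definition gram {R : realType} {n p : nat} (X : 'M[R]_(n, p)) : 'M[R]_p :=
  n%:R^-1 *: (X^T *m X).

(** The scale dl / p, rather than dl, gives diagonal dominance to a p x p perturbation; it is also
    the source of the order p^2 log p for n in the concentration step. *)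
Definition good_design {R : realType} {n p : nat} (dl : R) (X : 'M[R]_(n, p)) : Prop :=
  forall i j, `|gram X i j - (i == j)%:R| <= dl / p%:R.

Lemma gram_sym {R : realType} n p (X : 'M[R]_(n, p)) : (gram X)^T = gram X.
Proof. by rewrite /gram linearZ/= trmx_mul trmxK. Qed.

Section fixed_design.
Context {R : realType} {n p : nat}.
Variables (X : 'M[R]_(n, p)) (dl : R).
Hypotheses (n0 : (0 < n)%N) (dl0 : 0 <= dl) (dl1 : dl < 1 / 2).
Hypothesis goodX : good_design dl X.

Let nR : 0 < n%:R :> R. Proof. by rewrite ltr0n. Qed.
Let dl1' : dl <= 1 / 2. Proof. exact: ltW. Qed.
Let H := invmx (gram X).
Let Hsym : H^T = H. Proof. by apply: inv_sym; exact: gram_sym. Qed.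
Let unitS : gram X \in unitmx. Proof. exact: (good_unitmx dl0 dl1' goodX). Qed.
Let HS : H *m gram X = 1%:M. Proof. exact: mulVmx. Qed.

Definition vsd : R := Num.sqrt (1 + 2 * dl).
(** Least squares scaled by sqrt n / [vsd]: its covariance is H / (1 + 2 dl), below the identity,
    and [lsq_noise] supplies the difference. *)
Definition lsq : 'M[R]_(p, n) := (vsd^-1 * (Num.sqrt n%:R)^-1) *: (H *m X^T).
Definition lsq_noise : 'M[R]_(p, #|{: 'I_p * 'I_p}|) :=
  vsd^-1 *: ddfac ((1 + 2 * dl)%:M - H).

Let v2 : vsd ^+ 2 = 1 + 2 * dl. Proof. by rewrite sqr_sqrtr// addr_ge0// mulr_ge0. Qed.
Let vn0 : vsd != 0.
Proof. by rewrite gt_eqF// sqrtr_gt0; have := dl0; lra. Qed.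
Let sn2 : Num.sqrt (n%:R : R) ^+ 2 = n%:R. Proof. by rewrite sqr_sqrtr// ltW. Qed.
Let sn0 : Num.sqrt (n%:R : R) != 0. Proof. by rewrite gt_eqF// sqrtr_gt0. Qed.

Lemma lsq_orth : lsq *m lsq^T + lsq_noise *m lsq_noise^T = 1%:M.
Proof.
rewrite /lsq /lsq_noise !linearZ/= -?scalemxAl -?scalemxAr !scalerA.
rewrite (noise_fac_upper (gram_sym X) dl0 dl1' goodX) -/H.
rewrite trmx_mul trmxK Hsym mulmxA -(mulmxA H X^T X).
have -> : X^T *m X = n%:R *: gram X by rewrite scalerA divff ?scale1r// gt_eqF.
rewrite -scalemxAr HS -scalemxAl mul1mx scalerA.
have -> : vsd^-1 * (Num.sqrt n%:R)^-1 * (vsd^-1 * (Num.sqrt n%:R)^-1) * n%:R = (1 + 2 * dl)^-1.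
  rewrite -v2 -[in X in _ * X]sn2; field.
  by rewrite vn0.
rewrite -invfM -expr2 v2 -scalerDr addrCA subrr addr0 scale_scalar_mx mulVf//.
by rewrite gt_eqF//; have := dl0; lra.
Qed.

Lemma lsq_mean (b : 'cV[R]_p) : lsq *m (X *m b) = (vsd^-1 * Num.sqrt n%:R) *: b.
Proof.
rewrite /lsq -scalemxAl mulmxA -(mulmxA H X^T X).
have -> : X^T *m X = n%:R *: gram X by rewrite scalerA divff ?scale1r// gt_eqF.
rewrite -scalemxAr HS -scalemxAl mul1mx scalerA; congr (_ *: _).
by rewrite -[in X in _ * X]sn2; field; rewrite vn0 sn0.
Qed.

(** [simX] carries a sequence-model observation into n-space; this scale keeps the resulting
    covariance below the projection [Pr] onto the columns of X. *)
Definition tausd : R := Num.sqrt ((1 - 2 * dl) / n%:R).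
Definition simX : 'M[R]_(n, p) := tausd *: X.
Let Pr : 'M[R]_n := n%:R^-1 *: (X *m H *m X^T).
Definition sim_noise : 'M[R]_(n, n + #|{: 'I_p * 'I_p}|) :=
  row_mx (1%:M - Pr) ((Num.sqrt n%:R)^-1 *: (X *m ddfac (H - (1 - 2 * dl)%:M))).

Let Prsym : Pr^T = Pr.
Proof. by rewrite /Pr linearZ/= !trmx_mul trmxK Hsym mulmxA. Qed.

Let PrPr : Pr *m Pr = Pr.
Proof.
rewrite /Pr -scalemxAl -scalemxAr; congr (_ *: _).
rewrite !mulmxA -(mulmxA (X *m H) X^T X).
have -> : n%:R^-1 *: (X *m H *m (X^T *m X) *m H *m X^T) = X *m H *m gram X *m H *m X^T.
  by rewrite /gram -scalemxAr -!scalemxAl.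
by rewrite -(mulmxA X H) HS mulmx1.
Qed.

Let tau2 : tausd ^+ 2 = (1 - 2 * dl) / n%:R.
Proof. by rewrite sqr_sqrtr// divr_ge0 ?ltW//; have := dl1; lra. Qed.

Lemma tausd_gt0 : 0 < tausd.
Proof. by rewrite sqrtr_gt0 divr_gt0//; have := dl1; lra. Qed.

(** The missing covariance splits into 1 - [Pr], its own square since [Pr] is a symmetric
    projection, and X (H - (1 - 2 dl)) X^T / n, whose middle factor has an explicit square root. *)
Lemma sim_orth : simX *m simX^T + sim_noise *m sim_noise^T = 1%:M.
Proof.
have h1 : simX *m simX^T = ((1 - 2 * dl) / n%:R) *: (X *m X^T).
  by rewrite /simX linearZ/= -scalemxAl -scalemxAr scalerA -expr2 tau2.
have h2 : (1%:M - Pr) *m (1%:M - Pr)^T = 1%:M - Pr.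
  by rewrite raddfB/= trmx1 Prsym mulmxBl mul1mx mulmxBr mulmx1 PrPr subrr subr0.
pose B := (Num.sqrt n%:R)^-1 *: (X *m ddfac (H - (1 - 2 * dl)%:M)).
have h3 : B *m B^T = Pr - ((1 - 2 * dl) / n%:R) *: (X *m X^T).
  rewrite /B [(_ *: _)^T]linearZ/= -scalemxAl -?scalemxAr ?scalerA -invfM -expr2 sn2.
  rewrite trmx_mul mulmxA -(mulmxA X) (noise_fac_lower (gram_sym X) dl0 dl1' goodX) -/H.
  rewrite mulmxBr mulmxBl mul_mx_scalar -scalemxAl scalerBr -/Pr scalerA.
  by rewrite [n%:R^-1 * _]mulrC.
rewrite /sim_noise -/B tr_row_mx mul_row_col h1 h2 h3.
by set Z := _ *: (X *m X^T); rewrite addrC -addrA (subrK Z) subrK.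
Qed.

End fixed_design.

Section joint_law.
Context {d d1 d2} {Om : measurableType d} {T1 : measurableType d1} {T2 : measurableType d2}
  {R : realType} (P : probability Om R) (mu : probability T1 R).
Local Open Scope ereal_scope.

(** Independence makes the joint law a product, so the noise can be integrated out with the design
    held fixed. *)
Lemma ge0_integral_indep2 (Y : Om -> T1) (Z : Om -> T2) (f : T1 * T2 -> \bar R) :
  measurable_fun setT Y -> measurable_fun setT Z ->
  (forall A, measurable A -> P (Y @^-1` A) = mu A) ->
  indep2 P (sigma_of Y) (sigma_of Z) ->
  measurable_fun setT f -> (forall z, 0 <= f z) ->
  \int[P]_w f (Y w, Z w) = \int[P]_w \int[mu]_y f (y, Z w).
Proof.
move=> mY mZ lawY ind mf f0.
pose mZi := isMeasurableFun.Build _ _ _ _ Z mZ.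
pose Z' : {mfun Om >-> T2} := HB.pack Z mZi.
pose nu : probability T2 R := distribution P Z'.
have mYZ : measurable_fun setT (fun w => (Y w, Z w)) by exact: measurable_fun_pair.
pose mYZi := isMeasurableFun.Build _ _ _ _ (fun w => (Y w, Z w)) mYZ.
pose YZ : {mfun Om >-> (T1 * T2)%type} := HB.pack (fun w => (Y w, Z w)) mYZi.
have joint A B : measurable A -> measurable B ->
    distribution P YZ (A `*` B) = mu A * nu B.
  move=> mA mB; rewrite -[LHS]/(P (Y @^-1` A `&` Z @^-1` B)).
  have -> := ind (Y @^-1` A) (Z @^-1` B) (ex_intro2 _ _ A mA erefl) (ex_intro2 _ _ B mB erefl).
  rewrite EFinM !fineK; first by rewrite lawY.
    by apply: fin_num_measure; rewrite -[X in measurable X]setTI; exact: (mZ measurableT B mB).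
  by apply: fin_num_measure; rewrite -[X in measurable X]setTI; exact: (mY measurableT A mA).
transitivity (\int[distribution P YZ]_z f z).
  by rewrite ge0_integral_distribution.
transitivity (\int[mu \x nu]_z f z).
  by apply: eq_measure_integral => A mA _; apply/esym/product_measure_unique.
rewrite fubini_tonelli2// ge0_integral_distribution//.
  exact: (@measurable_fun_fubini_tonelli_G _ _ _ _ _ mu).
by move=> z; apply: integral_ge0.
Qed.

End joint_law.

(** * Concentration of the Gram matrix *)

Section exp_ineq.
Context {R : realType}.

Lemma expR_le_quad (x : R) : expR x <= 1 + x + x ^+ 2 * expR `|x|.
Proof.
have h1 : expR x - 1 <= x * expR x.
  have := expR_ge1Dx (- x); rewrite expRN => h.
  have e := expR_gt0 x.
  have : (1 - x) * expR x <= 1 by rewrite -ler_pdivlMr// div1r.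
  lra.
have h2 := expR_ge1Dx x.
have [x0|x0] := ger0P x.
  have : x * (expR x - 1) <= x * (x * expR x) by rewrite ler_wpM2l.
  lra.
have e1 : 1 <= expR (- x) by have := expR_ge1Dx (- x); lra.
have h3 : x * (expR x - 1) <= x ^+ 2.
  have : - x * (1 - expR x) <= - x * - x by rewrite ler_wpM2l; lra.
  lra.
have : x ^+ 2 * 1 <= x ^+ 2 * expR (- x) by rewrite ler_wpM2l ?sqr_ge0.
lra.
Qed.

Lemma expR_ge_sqr (x : R) : 0 <= x -> x ^+ 2 / 2 <= expR x.
Proof.
move=> x0; have /= h := expR_ge1Dxn 1 x0.
by apply: (le_trans _ h); rewrite -[leLHS]add0r lerD.
Qed.

(** Half of the exponent k absorbs y^2 and the other half exp(|l| |y|); the remaining factor l^2 is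
    what a Bernstein-type bound asks for. *)
Lemma expR_sqr_bound (k l y : R) : 0 < k -> `|l| <= k / 2 ->
  expR (l * y) <= 1 + l * y + l ^+ 2 * (8 / k ^+ 2) * expR (k * `|y|).
Proof.
move=> k0 lk; apply: (le_trans (expR_le_quad _)).
rewrite lerD2l exprMn normrM.
have -> : l ^+ 2 * y ^+ 2 * expR (`|l| * `|y|) = l ^+ 2 * (y ^+ 2 * expR (`|l| * `|y|)) by ring.
have -> : l ^+ 2 * (8 / k ^+ 2) * expR (k * `|y|) = l ^+ 2 * (8 / k ^+ 2 * expR (k * `|y|)) by ring.
rewrite ler_wpM2l ?sqr_ge0//.
have y2 : y ^+ 2 <= 8 / k ^+ 2 * expR (k / 2 * `|y|).
  have := @expR_ge_sqr (k / 2 * `|y|).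
  rewrite mulr_ge0 ?divr_ge0 ?(ltW k0)// => /(_ isT).
  rewrite exprMn real_normK ?num_real// => h.
  have -> : y ^+ 2 = 8 / k ^+ 2 * ((k / 2) ^+ 2 * y ^+ 2 / 2) by field; rewrite gt_eqF.
  by rewrite ler_wpM2l// divr_ge0// sqr_ge0.
apply: (@le_trans _ _ (8 / k ^+ 2 * expR (k / 2 * `|y|) * expR (k / 2 * `|y|))).
  apply: ler_pM; rewrite ?sqr_ge0 ?expR_ge0//.
  by rewrite ler_expR ler_wpM2r.
have -> : k * `|y| = k / 2 * `|y| + k / 2 * `|y| by field.
by rewrite expRD mulrA.
Qed.

End exp_ineq.

Section gauss_square.
Context {R : realType}.
Local Open Scope ereal_scope.

(** The mean of exp(g^2 / 4) for a standard Gaussian g, that is sqrt 2, left as a ratio of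
    normalising constants. *)
Definition gsq : R := (normal_peak 1 / normal_peak (Num.sqrt 2))%R.

Lemma gsq_ge0 : (0 <= gsq)%R.
Proof. by rewrite divr_ge0// normal_peak_ge0. Qed.

Lemma integral_gauss_sqr : \int[@gauss R]_x (expR (x ^+ 2 / 4))%:E = gsq%:E.
Proof.
have s20 : Num.sqrt (2 : R) != 0%R by rewrite gt_eqF// sqrtr_gt0.
rewrite ge0_integral_gauss; last 2 first.
- apply/measurable_EFinP; apply: measurableT_comp => //; exact: measurable_funM.
- by move=> x; rewrite lee_fin expR_ge0.
transitivity (\int[@lebesgue_measure R]_x (gsq * normal_pdf 0 (Num.sqrt 2) x)%:E).
  apply: eq_integral => x _; rewrite -EFinM; congr EFin.
  rewrite gpdfE normal_pdfE// /normal_fun subr0 sqr_sqrtr// mulrCA -expRD /gsq.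
  rewrite mulrA divfK; last by rewrite gt_eqF// normal_peak_gt0.
  by congr (_ * expR _)%R; field.
rewrite integral_finZl.
- by rewrite integral_normal_pdf mule1.
- exact: measurable_normal_pdf.
- by move=> x; exact: normal_pdf_ge0.
- exact: gsq_ge0.
Qed.

End gauss_square.

Section subgaussian_square.
Context {d} {Om : measurableType d} {R : realType} (P : probability Om R).
Variables (Z : Om -> R) (s2 : R).
Hypotheses (mZ : measurable_fun setT Z) (s20 : 0 < s2).
Local Open Scope ereal_scope.
Hypothesis subG : forall t : R, \int[P]_w (expR (t * Z w))%:E <= (expR (s2 * t ^+ 2 / 2))%:E.
Hypothesis varZ : \int[P]_w (Z w ^+ 2)%:E = 1.

(** With this k the averaged bound exp(s2 (2 k) g^2 / 2) is exp(g^2 / 4), integrable against the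
    Gaussian. *)
Let k : R := ((4 * s2)^-1)%R.
Let k0 : (0 < k)%R. Proof. by rewrite invr_gt0 mulr_gt0. Qed.

(* exp (k z^2) is the Gaussian average over g of exp (sqrt (2 k) g z), which reduces square-exponential moments to linear ones. *)
Lemma integral_exp_sqr : \int[P]_w (expR (k * Z w ^+ 2))%:E <= gsq%:E.
Proof.
pose c : R := Num.sqrt (2 * k).
have c2 : (c ^+ 2 = 2 * k)%R by rewrite sqr_sqrtr// mulr_ge0// ltW.
have mf : measurable_fun setT (fun z : Om * R => (expR (c * z.2 * Z z.1))%:E).
  apply/measurable_EFinP; apply: measurableT_comp => //; apply: measurable_funM.
    exact: measurable_funM.
  exact: (measurableT_comp mZ).
have f0 (z : Om * R) : 0 <= (expR (c * z.2 * Z z.1))%:E by rewrite lee_fin expR_ge0.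
have -> : \int[P]_w (expR (k * Z w ^+ 2))%:E =
    \int[gauss]_g \int[P]_w (expR (c * g * Z w))%:E.
  apply: etrans (@fubini_tonelli _ _ _ _ _ P gauss _ mf f0).
  apply: eq_integral => w _.
  under [RHS]eq_integral do rewrite /= mulrAC.
  by rewrite integral_gauss_mgf exprMn c2; congr (expR _)%:E; field.
rewrite -integral_gauss_sqr.
apply: ge0_le_integral => //.
- by move=> g _; apply: integral_ge0.
- exact: (@measurable_fun_fubini_tonelli_G _ _ _ _ _ P _ mf).
- apply/measurable_EFinP; apply: measurableT_comp => //; exact: measurable_funM.
- move=> g _; apply: (le_trans (subG (c * g))); rewrite lee_fin ler_expR exprMn c2.
  rewrite le_eqVlt; apply/orP; left; apply/eqP; rewrite /k; field.
  by rewrite gt_eqF.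
Qed.

Definition sqC : R := (8 / k ^+ 2 * expR k * gsq)%R.

Lemma sqC_ge0 : (0 <= sqC)%R.
Proof.
apply: mulr_ge0; last exact: gsq_ge0.
by apply: mulr_ge0; [rewrite divr_ge0// sqr_ge0|exact: expR_ge0].
Qed.

(** Second-order expansion: the linear term has mean zero because [Z] has second moment 1, and the
    square-exponential moment controls the remainder. *)
Lemma mgf_sqr (l : R) : (`|l| <= k / 2)%R ->
  \int[P]_w (expR (l * (Z w ^+ 2 - 1)))%:E <= (expR (sqC * l ^+ 2))%:E.
Proof.
move=> lk.
pose G w : R := (l ^+ 2 * (8 / k ^+ 2 * expR k) * expR (k * Z w ^+ 2))%R.
have mZ2 : measurable_fun setT (fun w => Z w ^+ 2)%R by exact: measurable_funX.
have mE (u : R) : measurable_fun setT (fun w => expR (u * Z w ^+ 2))%R.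
  by apply: measurableT_comp => //; exact: measurable_funM.
have mE1 : measurable_fun setT (fun w => expR (l * (Z w ^+ 2 - 1)))%R.
  apply: measurableT_comp => //; apply: measurable_funM => //; exact: measurable_funB.
have mG : measurable_fun setT G by exact: measurable_funM.
have cG : (0 <= l ^+ 2 * (8 / k ^+ 2 * expR k))%R.
  apply: mulr_ge0; first exact: sqr_ge0.
  by apply: mulr_ge0; [rewrite divr_ge0// sqr_ge0|exact: expR_ge0].
have G0 w : (0 <= G w)%R by rewrite mulr_ge0// expR_ge0.
have IG : \int[P]_w (G w)%:E <= (sqC * l ^+ 2)%:E.
  rewrite integral_finZl//.
  apply: (@le_trans _ _ ((l ^+ 2 * (8 / k ^+ 2 * expR k))%:E * gsq%:E)).
    by rewrite lee_wpmul2l ?lee_fin//; exact: integral_exp_sqr.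
  by rewrite -EFinM lee_fin /sqC le_eqVlt; apply/orP; left; apply/eqP; ring.
have pt w : (expR (l * (Z w ^+ 2 - 1)) <= 1 + l * (Z w ^+ 2 - 1) + G w)%R.
  apply: (le_trans (expR_sqr_bound _ k0 lk)); rewrite lerD2l.
  have -> : (G w = l ^+ 2 * (8 / k ^+ 2) * (expR k * expR (k * Z w ^+ 2)))%R.
    by rewrite /G; ring.
  apply: ler_wpM2l; first by rewrite mulr_ge0 ?sqr_ge0// divr_ge0// sqr_ge0.
  rewrite -expRD ler_expR -[X in (_ <= X + _)%R]mulr1 -mulrDr ler_wpM2l ?(ltW k0)//.
  by rewrite (le_trans (ler_normB _ _))// normr1 ger0_norm ?sqr_ge0// addrC.
apply: (@le_trans _ _ (1 + sqC * l ^+ 2)%:E); last by rewrite lee_fin expR_ge1Dx.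
have Z20 w : (0 <= Z w ^+ 2)%R by exact: sqr_ge0.
(* The linear term has no sign: l, or - l Z^2 when l < 0, is added on both sides to keep every
   integrand nonnegative. *)
have [l0|l0] := leP 0%R l.
  rewrite -(leeD2rE _ _ (_ : l%:E \is a fin_num))//.
  have -> : \int[P]_w (expR (l * (Z w ^+ 2 - 1)))%:E + l%:E =
      \int[P]_w (expR (l * (Z w ^+ 2 - 1)) + l)%:E.
    rewrite (integral_finD P mE1 (measurable_cst l) (fun=> expR_ge0 _) (fun=> l0)).
    by rewrite /= integral_prob_cst.
  have mlZ : measurable_fun setT (fun w => l * Z w ^+ 2)%R by exact: measurable_funM.
  have lZ0 w : (0 <= l * Z w ^+ 2)%R by rewrite mulr_ge0.
  apply: (@le_trans _ _ (\int[P]_w (1 + (l * Z w ^+ 2 + G w))%:E)).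
    apply: le_integral_fin.
    - by apply: measurable_funD.
    - by apply: measurable_funD => //; apply: measurable_funD.
    - by move=> w; rewrite addr_ge0// expR_ge0.
    - by move=> w; have := pt w; lra.
  have mlG : measurable_fun setT (fun w => l * Z w ^+ 2 + G w)%R by exact: measurable_funD.
  have lG0 w : (0 <= l * Z w ^+ 2 + G w)%R by rewrite addr_ge0.
  rewrite (integral_finD P (measurable_cst (1%R : R)) mlG (fun=> ler01) lG0).
  rewrite (integral_finD P mlZ mG lZ0 G0) (integral_finZl P mZ2 Z20 l0).
  rewrite /= integral_prob_cst varZ mule1 EFinD -addeA leeD2l//.
  by rewrite [leRHS]addeC leeD2l.
rewrite -(leeD2rE _ _ (_ : (- l)%:E \is a fin_num))//.
have nl0 : (0 <= - l)%R by rewrite oppr_ge0 ltW.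
have mlZ : measurable_fun setT (fun w => - l * Z w ^+ 2)%R by exact: measurable_funM.
have lZ0 w : (0 <= - l * Z w ^+ 2)%R by rewrite mulr_ge0.
have lE : \int[P]_w (- l * Z w ^+ 2)%:E = (- l)%:E.
  by rewrite (integral_finZl P mZ2 Z20 nl0) varZ mule1.
rewrite -[X in _ + X <= _]lE -(integral_finD P mE1 mlZ (fun=> expR_ge0 _) lZ0).
apply: (@le_trans _ _ (\int[P]_w ((1 - l) + G w)%:E)).
  apply: le_integral_fin.
  - by apply: measurable_funD.
  - by apply: measurable_funD.
  - by move=> w; rewrite addr_ge0// expR_ge0.
  - by move=> w; have := pt w; lra.
have l10 : (0 <= 1 - l)%R by lra.
rewrite (integral_finD P (measurable_cst ((1 - l)%R : R)) mG (fun=> l10) G0).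
rewrite /= integral_prob_cst !EFinD -!addeA leeD2l//.
by rewrite [leRHS]addeC leeD2l.
Qed.

End subgaussian_square.

Section gram_measurable.
Context {d} {Om : measurableType d} {R : realType} {n p : nat} (X : Om -> 'M[R]_(n, p)).
Hypothesis mX : measurable_fun setT (fun w => mxtup (X w)).

Lemma mxtupE (M : 'M[R]_(n, p)) i j : tnth (tnth (mxtup M) i) j = M i j.
Proof. by rewrite !tnth_mktuple. Qed.

Lemma measurable_entry i j : measurable_fun setT (fun w => X w i j).
Proof.
under eq_fun do rewrite -mxtupE.
apply: (measurableT_comp (measurable_tnth j)).
exact: (measurableT_comp (measurable_tnth i)).
Qed.

Lemma gramE (M : 'M[R]_(n, p)) j k : gram M j k = n%:R^-1 * \sum_i M i j * M i k.
Proof. by rewrite !mxE; congr (_ * _); apply: eq_bigr => i _; rewrite mxE. Qed.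

Lemma measurable_gram j k : measurable_fun setT (fun w => gram (X w) j k).
Proof.
under eq_fun do rewrite gramE.
apply: measurable_funM => //; apply: measurable_sum => i.
by apply: measurable_funM; exact: measurable_entry.
Qed.

Lemma measurable_good_design dl : measurable [set w | good_design dl (X w)].
Proof.
rewrite [X in measurable X](_ : _ = \bigcap_(i in [set: 'I_p]) \bigcap_(j in [set: 'I_p])
    ((fun w => gram (X w) i j - (i == j)%:R) @^-1` [set` `[- (dl / p%:R), dl / p%:R]])); last first.
  apply/seteqP; split => w /=.
    by move=> h i _ j _ /=; rewrite in_itv/= -ler_norml; exact: h.
  by move=> h i j; have := h i I j I; rewrite /= in_itv/= -ler_norml.
apply: fin_bigcap_measurable; first exact: finite_finset.
move=> i _; apply: fin_bigcap_measurable; first exact: finite_finset.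
move=> j _; rewrite -[X in measurable X]setTI.
have m : measurable_fun setT (fun w => gram (X w) i j - (i == j)%:R).
  by apply: measurable_funB => //; exact: measurable_gram.
exact: m.
Qed.

End gram_measurable.

Section concentration.
Context {d} {Om : measurableType d} {R : realType} (P : probability Om R).
Context {n p : nat} (X : Om -> 'M[R]_(n, p)) (sigma2 : R).
Hypotheses (sub : subG_design P X sigma2) (n0 : (0 < n)%N).
Local Open Scope ereal_scope.

(** A larger parameter preserves the sub-Gaussian bound; the maximum with 1 gives the positivity
    that [mgf_sqr] asks for. *)
Let s2 : R := Num.max sigma2 1%R.
Let s20 : (0 < s2)%R. Proof. by rewrite lt_max ltr01 orbT. Qed.
Let mX : measurable_fun setT (fun w => mxtup (X w)). Proof. by case: sub. Qed.
Let mXij i j : measurable_fun setT (fun w => X w i j). Proof. exact: measurable_entry. Qed.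
Let nR : (0 < n%:R :> R)%R. Proof. by rewrite ltr0n. Qed.

Definition proj (a : 'I_p -> R) i w : R := (\sum_j a j * X w i j)%R.

Lemma measurable_proj a i : measurable_fun setT (proj a i).
Proof. by apply: measurable_sum => j; apply: measurable_funM. Qed.

Lemma proj_subG a i t : (\sum_j a j ^+ 2 = 1)%R ->
  \int[P]_w (expR (t * proj a i w))%:E <= (expR (s2 * t ^+ 2 / 2))%:E.
Proof.
move=> a1; case: sub => _ _ _ [_ _ + _] => /(_ i a a1 t) /le_trans; apply.
rewrite lee_fin ler_expR ler_wpM2r// ler_wpM2r ?sqr_ge0//.
by rewrite le_max lexx.
Qed.

Lemma proj_var a i : (\sum_j a j ^+ 2 = 1)%R -> \int[P]_w (proj a i w ^+ 2)%:E = 1.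
Proof.
move=> a1; case: sub => _ _ _ [_ cov _ _].
have i2 j : P.-integrable setT (fun w => (X w i j ^+ 2)%:E).
  apply/integrableP; split; first by apply/measurable_EFinP; exact: measurable_funX.
  under eq_integral do rewrite gee0_abs ?lee_fin ?sqr_ge0// expr2.
  by rewrite cov eqxx ltry.
have ijk j k : P.-integrable setT (fun w => (X w i j * X w i k)%:E).
  (* Cross products are dominated by |x y| <= x^2 + y^2, integrable by isotropy. *)
  apply: (@le_integrable _ _ _ _ _ _ _ (fun w => (X w i j ^+ 2)%:E + (X w i k ^+ 2)%:E)) => //.
  - by apply/measurable_EFinP; exact: measurable_funM.
  - move=> w _; rewrite -EFinD !abse_EFin lee_fin [leRHS]ger0_norm ?addr_ge0 ?sqr_ge0//.
    rewrite normrM -[in leRHS](real_normK (num_real (X w i j))) -[in leRHS](real_normK (num_real (X w i k))).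
    have := sqr_ge0 (`|X w i j| - `|X w i k|)%R; have := sqr_ge0 `|X w i j|%R.
    have := sqr_ge0 `|X w i k|%R; nra.
  - by apply: integrableD.
transitivity (\int[P]_w (\sum_j \sum_k ((a j * a k)%:E * (X w i j * X w i k)%:E))).
  apply: eq_integral => w _; rewrite /proj expr2 mulr_suml -sumEFin.
  apply: eq_bigr => j _; rewrite mulr_sumr -sumEFin; apply: eq_bigr => k _.
  by rewrite -EFinM; congr EFin; ring.
rewrite integral_sum//; last first.
  by move=> j; apply: integrable_sum => // k _; exact: integrableZl.
transitivity (\sum_j (a j ^+ 2)%:E); last by rewrite sumEFin a1.
apply: eq_bigr => j _; rewrite integral_sum//; last by move=> k; exact: integrableZl.
under eq_bigr => k _ do rewrite integralZl// cov -EFinM.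
rewrite sumEFin (bigD1 j)//= eqxx mulr1 big1 ?addr0 ?expr2// => k kj.
by rewrite eq_sym (negbTE kj) mulr0.
Qed.

Definition concC : R := (sqC s2 + 1)%R.
Definition conck : R := ((4 * s2)^-1)%R.

Lemma concC_gt0 : (0 < concC)%R.
Proof. by rewrite /concC ltr_wpDl// sqC_ge0. Qed.

(** Rows are independent with equal laws, so the moment generating function of the sum is an n-th
    power. *)
Lemma mgf_sum_sqr a l : (\sum_j a j ^+ 2 = 1)%R -> (`|l| <= conck / 2)%R ->
  \int[P]_w (expR (l * \sum_i (proj a i w ^+ 2 - 1)))%:E <= (expR (n%:R * concC * l ^+ 2))%:E.
Proof.
move=> a1 lk.
pose i0 : 'I_n := Ordinal n0.
have pE i w : (\sum_j a j * tnth (tnth (mxtup (X w)) i) j)%R = proj a i w.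
  by apply: eq_bigr => j _; rewrite mxtupE.
case: (sub) => _ ind iden _.
have mrow i : measurable_fun setT (fun w => tnth (mxtup (X w)) i).
  exact: (measurableT_comp (measurable_tnth i)).
pose rowi := isMeasurableFun.Build _ _ _ _ _ (mrow i0).
pose row0 : {mfun Om >-> p.-tuple R} := HB.pack (fun w => tnth (mxtup (X w)) i0) rowi.
pose rho : probability (p.-tuple R) R := distribution P row0.
pose f (x : p.-tuple R) : R := expR (l * ((\sum_j a j * tnth x j) ^+ 2 - 1)).
have mf : measurable_fun setT f.
  apply: measurableT_comp => //; apply: measurable_funM => //; apply: measurable_funB => //.
  apply: measurable_funX; apply: measurable_sum => j; apply: measurable_funM => //.
  exact: measurable_tnth.
have f0 x : (0 <= f x)%R by exact: expR_ge0.
have lawX := @law_iidm _ _ _ _ _ rho P n _ mX (fun i B mB => iden i i0 B mB) ind.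
have fE : \int[rho]_x (f x)%:E <= (expR (concC * l ^+ 2))%:E.
  rewrite ge0_integral_distribution//; last exact/measurable_EFinP.
  have -> : \int[P]_w ((fun x => (f x)%:E) \o row0) w =
      \int[P]_w (expR (l * (proj a i0 w ^+ 2 - 1)))%:E.
    by apply: eq_integral => w _; rewrite -pE.
  apply: (le_trans (mgf_sqr (measurable_proj a i0) s20 (fun t => proj_subG i0 t a1) (proj_var i0 a1) lk)).
  by rewrite lee_fin ler_expR ler_wpM2r ?sqr_ge0// /concC lerDl.
pose c := fine (\int[rho]_x (f x)%:E).
have cE : \int[rho]_x (f x)%:E = c%:E.
  rewrite fineK// ge0_fin_numE; first exact: le_lt_trans fE (ltry _).
  by apply: integral_ge0 => x _; rewrite lee_fin.
have c0 : (0 <= c)%R by rewrite -lee_fin -cE; apply: integral_ge0 => x _; rewrite lee_fin.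
have -> : \int[P]_w (expR (l * \sum_i (proj a i w ^+ 2 - 1)))%:E =
    \int[P]_w (\prod_i f (tnth (mxtup (X w)) i))%:E.
  apply: eq_integral => w _; rewrite mulr_sumr expR_sum; congr EFin.
  by apply: eq_bigr => i _; rewrite /f pE.
rewrite (ge0_integral_law (f := fun x => (\prod_i f (tnth x i))%:E) mX lawX); last 2 first.
- apply/measurable_EFinP; apply: measurable_prod => i _.
  exact: (measurableT_comp mf (measurable_tnth i)).
- by move=> x; rewrite lee_fin prodr_ge0.
rewrite (@integral_iidm_prod _ _ _ rho n (fun=> f) (fun=> c))//.
rewrite prodr_const card_ord lee_fin -mulrA expRM_natl lerXn2r ?nnegrE ?expR_ge0//.
by rewrite -lee_fin -cE.
Qed.

(** Polarization by unit vectors: with (e_j + e_k) / sqrt 2 and (e_j - e_k) / sqrt 2, an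
    off-diagonal Gram entry becomes half a difference of sums of squares. *)
Definition pairvec (j k : 'I_p) (e : bool) : 'I_p -> R := fun m =>
  if j == k then (j == m)%:R else (((j == m)%:R + (-1) ^+ e * (k == m)%:R) / Num.sqrt 2)%R.

Let sq2 : (Num.sqrt (2 : R) ^+ 2 = 2)%R. Proof. by rewrite sqr_sqrtr. Qed.
Lemma pairvec_norm j k e : (\sum_m pairvec j k e m ^+ 2 = 1)%R.
Proof.
rewrite /pairvec; have [_|jk] := eqVneq j k.
  transitivity (\sum_m (j == m)%:R * (1 : R))%R; last by rewrite sum_delta.
  by apply: eq_bigr => m _; case: (j == m); rewrite ?expr1n ?expr0n ?mulr1.
transitivity (\sum_m (j == m)%:R * (1 / 2 : R) + \sum_m (k == m)%:R * (1 / 2 : R))%R.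
  rewrite -big_split/=; apply: eq_bigr => m _; rewrite exprMn exprVn sq2.
  have [<-|_] := eqVneq j m; first by rewrite eq_sym (negbTE jk) /= mulr1n mulr0n; field.
  by rewrite add0r exprMn sqrr_sign mul1r; case: (k == m); rewrite /= ?mulr1n ?mulr0n; field.
by rewrite !sum_delta; field.
Qed.

Lemma proj_pairvec j k e i w : proj (pairvec j k e) i w =
  if j == k then X w i j else ((X w i j + (-1) ^+ e * X w i k) / Num.sqrt 2)%R.
Proof.
rewrite /proj /pairvec; case: (j == k); first by rewrite sum_delta.
transitivity ((\sum_m (j == m)%:R * X w i m + (-1) ^+ e * \sum_m (k == m)%:R * X w i m) / Num.sqrt 2)%R.
  rewrite mulr_sumr -big_split/= mulr_suml; apply: eq_bigr => m _.
  by rewrite mulrAC mulrDl mulrA.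
by rewrite !sum_delta.
Qed.

Definition sumsq a w : R := (\sum_i (proj a i w ^+ 2 - 1))%R.

Lemma gram_sumsq j k w : (n%:R * (gram (X w) j k - (j == k)%:R))%R =
  (if j == k then sumsq (pairvec j k false) w
   else (sumsq (pairvec j k false) w - sumsq (pairvec j k true) w) / 2)%R.
Proof.
rewrite gramE mulrBr mulVKf; last by rewrite gt_eqF.
rewrite /sumsq.
have [->|jk] := eqVneq j k.
  rewrite /= mulr1n mulr1 sumrB sumr_const card_ord; congr (_ - _)%R.
  by apply: eq_bigr => i _; rewrite proj_pairvec eqxx expr2.
rewrite /= mulr0n mulr0 subr0 -sumrB mulr_suml; apply: eq_bigr => i _.
by rewrite !proj_pairvec (negbTE jk) !exprMn exprVn sq2 expr0 expr1; field.
Qed.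

Lemma gram_tail (u : R) : (0 < u)%R -> (u <= conck * concC)%R ->
  P (~` [set w | good_design (u * p%:R) (X w)]) <=
  (4 * p%:R ^+ 2 * expR (- (n%:R * u ^+ 2 / (4 * concC))))%:E.
Proof.
move=> u0 uk.
have [p0|p0] := posnP p.
  rewrite (_ : ~` _ = set0) ?measure0 ?lee_fin ?mulr_ge0 ?expR_ge0 ?sqr_ge0//.
  apply/seteqP; split => // w /=; apply => i j; have := ltn_ord i.
  by rewrite [X in (_ < X)%N]p0.
have pR : (0 < p%:R :> R)%R by rewrite ltr0n.
have C0 := concC_gt0.
(* Minimises - l n u + n [concC] l^2, with value - n u^2 / (4 [concC]). *)
pose l : R := (u / (2 * concC))%R.
have l0 : (0 <= l)%R by rewrite divr_ge0 ?mulr_ge0 ?(ltW u0) ?(ltW C0).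
have lk : (l <= conck / 2)%R.
  rewrite ler_pdivrMr ?mulr_gt0//.
  by apply: (le_trans uk); rewrite le_eqVlt; apply/orP; left; apply/eqP; field.
(* Exponential Markov bound for one pair (j, k), one polarization vector e and one sign t; the union
   has 4 p^2 terms. *)
pose F j k e (t : bool) w : R :=
  (expR (- (l * n%:R * u)) * expR ((-1) ^+ t * l * sumsq (pairvec j k e) w))%R.
have mS a : measurable_fun setT (sumsq a).
  apply: measurable_sum => i; apply: measurable_funB => //.
  by apply: measurable_funX; exact: measurable_proj.
have mexp a (c : R) : measurable_fun setT (fun w => expR (c * sumsq a w)).
  by apply: measurableT_comp => //; exact: measurable_funM.
have mF j k e t : measurable_fun setT (F j k e t) by exact: measurable_funM.
have F0 j k e t w : (0 <= F j k e t w)%R by rewrite mulr_ge0// expR_ge0.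
have IF j k e t : \int[P]_w (F j k e t w)%:E <= (expR (- (n%:R * u ^+ 2 / (4 * concC))))%:E.
  rewrite (integral_finZl P (mexp _ _) (fun=> expR_ge0 _) (expR_ge0 _)).
  apply: (@le_trans _ _ ((expR (- (l * n%:R * u)))%:E * (expR (n%:R * concC * l ^+ 2))%:E)).
    rewrite lee_wpmul2l ?lee_fin ?expR_ge0//.
    apply: (le_trans (mgf_sum_sqr (pairvec_norm j k e) _)).
      by rewrite normrM normrX normrN1 expr1n mul1r ger0_norm.
    by rewrite lee_fin ler_expR exprMn sqrr_sign mul1r.
  rewrite -EFinM -expRD lee_fin ler_expR le_eqVlt; apply/orP; left; apply/eqP.
  by rewrite /l; field; rewrite gt_eqF.
have mB : measurable (~` [set w | good_design (u * p%:R) (X w)]).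
  by apply: measurableC; exact: measurable_good_design.
rewrite -[X in P X]setIT -integral_indic//.
apply: (@le_trans _ _ (\int[P]_w (\sum_j \sum_k \sum_(e : bool) \sum_(t : bool) F j k e t w)%:E)).
  apply: le_integral_fin => //.
  - by do 4 (apply: measurable_sum => ?).
  move=> w; rewrite indicE; case: (boolP (w \in _)) => [|_]; last first.
    by do 4 (apply: sumr_ge0 => ? _).
  rewrite inE/= => /existsNP[j /existsNP[k /negP]].
  rewrite -ltNge mulfK; last by rewrite (gt_eqF pR).
  move=> hjk.
  suff [e [t h]] : exists e t, (1 <= F j k e t w)%R.
    apply: (le_trans h).
    rewrite (bigD1 j)//= (bigD1 k)//= (bigD1 e)//= (bigD1 t)//= -!addrA lerDl.
    rewrite !addr_ge0//; by do ?[apply: sumr_ge0 => ? _].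
  have one e (b : R) : (n%:R * u < `|sumsq (pairvec j k e) w|)%R ->
      exists e t, (1 <= F j k e t w)%R.
    rewrite lter_normr => /orP[h|h]; exists e.
      exists false; rewrite /F -expRD -[X in (X <= _)%R]expR0 ler_expR expr0.
      have : (l * (n%:R * u) <= l * sumsq (pairvec j k e) w)%R by rewrite ler_wpM2l// ltW.
      lra.
    exists true; rewrite /F -expRD -[X in (X <= _)%R]expR0 ler_expR expr1.
    have : (l * (n%:R * u) <= l * - sumsq (pairvec j k e) w)%R by rewrite ler_wpM2l// ltW.
    lra.
  have : (n%:R * u < `|n%:R * (gram (X w) j k - (j == k)%:R)|)%R.
    by rewrite normrM ger0_norm ?(ltW nR)// ltr_pM2l.
  rewrite gram_sumsq; case: ifP => _; first exact: one.
  (* If half a difference exceeds n u in absolute value, so does one of its two terms. *)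
  have [h _|h] := ltP (n%:R * u)%R `|sumsq (pairvec j k false) w|%R; first exact: (one _ 0%R h).
  have [h' _|h'] := ltP (n%:R * u)%R `|sumsq (pairvec j k true) w|%R; first exact: (one _ 0%R h').
  rewrite normrM (@ger0_norm _ (2^-1)%R) ?invr_ge0// ltr_pdivlMr// => h2.
  have := ler_normB (sumsq (pairvec j k false) w) (sumsq (pairvec j k true) w).
  lra.
have sumE (I : finType) (G : I -> Om -> R) (c : R) : (forall i, measurable_fun setT (G i)) ->
    (forall i w, (0 <= G i w)%R) -> (forall i, \int[P]_w (G i w)%:E <= c%:E) ->
    \int[P]_w (\sum_i G i w)%:E <= (#|I|%:R * c)%:E.
  move=> mG G0 IG; rewrite integral_fin_sum//.
  apply: (@le_trans _ _ (\sum_(i : I) c%:E)); first by apply: lee_sum => i _.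
  by rewrite sumEFin sumr_const mulr_natl.
pose E : R := expR (- (n%:R * u ^+ 2 / (4 * concC))).
apply: (@le_trans _ _ (#|'I_p|%:R * (#|'I_p|%:R * (#|{: bool}|%:R * (#|{: bool}|%:R * E))))%:E).
  apply: (@sumE _ _ _) => [j|j w|j]; first by do 3 (apply: measurable_sum => ?).
    by do 3 (apply: sumr_ge0 => ? _).
  apply: (@sumE _ _ _) => [k|k w|k]; first by do 2 (apply: measurable_sum => ?).
    by do 2 (apply: sumr_ge0 => ? _).
  apply: (@sumE _ _ _) => [e|e w|e]; first by apply: measurable_sum => ?.
    by apply: sumr_ge0 => ? _.
  by apply: (@sumE _ _ _) => // t; exact: IF.
rewrite lee_fin card_ord card_bool le_eqVlt; apply/orP; left; apply/eqP.
by rewrite -/E; ring.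
Qed.

End concentration.

(** * The randomized least-squares test *)

Section measurable_matrix.
Context {d} {Om : measurableType d} {R : realType}.
Implicit Types f : Om -> R.

(** Written as f (f^2)^(-1), which allows real powers of a nonnegative base; where f vanishes, both
    sides are 0. *)
Lemma measurable_inv f : measurable_fun setT f -> measurable_fun setT (fun w => (f w)^-1).
Proof.
move=> mf.
rewrite (_ : (fun w => _) = (fun w => f w * (f w ^+ 2) `^ (-1))).
  apply: measurable_funM => //.
  have mf2 : measurable_fun setT (fun w => f w ^+ 2) by exact: measurable_funX.
  exact: (measurableT_comp (measurable_powR (-1)) mf2).
apply/funext => w; rewrite powR_inv1 ?sqr_ge0//.
have [->|f0] := eqVneq (f w) 0; first by rewrite invr0 mul0r.
by field.
Qed.

Lemma measurable_sg f : measurable_fun setT f -> measurable_fun setT (fun w => Num.sg (f w)).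
Proof.
move=> mf.
rewrite (_ : (fun w => _) = (fun w => f w * `|f w|^-1)).
  apply: measurable_funM => //; apply: measurable_inv.
  exact: measurableT_comp.
apply/funext => w; have [->|f0] := eqVneq (f w) 0; first by rewrite sgr0 mul0r.
by rewrite {2}[f w]numEsg mulfK// normr_eq0.
Qed.

Lemma measurable_sqrtr f : measurable_fun setT f ->
  measurable_fun setT (fun w => Num.sqrt (f w)).
Proof.
move=> mf.
have ms : measurable_fun setT (@Num.sqrt R).
  by apply: continuous_measurable_fun; exact: sqrt_continuous.
exact: (measurableT_comp ms mf).
Qed.

Definition mmx m n (M : Om -> 'M[R]_(m, n)) :=
  forall i j, measurable_fun setT (fun w => M w i j).

Lemma mmx_cst m n (A : 'M[R]_(m, n)) : mmx (fun=> A).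
Proof. by move=> i j; exact: measurable_cst. Qed.

Lemma mmx_mul m n k (M : Om -> 'M[R]_(m, n)) (N : Om -> 'M[R]_(n, k)) :
  mmx M -> mmx N -> mmx (fun w => M w *m N w).
Proof.
move=> mM mN i j; under eq_fun do rewrite mxE.
by apply: measurable_sum => l; exact: measurable_funM.
Qed.

Lemma mmx_tr m n (M : Om -> 'M[R]_(m, n)) : mmx M -> mmx (fun w => (M w)^T).
Proof. by move=> mM i j; under eq_fun do rewrite mxE; exact: mM. Qed.

Lemma mmx_scale m n f (M : Om -> 'M[R]_(m, n)) : measurable_fun setT f ->
  mmx M -> mmx (fun w => f w *: M w).
Proof. by move=> mf mM i j; under eq_fun do rewrite mxE; exact: measurable_funM. Qed.

Lemma mmx_add m n (M N : Om -> 'M[R]_(m, n)) : mmx M -> mmx N -> mmx (fun w => M w + N w).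
Proof. by move=> mM mN i j; under eq_fun do rewrite mxE; exact: measurable_funD. Qed.

Lemma mmx_opp m n (M : Om -> 'M[R]_(m, n)) : mmx M -> mmx (fun w => - M w).
Proof.
move=> mM i j; under eq_fun do rewrite mxE.
exact: (measurableT_comp _ (mM i j)).
Qed.

Lemma mmx_det n (M : Om -> 'M[R]_n) : mmx M -> measurable_fun setT (fun w => \det (M w)).
Proof.
move=> mM; apply: measurable_sum => s; apply: measurable_funM => //.
by apply: measurable_prod => i _; exact: mM.
Qed.

Lemma mmx_adj n (M : Om -> 'M[R]_n) : mmx M -> mmx (fun w => \adj (M w)).
Proof.
move=> mM i j; under eq_fun do rewrite mxE /cofactor.
apply: measurable_funM => //; apply: mmx_det => k l.
by under eq_fun do rewrite !mxE; exact: mM.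
Qed.

Lemma mmx_ddfac n (M : Om -> 'M[R]_n) : mmx M -> mmx (fun w => ddfac (M w)).
Proof.
move=> mM i c; under eq_fun do rewrite mxE.
case: (enum_val c) => j k; case: (j == k).
  apply: measurable_funM => //; apply: measurable_sqrtr; apply: measurable_funB => //.
  rewrite (_ : (fun w => _) = fun w => \sum_l (if l != j then `|M w j l| else 0)); last first.
    by apply/funext => w; rewrite big_mkcond.
  apply: measurable_sum => l; case: (l != j); last exact: measurable_cst.
  exact: (measurableT_comp _ (mM j l)).
apply: measurable_funM.
  apply: measurable_sqrtr; apply: measurable_funM => //.
  exact: (measurableT_comp _ (mM j k)).
by apply: measurable_funD => //; apply: measurable_funM => //; exact: measurable_sg.
Qed.

(** Cramer's formula in place of [invmx], which branches on invertibility: its entries are visibly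
    measurable in S, and both inverses agree on good designs. *)
Definition adjinv n (S : 'M[R]_n) : 'M[R]_n := (\det S)^-1 *: \adj S.

Lemma adjinvE n (S : 'M[R]_n) : S \in unitmx -> adjinv S = invmx S.
Proof. by move=> u; rewrite /adjinv /invmx u. Qed.

Lemma mmx_adjinv n (M : Om -> 'M[R]_n) : mmx M -> mmx (fun w => adjinv (M w)).
Proof.
move=> mM; apply: mmx_scale; last exact: mmx_adj.
by apply: measurable_inv; exact: mmx_det.
Qed.

Lemma measurable_ctup n (M : Om -> 'cV[R]_n) : mmx M -> measurable_fun setT (fun w => ctup (M w)).
Proof.
move=> mM; apply: measurable_tupleP => i; under eq_fun do rewrite tnth_mktuple.
exact: mM.
Qed.

Lemma mmx_tcol n (f : Om -> n.-tuple R) : measurable_fun setT f -> mmx (fun w => tcol (f w)).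
Proof.
move=> mf i j; under eq_fun do rewrite mxE.
exact: (measurableT_comp (measurable_tnth i) mf).
Qed.

Lemma mmx_gram n p (M : Om -> 'M[R]_(n, p)) : mmx M -> mmx (fun w => gram (M w)).
Proof.
by move=> mM; apply: mmx_scale => //; apply: mmx_mul => //; exact: mmx_tr.
Qed.

End measurable_matrix.

Definition mat {R : realType} {n p : nat} (t : n.-tuple (p.-tuple R)) : 'M[R]_(n, p) :=
  \matrix_(i, j) tnth (tnth t i) j.

Lemma matK {R : realType} n p (M : 'M[R]_(n, p)) : mat (mxtup M) = M.
Proof. by apply/matrixP => i j; rewrite mxE mxtupE. Qed.

Lemma mat_mxtup {R : realType} n p (t : n.-tuple (p.-tuple R)) : mxtup (mat t) = t.
Proof.
apply: eq_from_tnth => i; apply: eq_from_tnth => j.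
by rewrite mxtupE mxE.
Qed.

Lemma mmx_mat {d} {Om : measurableType d} {R : realType} n p
    (f : Om -> n.-tuple (p.-tuple R)) :
  measurable_fun setT f -> mmx (fun w => mat (f w)).
Proof.
move=> mf i j; under eq_fun do rewrite mxE.
apply: (measurableT_comp (measurable_tnth j)).
exact: (measurableT_comp (measurable_tnth i)).
Qed.

Section lsq_test.
Context {R : realType} {n p : nat} (dl : R) (T0 : p.-tuple R -> R).
Hypotheses (n0 : (0 < n)%N) (dl0 : 0 <= dl) (dl1 : dl < 1 / 2).
Hypotheses (mT0 : measurable_fun setT T0) (T01 : forall x, 0 <= T0 x <= 1).
Local Open Scope ereal_scope.
Notation gaussn := (iidm (@gauss R)).
Notation N := #|{: 'I_p * 'I_p}|.

Definition lsq_est (X : 'M[R]_(n, p)) (y : n.-tuple R) (u : N.-tuple R) : p.-tuple R :=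
  ctup (((vsd dl)^-1 * (Num.sqrt n%:R)^-1) *: (adjinv (gram X) *m X^T) *m tcol y +
        ((vsd dl)^-1 *: ddfac ((1 + 2 * dl)%:M - adjinv (gram X))) *m tcol u)%R.

(** A test is a function of the data, so the auxiliary noise is integrated out rather than drawn.
    The indicator makes the test accept on bad designs. *)
Definition lsq_test (z : data_space n p) : R :=
  (\1_[set x : n.-tuple (p.-tuple R) | good_design dl (mat x)] z.2 *
   fine (\int[gaussn N]_u (T0 (lsq_est (mat z.2) z.1 u))%:E))%R.

Lemma measurable_lsq_est {d} {Om : measurableType d} (x : Om -> n.-tuple (p.-tuple R))
    (y : Om -> n.-tuple R) (u : Om -> N.-tuple R) :
  measurable_fun setT x -> measurable_fun setT y -> measurable_fun setT u ->
  measurable_fun setT (fun w => lsq_est (mat (x w)) (y w) (u w)).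
Proof.
move=> mx my mu; apply: measurable_ctup.
have mX := mmx_mat mx.
have mH : mmx (fun w => adjinv (gram (mat (x w)))) by apply: mmx_adjinv; exact: mmx_gram.
apply: mmx_add; apply: mmx_mul.
- by apply: mmx_scale => //; apply: mmx_mul => //; exact: mmx_tr.
- exact: mmx_tcol.
- apply: mmx_scale => //; apply: mmx_ddfac; apply: mmx_add; first exact: mmx_cst.
  exact: mmx_opp.
- exact: mmx_tcol.
Qed.

Lemma integral_T0_fin (h : N.-tuple R -> p.-tuple R) : measurable_fun setT h ->
  0 <= \int[gaussn N]_u (T0 (h u))%:E <= 1.
Proof.
move=> mh; apply/andP; split.
  by apply: integral_ge0 => u _; rewrite lee_fin; case/andP: (T01 (h u)).
rewrite -[leRHS](integral_prob_cst (gaussn N)); apply: le_integral_fin.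
- exact: (measurableT_comp mT0 mh).
- exact: measurable_cst.
- by move=> u; case/andP: (T01 (h u)).
- by move=> u; case/andP: (T01 (h u)).
Qed.

Lemma measurable_est1 z : measurable_fun setT (lsq_est (mat z.2) z.1).
Proof.
apply: (@measurable_lsq_est _ _ (fun=> z.2) (fun=> z.1) id) => //; exact: measurable_cst.
Qed.

Lemma is_test_lsq : is_test lsq_test.
Proof.
split; last first.
  move=> z; have /andP[i0 i1] := integral_T0_fin (measurable_est1 z).
  have f0 := fine_ge0 i0.
  have f1 : (fine (\int[gaussn N]_u (T0 (lsq_est (mat z.2) z.1 u))%:E) <= 1)%R.
    rewrite -lee_fin fineK// ge0_fin_numE//; exact: le_lt_trans i1 (ltry _).
  rewrite /lsq_test indicE; case: (_ \in _); last by rewrite mul0r lexx ler01.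
  by rewrite mul1r f0.
apply: measurable_funM.
  apply: (measurableT_comp _ measurable_snd).
  apply: measurable_indic.
  apply: (@measurable_good_design _ (n.-tuple (p.-tuple R)) R n p mat).
  under eq_fun do rewrite mat_mxtup; exact: measurable_id.
apply: measurableT_comp => //.
apply: (@measurable_fun_fubini_tonelli_F _ _ _ _ _ (gaussn N)
  (fun v : data_space n p * N.-tuple R => (T0 (lsq_est (mat v.1.2) v.1.1 v.2))%:E)).
- apply/measurable_EFinP; apply: (measurableT_comp mT0); apply: measurable_lsq_est.
  + exact: (measurableT_comp measurable_snd measurable_fst).
  + exact: (measurableT_comp measurable_fst measurable_fst).
  + exact: measurable_snd.
- by move=> v; rewrite lee_fin; case/andP: (T01 (lsq_est (mat v.1.2) v.1.1 v.2)).
Qed.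

Lemma lsq_test_mean (X : 'M[R]_(n, p)) (b : 'cV[R]_p) : good_design dl X ->
  \int[gaussn n]_e (lsq_test (obs X e b))%:E =
  \int[gaussn p]_x (T0 (tadd x (fun i => (vsd dl)^-1 * Num.sqrt n%:R * b i ord0)%R))%:E.
Proof.
move=> gX.
have u : gram X \in unitmx by apply: (good_unitmx dl0 (ltW dl1) gX).
have mT (th : 'I_p -> R) : measurable_fun setT (fun x => (T0 (tadd x th))%:E).
  by apply/measurable_EFinP; exact: (measurableT_comp mT0 (measurable_tadd th)).
rewrite -(@ge0_integral_gaussn_lin2 R p n N (lsq X dl) (lsq_noise X dl)
   (fun x => (T0 (tadd x (fun i => (vsd dl)^-1 * Num.sqrt n%:R * b i ord0)%R))%:E)); last 3 first.
- exact: lsq_orth.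
- exact: mT.
- by move=> x; rewrite lee_fin; case/andP: (T01 (tadd x (fun i => (vsd dl)^-1 * Num.sqrt n%:R * b i ord0)%R)).
apply: eq_integral => e _; rewrite /lsq_test /=.
rewrite indicE mem_set/= ?matK// mul1r fineK; last first.
  have /andP[i0 i1] := integral_T0_fin (measurable_est1 (obs X e b)).
  by move: i0 i1; rewrite /= matK => i0 i1; rewrite ge0_fin_numE//; exact: le_lt_trans i1 (ltry _).
apply: eq_integral => v _; congr (T0 _)%:E.
rewrite /lsq_est (adjinvE u); apply: eq_from_tnth => i; rewrite !tnth_mktuple.
have -> : tcol [tuple ((X *m b) i0 ord0 + tnth e i0)%R | i0 < n] = (X *m b + tcol e)%R.
  by apply/colP => j; rewrite !mxE tnth_mktuple !mxE.
rewrite mulmxDr -/(lsq X dl) (lsq_mean n0 dl0 dl1 gX) -addrA addrC.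
by rewrite [in LHS]mxE [X in (_ + X)%R]mxE.
Qed.

End lsq_test.

(** * Risk bounds for random designs *)

Lemma XiP {R : realType} p s (A : R) (b : 'cV[R]_p) : Xi s A b <->
  #|[set i | b i ord0 != 0]%SET| = s /\ forall i, b i ord0 != 0 -> A <= `|b i ord0|.
Proof.
rewrite /Xi/= (_ : #|[set i | b i ord0 != 0]%SET| = #|[set i : 'I_p | b i ord0 != 0]|)//.
by apply: eq_card => i; rewrite inE; apply/idP/idP => h; rewrite ?inE// in h *.
Qed.

Section average.
Context {d} {Om : measurableType d} {R : realType} (mu : probability Om R).
Local Open Scope ereal_scope.

Lemma le_integral_average (I : finType) (k : R) (J : I -> Om -> \bar R) (H D : Om -> \bar R) :
  (0 <= k)%R -> (forall i, measurable_fun setT (J i)) -> (forall i w, 0 <= J i w) ->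
  measurable_fun setT H -> (forall w, 0 <= H w) ->
  measurable_fun setT D -> (forall w, 0 <= D w) ->
  (forall w, k%:E * \sum_i J i w <= H w + D w) ->
  k%:E * \sum_i \int[mu]_w J i w <= \int[mu]_w H w + \int[mu]_w D w.
Proof.
move=> k0 mJ J0 mH H0 mD D0 le.
rewrite -(ge0_integralD mu measurableT (fun w _ => H0 w) mH (fun w _ => D0 w) mD).
rewrite -(ge0_integral_sum mu measurableT mJ (fun i w _ => J0 i w)).
have mS : measurable_fun setT (fun w => \sum_i J i w) by exact: emeasurable_sum.
have S0 w : 0 <= \sum_i J i w by exact: sume_ge0.
rewrite -(ge0_integralZl mu measurableT mS (fun w _ => S0 w)) ?lee_fin//.
have mkS : measurable_fun setT (fun w => k%:E * \sum_i J i w) by apply: measurable_funeM.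
have mHD : measurable_fun setT (fun w => H w + D w) by apply: emeasurable_funD.
apply: ge0_le_integral => // w _; by rewrite mule_ge0 ?lee_fin.
Qed.

End average.

Section risk.
Context {R : realType} {n p : nat} {d} {Om : measurableType d} (P : probability Om R).
Variables (X : Om -> 'M[R]_(n, p)) (eps : Om -> n.-tuple R) (dl : R).
Hypotheses (n0 : (0 < n)%N) (dl0 : 0 <= dl) (dl1 : dl < 1 / 2).
Hypotheses (gn : gauss_noise P eps)
  (ind : indep2 P (sigma_of eps) (sigma_of (fun w => mxtup (X w))))
  (mX : measurable_fun setT (fun w => mxtup (X w))).
Local Open Scope ereal_scope.
Notation gaussn := (iidm (@gauss R)).
Implicit Types T F : @data_space R n p -> R.
Implicit Types b : 'cV[R]_p.

Lemma measurable_obs {d'} {Om' : measurableType d'} (x : Om' -> n.-tuple (p.-tuple R))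
    (e : Om' -> n.-tuple R) b : measurable_fun setT x -> measurable_fun setT e ->
  measurable_fun setT (fun w => obs (mat (x w)) (e w) b).
Proof.
move=> mx me; apply: measurable_fun_pair; last by under eq_fun do rewrite mat_mxtup.
rewrite (_ : (fun w => _) = fun w => ctup (mat (x w) *m b + tcol (e w))%R).
  apply: measurable_ctup; apply: mmx_add; last exact: mmx_tcol.
  by apply: mmx_mul; [exact: mmx_mat|exact: mmx_cst].
by apply/funext => w; apply: eq_from_tnth => i; rewrite !tnth_mktuple !mxE.
Qed.

Lemma measurable_obs_mx (M : 'M[R]_(n, p)) b : measurable_fun setT (fun e => obs M e b).
Proof. by rewrite -(matK M); apply: measurable_obs => //; exact: measurable_cst. Qed.

Let meps : measurable_fun setT eps. Proof. by case: gn. Qed.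

Lemma measurable_obs_design b : measurable_fun setT (fun w => obs (X w) (eps w) b).
Proof. by under eq_fun do rewrite -(matK (X _)); exact: measurable_obs. Qed.

Definition cmean F b w : \bar R := \int[gaussn n]_e (F (obs (X w) e b))%:E.

Lemma Etest_cmean F b : measurable_fun setT F -> (forall z, 0 <= F z)%R ->
  Etest P X eps F b = \int[P]_w cmean F b w.
Proof.
move=> mF F0; rewrite /Etest /cmean.
pose f (v : n.-tuple R * n.-tuple (p.-tuple R)) : \bar R := (F (obs (mat v.2) v.1 b))%:E.
have law A : measurable A -> P (eps @^-1` A) = gaussn n A.
  have [me mg indep] := gn; exact: (law_iidm me).
have mf : measurable_fun setT f.
  apply/measurable_EFinP; apply: (measurableT_comp mF).
  exact: (measurable_obs _ measurable_snd measurable_fst).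
have f0 z : 0 <= f z by rewrite lee_fin.
have h := ge0_integral_indep2 meps mX law ind mf f0.
rewrite (_ : (fun w => (F (obs (X w) (eps w) b))%:E) = fun w => f (eps w, mxtup (X w))); last first.
  by apply/funext => w; rewrite /f /= matK.
rewrite h; apply: eq_integral => w _; apply: eq_integral => e _.
by rewrite /f /= matK.
Qed.

Lemma measurable_cmean F b : measurable_fun setT F -> (forall z, 0 <= F z)%R ->
  measurable_fun setT (cmean F b).
Proof.
move=> mF F0; rewrite (_ : cmean F b = (fun x => \int[gaussn n]_e (F (obs (mat x) e b))%:E) \o
  (fun w => mxtup (X w))); last first.
  by apply/funext => w; rewrite /cmean /= matK.
apply: measurableT_comp => //.
apply: (@measurable_fun_fubini_tonelli_F _ _ _ _ _ (gaussn n)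
  (fun v : n.-tuple (p.-tuple R) * n.-tuple R => (F (obs (mat v.1) v.2 b))%:E)).
- apply/measurable_EFinP; apply: (measurableT_comp mF).
  exact: (measurable_obs _ measurable_fst measurable_snd).
- by move=> v; rewrite lee_fin.
Qed.

Lemma cmean01 T b w : is_test T -> 0 <= cmean T b w <= 1.
Proof.
move=> [mT T01]; apply/andP; split.
  by apply: integral_ge0 => e _; rewrite lee_fin; case/andP: (T01 (obs (X w) e b)).
rewrite -[leRHS](integral_prob_cst (gaussn n)); apply: le_integral_fin.
- exact: (measurableT_comp mT (measurable_obs_mx (X w) b)).
- exact: measurable_cst.
- by move=> e; case/andP: (T01 (obs (X w) e b)).
- by move=> e; case/andP: (T01 (obs (X w) e b)).
Qed.

Lemma EtestC T b : is_test T ->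
  Etest P X eps T b + Etest P X eps (fun z => 1 - T z)%R b = 1.
Proof.
move=> [mT T01].
have mTo : measurable_fun setT (fun w => T (obs (X w) (eps w) b)).
  exact: (measurableT_comp mT (measurable_obs_design b)).
rewrite -[RHS](integral_prob_cst P) /Etest.
rewrite -integral_finD//.
- by apply: eq_integral => w _; congr EFin; ring.
- exact: measurable_funB.
- by move=> w; case/andP: (T01 (obs (X w) (eps w) b)).
- by move=> w; case/andP: (T01 (obs (X w) (eps w) b)) => _; rewrite subr_ge0.
Qed.

Lemma Etest01 T b : is_test T -> 0 <= Etest P X eps T b <= 1.
Proof.
move=> tT; have [mT T01] := tT.
rewrite Etest_cmean//; last by move=> z; case/andP: (T01 z).
have c01 w := cmean01 b w tT.
apply/andP; split; first by apply: integral_ge0 => w _; case/andP: (c01 w).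
rewrite -[leRHS](integral_prob_cst P); apply: ge0_le_integral => //.
- by move=> w _; case/andP: (c01 w).
- by apply: measurable_cmean => // z; case/andP: (T01 z).
- by move=> w _; case/andP: (c01 w).
Qed.

Lemma Etest_fin T b : is_test T -> exists2 e : R, Etest P X eps T b = e%:E & (0 <= e <= 1)%R.
Proof.
move=> tT; have /andP[h0 h1] := Etest01 b tT.
have e : Etest P X eps T b = (fine (Etest P X eps T b))%:E.
  by rewrite fineK// ge0_fin_numE//; exact: le_lt_trans h1 (ltry _).
by exists (fine (Etest P X eps T b)) => //; rewrite -2!lee_fin -e h0.
Qed.

Lemma EtestC_fin T b (e : R) : is_test T -> Etest P X eps T b = e%:E ->
  Etest P X eps (fun z => 1 - T z)%R b = (1 - e)%:E.
Proof.
move=> tT ee; have := EtestC b tT; rewrite ee.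
case: (Etest _ _ _ (fun z => _) b) => //= y; rewrite -EFinD => -[] <-.
by congr EFin; ring.
Qed.

Notation G := [set w | good_design dl (X w)].
Let mG : measurable G. Proof. exact: measurable_good_design. Qed.

(** The conditional mean given the design is constant on good designs and 0 off them. Every mean of
    the test is thus [m b] times P(G), and the gain g is merely multiplied by P(G) >= 1/2. *)
Lemma minimax_risk_le s (A g : R) (T0 : p.-tuple R -> R) :
  measurable_fun setT T0 -> (forall x, 0 <= T0 x <= 1)%R -> (0 <= g)%R ->
  P (~` G) <= (1 / 2)%:E ->
  (forall b, Xi s A b -> \int[gaussn p]_x (T0 x)%:E + g%:E <=
    \int[gaussn p]_x (T0 (tadd x (fun i => (vsd dl)^-1 * Num.sqrt n%:R * b i ord0)%R))%:E) ->
  minimax_risk P X eps s A <= (1 - g / 2)%:E.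
Proof.
move=> mT0 T001 g0 badP gain.
have tT : @is_test R n p (lsq_test dl T0) by exact: is_test_lsq.
pose m b := \int[gaussn p]_x (T0 (tadd x (fun i => (vsd dl)^-1 * Num.sqrt n%:R * b i ord0)%R))%:E.
have m0E : m 0%R = \int[gaussn p]_x (T0 x)%:E.
  apply: eq_integral => x _; congr (T0 _)%:E; apply: eq_from_tnth => i.
  by rewrite tnth_mktuple mxE mulr0 addr0.
have mm b : 0 <= m b <= 1.
  apply/andP; split; first by apply: integral_ge0 => x _; rewrite lee_fin; case/andP: (T001 (tadd x (fun i => (vsd dl)^-1 * Num.sqrt n%:R * b i ord0)%R)).
  rewrite -[leRHS](integral_prob_cst (gaussn p)); apply: le_integral_fin.
  - exact: (measurableT_comp mT0 (measurable_tadd _)).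
  - exact: measurable_cst.
  - by move=> x; case/andP: (T001 (tadd x (fun i => (vsd dl)^-1 * Num.sqrt n%:R * b i ord0)%R)).
  - by move=> x; case/andP: (T001 (tadd x (fun i => (vsd dl)^-1 * Num.sqrt n%:R * b i ord0)%R)).
have mf b : m b = (fine (m b))%:E.
  by have /andP[h0 h1] := mm b; rewrite fineK// ge0_fin_numE//; exact: le_lt_trans h1 (ltry _).
have m01 b : (0 <= fine (m b) <= 1)%R by have := mm b; rewrite mf !lee_fin.
set q := fine (P G).
have PG : P G = q%:E by rewrite fineK// fin_num_measure.
have q12 : (1 / 2 <= q)%R.
  move: badP; rewrite probability_setC// PG -EFinB lee_fin; lra.
have q1 : (q <= 1)%R by rewrite -lee_fin -PG probability_le1.
have EE b : Etest P X eps (lsq_test dl T0) b = (fine (m b) * q)%:E.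
  have [mT T01] := tT; have T0' (z : @data_space R n p) : (0 <= lsq_test dl T0 z)%R by case/andP: (T01 z).
  rewrite (Etest_cmean b mT T0').
  rewrite (_ : cmean (lsq_test dl T0) b = fun w => (fine (m b) * \1_G w)%:E).
    rewrite integral_finZl//; last by case/andP: (m01 b).
    by rewrite integral_indic// setIT EFinM; congr (_ * _).
  apply/funext => w; rewrite /cmean indicE; case: (boolP (w \in G)) => wG.
    rewrite inE/= in wG.
    by rewrite (lsq_test_mean n0 dl0 dl1 mT0 T001 b wG) mulr1 -mf.
  rewrite mulr0; apply: integral0_eq => e _; rewrite /lsq_test indicE /= memNset ?mul0r//=.
  by move: wG; rewrite notin_setE /= matK.
apply: (@le_trans _ _ (risk_test P X eps s A (lsq_test dl T0))).
  by apply: ereal_inf_lbound; exists (lsq_test dl T0).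
rewrite /risk_test EE.
apply: (@le_trans _ _ ((fine (m 0) * q)%:E + (1 - (fine (m 0) + g) * q)%:E)); last first.
  by rewrite -EFinD lee_fin; nra.
apply: leeD2l; apply: ge_ereal_sup => _ [b bX <-].
rewrite (EtestC_fin tT (EE b)) lee_fin.
have : (fine (m 0) + g <= fine (m b))%R.
  by rewrite -lee_fin EFinD -mf m0E -mf; exact: gain.
by move=> h; nra.
Qed.

End risk.

Section risk_lower.
Context {R : realType} {n p : nat} {d} {Om : measurableType d} (P : probability Om R).
Variables (X : Om -> 'M[R]_(n, p)) (eps : Om -> n.-tuple R) (dl : R).
Hypotheses (n0 : (0 < n)%N) (dl0 : 0 <= dl) (dl1 : dl < 1 / 2).
Hypotheses (gn : gauss_noise P eps)
  (ind : indep2 P (sigma_of eps) (sigma_of (fun w => mxtup (X w))))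
  (mX : measurable_fun setT (fun w => mxtup (X w))).
Variables (s b : nat) (pos : 'I_s -> 'I_b -> 'I_p) (A t l a B : R).
Hypothesis pos_inj : forall i k i' k', pos i k = pos i' k' -> i = i' /\ k = k'.
Let theta := A / tausd (n := n) dl.
Let V := expR (- theta ^+ 2 + l * t + (2 * theta - l) ^+ 2 / 2).
Let q := s%:R * expR (- (t - theta) ^+ 2 / 2) + a.
Hypotheses (b0 : (0 < b)%N) (A0 : 0 < A) (l0 : 0 <= l) (tt : theta <= t) (a0 : 0 < a)
  (sV1 : s%:R * (V / b%:R) <= 1 / 2) (sV2 : 2 * (s%:R * (V / b%:R)) <= a ^+ 2).
Notation gaussn := (iidm (@gauss R)).
Notation G := [set w | good_design dl (X w)].
Hypothesis badP : (P (~` G) <= B%:E)%E.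
Implicit Types (f : {ffun 'I_s -> 'I_b}) (T : @data_space R n p -> R).
Local Open Scope ereal_scope.

Definition spikev f : 'cV[R]_p := (\col_j spike pos A f j)%R.

Lemma spikev_Xi f : Xi s A (spikev f).
Proof.
have E i : (spikev f i ord0 != 0%R) = hit pos f i.
  by rewrite mxE /spike; case: ifP => _; rewrite ?eqxx// gt_eqF.
apply/XiP; split; last first.
  by move=> i; rewrite E mxE /spike => ->; rewrite ger0_norm// ltW.
rewrite (_ : [set i | _]%SET = [set pos i (f i) | i in [set: 'I_s]]%SET).
  by rewrite card_imset ?cardsT ?card_ord// => i i' /pos_inj[].
apply/setP => j; rewrite inE E; apply/existsP/imsetP => [[i /eqP ->]|[i _ ->]].
  by exists i.
by exists i.
Qed.

Let q0 : (0 <= q)%R. Proof. by rewrite addr_ge0 ?mulr_ge0 ?expR_ge0// ltW. Qed.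

(** Data for a fixed good design are simulated from a sequence-model observation x with spikes A /
    [tausd] and auxiliary noise y. For each y the test is a test in x, to which [block_prior_bound]
    applies; then y is averaged out. *)
Lemma cmean_prior_bound T w : is_test T -> w \in G ->
  ((b ^ s)%:R^-1)%:E * \sum_f cmean X T (spikev f) w <= cmean X T 0%R w + q%:E.
Proof.
move=> tT; rewrite inE/= => gw; have [mT T01] := tT.
pose N := #|{: 'I_p * 'I_p}|.
pose Y (x : p.-tuple R) (y : (n + N).-tuple R) : n.-tuple R :=
  ctup (simX (X w) dl *m tcol x + sim_noise (X w) dl *m tcol y)%R.
pose F x y : R := T (obs (X w) (Y x y) 0%R).
have mY : measurable_fun setT (fun v : (n + N).-tuple R * p.-tuple R => Y v.2 v.1).
  apply: measurable_ctup; apply: mmx_add; apply: mmx_mul; try exact: mmx_cst.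
  - exact: mmx_tcol.
  - exact: mmx_tcol.
have mF th : measurable_fun setT
    (fun v : (n + N).-tuple R * p.-tuple R => F (tadd v.2 th) v.1).
  apply: (measurableT_comp mT); apply: (measurableT_comp (measurable_obs_mx _ _)).
  apply: (measurableT_comp mY (g := fun v : (n + N).-tuple R * p.-tuple R => (v.1, tadd v.2 th))).
  by apply: measurable_fun_pair => //; exact: (measurableT_comp (measurable_tadd th) measurable_snd).
have F0 x y : (0 <= F x y)%R by case/andP: (T01 (obs (X w) (Y x y) 0%R)).
have swap (c : 'cV[R]_p) (th : 'I_p -> R) : (forall j, c j ord0 = tausd (n := n) dl * th j)%R ->
    cmean X T c w = \int[gaussn (n + N)]_y \int[gaussn p]_x (F (tadd x th) y)%:E.
  move=> cth; rewrite /cmean.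
  have mTo : measurable_fun setT (fun e => (T (obs (X w) e c))%:E).
    by apply/measurable_EFinP; exact: (measurableT_comp mT (measurable_obs_mx _ _)).
  rewrite -(ge0_integral_gaussn_lin2 (sim_orth n0 dl0 dl1 gw) mTo); last first.
    by move=> e; rewrite lee_fin; case/andP: (T01 (obs (X w) e c)).
  have FE x y : T (obs (X w) (Y x y) c) = F (tadd x th) y.
    rewrite /F /obs; congr (T (_, _)); apply: eq_from_tnth => i.
    rewrite !tnth_mktuple mulmx0 [in RHS]mxE add0r.
    rewrite (_ : tcol (tadd x th) = tcol x + \col_j th j)%R; last first.
      by apply/colP => j; rewrite !mxE tnth_mktuple.
    rewrite mulmxDr [in RHS]addrAC [in RHS]mxE [X in X = _]addrC; congr (_ + _)%R.
    rewrite /simX -scalemxAl scalemxAr; congr ((_ *m _) i ord0)%R.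
    by apply/colP => j; rewrite cth !mxE.
  pose g (v : (n + N).-tuple R * p.-tuple R) : \bar R := (F (tadd v.2 th) v.1)%:E.
  have mg : measurable_fun setT g by apply/measurable_EFinP; exact: mF.
  have g0 v : 0 <= g v by rewrite lee_fin.
  transitivity (\int[gaussn p]_x \int[gaussn (n + N)]_y g (y, x)).
    by apply: eq_integral => x _; apply: eq_integral => y _; rewrite FE.
  by rewrite -(@fubini_tonelli _ _ _ _ R (gaussn (n + N)) (gaussn p) g mg g0).
have mint th : measurable_fun setT
    (fun y : (n + N).-tuple R => \int[gaussn p]_x (F (tadd x th) y)%:E).
  apply: (@measurable_fun_fubini_tonelli_F _ _ _ _ R (gaussn p)
    (fun v : (n + N).-tuple R * p.-tuple R => (F (tadd v.2 th) v.1)%:E)).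
  - by apply/measurable_EFinP; exact: mF.
  - by move=> v; rewrite lee_fin.
have int0 th (y : (n + N).-tuple R) : 0 <= \int[gaussn p]_x (F (tadd x th) y)%:E.
  by apply: integral_ge0 => x _; rewrite lee_fin.
have swap1 f : cmean X T (spikev f) w =
    \int[gaussn (n + N)]_y \int[gaussn p]_x (F (tadd x (spike pos theta f)) y)%:E.
  apply: swap => j; rewrite mxE /spike; case: ifP => _; last by rewrite mulr0.
  by rewrite /theta mulrC divfK// gt_eqF// tausd_gt0.
have swap2 : cmean X T 0%R w =
    \int[gaussn (n + N)]_y \int[gaussn p]_x (F (tadd x (fun=> 0%R)) y)%:E.
  by apply: swap => j; rewrite mxE mulr0.
rewrite swap2; under eq_bigr do rewrite swap1.
rewrite -[q%:E](integral_prob_cst (gaussn (n + N))).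
apply: le_integral_average => //.
move=> y.
have -> : \int[gaussn p]_x (F (tadd x (fun=> 0%R)) y)%:E = \int[gaussn p]_x (F x y)%:E.
  apply: eq_integral => x _; congr (F _ _)%:E; apply: eq_from_tnth => i.
  by rewrite tnth_mktuple addr0.
apply: (block_prior_bound (T := fun x => F x y) pos_inj b0 l0 tt a0 sV1 sV2).
- apply: (measurableT_comp mT); apply: (measurableT_comp (measurable_obs_mx _ _)).
  exact: (measurableT_comp mY (pair1_measurable y)).
- by move=> x; exact: (T01 (obs (X w) (Y x y) 0%R)).
Qed.

Let mG : measurable G. Proof. exact: measurable_good_design. Qed.
Let card_ff : #|{ffun 'I_s -> 'I_b}| = (b ^ s)%N. Proof. by rewrite card_ffun !card_ord. Qed.
Let K0 : (0 < (b ^ s)%:R :> R)%R. Proof. by rewrite ltr0n expn_gt0 b0. Qed.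

Lemma average_cst (x : R) : (((b ^ s)%:R^-1)%:E * \sum_(f : {ffun 'I_s -> 'I_b}) x%:E = x%:E).
Proof.
rewrite sumEFin sumr_const card_ff -EFinM -(mulr_natr x) mulrCA mulVf ?mulr1//.
by rewrite gt_eqF.
Qed.

(** On bad designs the average power is bounded by 1, at a cost of B in the mean. *)
Lemma Etest_prior_bound T : is_test T ->
  ((b ^ s)%:R^-1)%:E * \sum_f Etest P X eps T (spikev f) <=
  Etest P X eps T 0%R + (q + B)%:E.
Proof.
move=> tT; have [mT T01] := tT.
have T0 (z : @data_space R n p) : (0 <= T z)%R by case/andP: (T01 z).
have EE c : Etest P X eps T c = \int[P]_w cmean X T c w by exact: Etest_cmean.
have mc c : measurable_fun setT (cmean X T c) by exact: measurable_cmean.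
have c0 c w : 0 <= cmean X T c w by case/andP: (cmean01 X c w tT).
have c1 c w : cmean X T c w <= 1 by case/andP: (cmean01 X c w tT).
rewrite EE; under eq_bigr do rewrite EE.
have mD : measurable_fun setT (fun w => (q + \1_(~` G) w)%R).
  by apply: measurable_funD => //; apply: measurable_indic; exact: measurableC.
apply: (@le_trans _ _ (\int[P]_w cmean X T 0%R w + \int[P]_w (q + \1_(~` G) w)%:E)).
  apply: le_integral_average => //.
  - exact/measurable_EFinP.
  - by move=> w; rewrite lee_fin addr_ge0// indicE ler0n.
  move=> w; case: (boolP (w \in G)) => wG.
    apply: le_trans (cmean_prior_bound tT wG) _; apply: leeD2l.
    by rewrite lee_fin lerDl indicE ler0n.
  rewrite indicE in_setC wG/=.
  apply: (@le_trans _ _ 1).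
    rewrite -(average_cst 1); apply: lee_wpmul2l.
    - by rewrite lee_fin invr_ge0 ltW.
    - by apply: lee_sum => f _; exact: c1.
  rewrite -[leLHS]add0e; apply: leeD => //; by rewrite lee_fin lerDr.
apply: leeD2l.
rewrite integral_finD//.
- by rewrite (integral_prob_cst P) integral_indic ?setIT ?EFinD//; [exact: leeD2l|exact: measurableC].
- by apply: measurable_indic; exact: measurableC.
Qed.

(** The supremum over [Xi] dominates the average over the prior, all of whose draws lie in [Xi]. *)
Lemma minimax_risk_ge : (1 - (q + B))%:E <= minimax_risk P X eps s A.
Proof.
apply: le_ereal_inf_tmp => _ [T tT <-].
rewrite /risk_test; set S := ereal_sup _.
have hb := Etest_prior_bound tT.
have [e0 E0 /andP[e00 e01]] := Etest_fin gn ind mX 0%R tT.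
have S0 f : (1 - fine (Etest P X eps T (spikev f)))%:E <= S.
  have [e E _] := Etest_fin gn ind mX (spikev f) tT.
  apply: ereal_sup_ubound; exists (spikev f); first exact: spikev_Xi.
  by rewrite (EtestC_fin gn mX tT E) E.
rewrite E0.
have [f0 _] : exists f0 : {ffun 'I_s -> 'I_b}, true.
  by exists [ffun=> Ordinal b0].
have {}hb : (1 - (q + B) - e0)%:E <= S.
  case SE : S => [x| |]; last 2 first.
  - by rewrite leey.
  - by have := S0 f0; rewrite SE.
  rewrite lee_fin.
  have : ((1 - x)%R)%:E <= (e0 + (q + B))%:E.
    rewrite (EFinD e0) -E0; apply: le_trans hb.
    rewrite -average_cst; apply: lee_wpmul2l.
    - by rewrite lee_fin invr_ge0 ltW.
    apply: lee_sum => f _.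
    have [e E _] := Etest_fin gn ind mX (spikev f) tT.
    by have := S0 f; rewrite SE E !lee_fin /=; lra.
  by rewrite lee_fin; lra.
rewrite (_ : (1 - (q + B))%:E = e0%:E + (1 - (q + B) - e0)%:E); first exact: leeD2l.
by rewrite -EFinD; congr EFin; ring.
Qed.

End risk_lower.

(** * Exponents *)

Section deterministic.
Context {R : realType} {n p : nat} {d} {Om : measurableType d} (P : probability Om R).
Variables (X : Om -> 'M[R]_(n, p)) (eps : Om -> n.-tuple R) (dl : R).
Hypotheses (n0 : (0 < n)%N) (dl0 : 0 <= dl) (dl1 : dl < 1 / 2).
Hypotheses (gn : gauss_noise P eps)
  (ind : indep2 P (sigma_of eps) (sigma_of (fun w => mxtup (X w))))
  (mX : measurable_fun setT (fun w => mxtup (X w))).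
Variables (s : nat) (alpha r : R).
Hypotheses (p1 : (1 < p)%N) (s0 : (0 < s)%N) (sp : (s <= p)%N).
Notation L := (ln p%:R : R).
Hypothesis s_ub : s%:R <= 2 * expR ((1 - alpha) * L).
Hypothesis r0 : 0 < r.

Let p0 : (0 < p%:R :> R). Proof. by rewrite ltr0n (ltn_trans _ p1). Qed.
Let L0 : 0 < L. Proof. by rewrite ln_gt0// ltr1n. Qed.
Let pE : p%:R = expR L. Proof. by rewrite lnK// posrE. Qed.
Let n0R : (0 < n%:R :> R). Proof. by rewrite ltr0n. Qed.
Let w := Num.sqrt (2 * L).
Let w2 : w ^+ 2 = 2 * L. Proof. by rewrite sqr_sqrtr// mulr_ge0// ltW. Qed.
Let w0 : 0 < w. Proof. by rewrite sqrtr_gt0 mulr_gt0. Qed.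
Let A := Num.sqrt (2 * r * L / n%:R).
Let A0 : 0 < A. Proof. by rewrite sqrtr_gt0 divr_gt0// !mulr_gt0. Qed.
Let A2 : A ^+ 2 = 2 * r * L / n%:R.
Proof. by rewrite sqr_sqrtr// ltW// divr_gt0// !mulr_gt0. Qed.

Let eq_sqr (x y : R) : 0 <= x -> 0 <= y -> x ^+ 2 = y ^+ 2 -> x = y.
Proof. by move=> x0 y0 /eqP; rewrite eqrXn2// => /eqP. Qed.

Lemma block_pos_lt b (i : 'I_s) (k : 'I_b) : (s * b <= p)%N -> (i * b + k < p)%N.
Proof.
move=> sbp; apply: leq_trans sbp; apply: (@leq_trans (i.+1 * b)).
  by rewrite mulSn addnC ltn_add2r.
by rewrite leq_mul2r ltn_ord orbT.
Qed.

(** v is the exponent of the second moment of one spike's likelihood ratio: 2 x untruncated, 4 sqrt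
    x - 2 x - 1 when cut at sqrt(2 L). Two draws share about s^2 / p positions, so the variance has
    exponent 1 - 2 alpha + v, and its square root bounds the gain. *)
Lemma risk_ge_expR (v B : R) : let x := r / (1 - 2 * dl) in x <= 1 ->
  v = 2 * x \/ (1 / 4 <= x /\ v = 4 * Num.sqrt x - 2 * x - 1) ->
  16 * expR ((1 - 2 * alpha + v) * L) <= 1 ->
  (P (~` [set w | good_design dl (X w)]) <= B%:E)%E ->
  ((1 - (6 * expR ((1 - 2 * alpha + v) / 2 * L) + B))%:E <= minimax_risk P X eps s A)%E.
Proof.
move=> x x1 hv V1 badP.
have dl2 : 0 < 1 - 2 * dl by have := dl1; lra.
have x0 : 0 < x by rewrite divr_gt0.
set y := Num.sqrt x; have y0 : 0 < y by rewrite sqrtr_gt0.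
have y2 : y ^+ 2 = x by rewrite sqr_sqrtr// ltW.
have y1 : y <= 1 by rewrite -[1]sqrtr1 ler_wsqrtr.
have th : A / tausd (n := n) dl = y * w.
  apply: eq_sqr; first by rewrite divr_ge0 ?ltW// tausd_gt0.
    by rewrite mulr_ge0 ?sqrtr_ge0.
  rewrite expr_div_n exprMn A2 y2 w2 sqr_sqrtr /x; last by rewrite divr_ge0// ltW.
  by field; rewrite !gt_eqF.
pose b := (p %/ s)%N.
have b0 : (0 < b)%N by rewrite divn_gt0.
have sb : (s * b <= p)%N by rewrite mulnC leq_divM.
have sR : 0 < s%:R :> R by rewrite ltr0n.
have bR : 0 < b%:R :> R by rewrite ltr0n.
(* Rounding p / s down loses at most a factor 2. *)
have bE : p%:R <= 2 * s%:R * b%:R :> R.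
  rewrite -!natrM ler_nat; apply: leq_trans (ltnW (ltn_ceil p s0)) _.
  by rewrite -/b -mulnA (mulnC s b) mulnA leq_mul2r mul2n -addnn -addn1 leq_add2l b0 orbT.
pose pos (i : 'I_s) (k : 'I_b) : 'I_p := Ordinal (block_pos_lt i k sb).
have pos_inj i k i' k' : pos i k = pos i' k' -> i = i' /\ k = k'.
  move=> [] e; split; apply: val_inj => /=.
    by have := congr1 (divn^~ b) e; rewrite !divnMDl// !divn_small// !addn0.
  by have := congr1 (modn^~ b) e; rewrite !modnMDl !modn_small.
(* 0 without truncation, otherwise the optimal 2 theta - t for theta = y w and t = w, nonnegative
   because x >= 1/4. *)
pose l := if v == 2 * x then 0 else (2 * y - 1) * w.
have [l0 vE] : 0 <= l /\ - (y * w) ^+ 2 + l * w + (2 * (y * w) - l) ^+ 2 / 2 = v * L.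
  rewrite /l; case: eqP => [->|v2].
    split => //.
    have -> : - (y * w) ^+ 2 + 0 * w + (2 * (y * w) - 0) ^+ 2 / 2 = y ^+ 2 * w ^+ 2 by field.
    by rewrite y2 w2; ring.
  case: hv => [//|[x4 ->]]; split.
    rewrite mulr_ge0 ?sqrtr_ge0//; suff h : 1 / 2 <= y by lra.
    by rewrite leNgt; apply/negP => h; move: x4; rewrite -y2; nra.
  have -> : - (y * w) ^+ 2 + (2 * y - 1) * w * w + (2 * (y * w) - (2 * y - 1) * w) ^+ 2 / 2 =
      (2 * y - y ^+ 2 - 1 / 2) * w ^+ 2 by field.
  by rewrite y2 w2 -/y; field.
(* The square root of twice the bound [sV] shown next. *)
set a := 4 * expR ((1 - 2 * alpha + v) / 2 * L).
have a0 : 0 < a by rewrite mulr_gt0// expR_gt0.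
have a2 : a ^+ 2 = 16 * expR ((1 - 2 * alpha + v) * L).
  by rewrite /a exprMn -expRM_natl; congr (_ * expR _); [ring|field].
have sV : s%:R * (expR (v * L) / b%:R) <= 8 * expR ((1 - 2 * alpha + v) * L).
  have e2 : expR ((1 - 2 * alpha + v) * L) * p%:R =
      expR ((1 - alpha) * L) ^+ 2 * expR (v * L).
    by rewrite [X in _ * X = _]pE -expRM_natl -!expRD; congr expR; ring.
  rewrite mulrA ler_pdivrMr//.
  have := expR_gt0 (v * L); have := expR_gt0 ((1 - alpha) * L).
  have := expR_gt0 ((1 - 2 * alpha + v) * L).
  set E := expR _ in e2 *; set S := expR ((1 - alpha) * L) in e2 *; set W := expR _ in e2 *.
  move=> E0 S0 W0.
  rewrite -(ler_pM2l sR).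
  have h1 : s%:R * (s%:R * W) <= 4 * S ^+ 2 * W.
    rewrite mulrA ler_wpM2r ?(ltW W0)//.
    by have := ler_pM (ltW sR) (ltW sR) s_ub s_ub; rewrite -/S; lra.
  apply: le_trans h1 _.
  have : E * p%:R <= E * (2 * s%:R * b%:R) by rewrite ler_wpM2l// ltW.
  by rewrite e2; lra.
(* The mass cut off is of no larger order than a: the exponents differ by (2 y - 1)^2 / 2 in the
   first case and coincide in the second. *)
have f1 : 1 - alpha - (1 - y) ^+ 2 <= (1 - 2 * alpha + v) / 2.
  case: hv => [->|[_ ->]]; last by rewrite -/y -y2; lra.
  rewrite -y2.
  by have := sqr_ge0 (2 * y - 1); nra.
apply: le_trans (minimax_risk_ge n0 dl0 dl1 gn ind mX pos_inj b0 A0 l0 (t := w) _ a0 _ _ badP).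
- rewrite lee_fin lerD2l lerN2 lerD2r th /a.
  have -> : - (w - y * w) ^+ 2 / 2 = - (1 - y) ^+ 2 * L.
    have -> : (w - y * w) ^+ 2 = (1 - y) ^+ 2 * w ^+ 2 by ring.
    by rewrite w2; field.
  apply: (@le_trans _ _ (2 * expR ((1 - alpha) * L) * expR (- (1 - y) ^+ 2 * L) +
      4 * expR ((1 - 2 * alpha + v) / 2 * L))).
    by rewrite lerD2r ler_wpM2r// expR_ge0.
  rewrite -mulrA -expRD -mulrDl.
  have : expR ((1 - alpha - (1 - y) ^+ 2) * L) <= expR ((1 - 2 * alpha + v) / 2 * L).
    by rewrite ler_expR ler_wpM2r// ltW.
  by lra.
- by rewrite th ler_piMl// ltW.
- by rewrite th vE; apply: le_trans sV _; lra.
- by rewrite th vE a2; move: sV; lra.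
Qed.

Hypothesis s_lb : expR ((1 - alpha) * L) <= 2 * s%:R.

(** At threshold sqrt(2 kap L) a spike exceeds with probability at least p^(- xi), by the first
    exponential condition. The next two make this dominate the null probability and keep the shift
    of the mean count below p^((1 - kap) / 2), the order of its standard deviation. *)
Lemma risk_le_expR (kap xi : R) : let x := r / (1 + 2 * dl) in r <= kap -> kap <= 1 -> 0 <= xi ->
  expR (- xi * L) <= normal_peak 1 *
    expR (- ((Num.sqrt kap - Num.sqrt x) * Num.sqrt (2 * L) + 1) ^+ 2 / 2) ->
  4 * expR (- kap * L) <= expR (- xi * L) ->
  2 * expR ((1 - alpha - xi) * L) <= expR ((1 - kap) / 2 * L) ->
  (P (~` [set w | good_design dl (X w)]) <= (1 / 2)%:E)%E ->
  (minimax_risk P X eps s A <=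
    (1 - expR ((1 - alpha - xi - (1 - kap) / 2) * L) / 256)%:E)%E.
Proof.
move=> x rk k1 xi0 hpk hk hU badP.
have dl2 : 0 < 1 + 2 * dl by have := dl0; lra.
have x0 : 0 < x by rewrite divr_gt0.
have xk : x <= kap.
  by apply: le_trans rk; rewrite ler_pdivrMr//; have := mulr_ge0 (ltW r0) dl0; lra.
set a := Num.sqrt x * w; set t := Num.sqrt kap * w.
have k0 : 0 <= kap by apply: le_trans xk; exact: ltW.
have a0 : 0 < a by rewrite mulr_gt0// sqrtr_gt0.
have at_ : a <= t by rewrite ler_wpM2r ?(ltW w0)// ler_wsqrtr.
have t0 : 0 <= t by apply: le_trans at_; exact: ltW.
have t2 : t ^+ 2 / 2 = kap * L by rewrite exprMn w2 sqr_sqrtr//; field.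
set pi0 := excprob t 0; set pi1 := expR (- xi * L).
have pi1_gt0 : 0 < pi1 by exact: expR_gt0.
have pi0_ge0 : 0 <= pi0 by case/andP: (excprob01 t 0).
have pi0_le : pi0 <= 2 * expR (- kap * L).
  apply: le_trans (excprob0_le t0) _.
  by rewrite (_ : - t ^+ 2 / 2 = - kap * L)// mulNr t2 mulNr.
have pi01 : 2 * pi0 <= pi1 by apply: le_trans hk; lra.
have pi1_le1 : pi1 <= 1 by rewrite -expR0 ler_expR mulNr oppr_le0 mulr_ge0// ltW.
set e := expR ((1 - kap) / 2 * L).
have e0 : 0 < e by exact: expR_gt0.
have e1 : 1 <= e by rewrite -expR0 ler_expR mulr_ge0 ?(ltW L0)// divr_ge0// subr_ge0.
pose U := 2 * e ^+ 2.
have eU : e <= Num.sqrt U.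
  rewrite -[e in leLHS](ger0_norm (ltW e0)) -sqrtr_sqr ler_wsqrtr// /U.
  by have := sqr_ge0 e; lra.
have Ue : Num.sqrt U <= 2 * e.
  have e20 : 0 <= 2 * e by rewrite mulr_ge0// ltW.
  rewrite -[2 * e in leRHS](ger0_norm e20) -sqrtr_sqr ler_wsqrtr// /U exprMn.
  by have := sqr_ge0 e; nra.
set S := expR ((1 - alpha) * L).
have sl : S <= 2 * s%:R := s_lb. have su : s%:R <= 2 * S := s_ub.
have S0 : 0 < S by exact: expR_gt0.
have Spi : S * pi1 = expR ((1 - alpha - xi) * L).
  by rewrite /S /pi1 -expRD; congr expR; ring.
have pe : p%:R * expR (- kap * L) = e ^+ 2.
  by rewrite [X in X * _ = _]pE -expRM_natl -expRD; congr expR; field.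
have sR : 0 < s%:R :> R by rewrite ltr0n.
pose g := s%:R * (pi1 - pi0) / (16 * Num.sqrt U).
have sU0 : 0 < Num.sqrt U by exact: lt_le_trans eU.
have g0 : 0 <= g.
  by rewrite divr_ge0 ?mulr_ge0 ?ltW// ?mulr_gt0//; lra.
(* 128 collects 16 from the ramp and a factor 2 from each of s >= S / 2, [pi1] - [pi0] >= [pi1] / 2
   and sqrt U <= 2 e. The final 256 includes the halving in [minimax_risk_le]. *)
have gE : expR ((1 - alpha - xi - (1 - kap) / 2) * L) / 128 <= g.
  rewrite (_ : expR _ = S * pi1 / e); last first.
    by rewrite Spi /e -expRN -expRD; congr expR; ring.
  rewrite /g ler_pdivlMr ?mulr_gt0//.
  apply: (@le_trans _ _ (S * pi1 / e / 128 * (16 * (2 * e)))).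
    by rewrite ler_wpM2l ?ler_wpM2l// !mulr_ge0 ?invr_ge0 ?ltW.
  rewrite (_ : _ * _ = S * pi1 / 4); last by field; rewrite gt_eqF.
  have h1 : S * pi1 <= 2 * s%:R * pi1 by rewrite ler_wpM2r// ltW.
  have h2 : s%:R * (2 * pi0) <= s%:R * pi1 by rewrite ler_wpM2l// ltW.
  lra.
pose M := 3 * Num.sqrt U + 1.
pose T0 (z : p.-tuple R) := clip (p%:R * pi0) M (cnt t z).
have mT0 : measurable_fun setT T0.
  exact: (measurableT_comp (@measurable_clip _ _ _) (@measurable_cnt _ t p)).
have T001 z : 0 <= T0 z <= 1 by exact: clip01.
have risk_g : (minimax_risk P X eps s A <= (1 - g / 2)%:E)%E.
  apply: (minimax_risk_le n0 dl0 dl1 gn ind mX mT0 T001 g0 badP) => b /XiP[sE hA].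
  have vs0 : 0 < (vsd dl)^-1 * Num.sqrt n%:R by rewrite mulr_gt0 ?invr_gt0 ?sqrtr_gt0.
  apply: count_test_gain.
  - by rewrite /U; nra.
  - by rewrite -/pi0 /U -pe; apply: le_trans (ler_wpM2l (ltW p0) pi0_le) _; lra.
  - by rewrite -/pi0; lra.
  - exact: pi1_le1.
  - rewrite -/pi0; apply: le_trans eU; apply: le_trans hU; rewrite -Spi.
    have h1 : s%:R * pi1 <= 2 * S * pi1 by rewrite ler_wpM2r ?(ltW pi1_gt0).
    have h2 := mulr_ge0 (ltW sR) pi0_ge0; lra.
  - rewrite -[RHS]sE; apply: eq_card => i; rewrite !inE.
    by rewrite mulf_eq0 gt_eqF.
  - move=> i; rewrite mulf_eq0 gt_eqF//= => bi.
    apply: le_trans (excprob_ge _ at_); last first.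
      rewrite normrM (gtr0_norm vs0); apply: le_trans (ler_wpM2l (ltW vs0) (hA i bi)).
      rewrite le_eqVlt; apply/orP; left; apply/eqP; apply: eq_sqr.
      - exact: ltW.
      - by rewrite mulr_ge0 ?sqrtr_ge0// ltW.
      rewrite /a !exprMn A2 exprVn w2 !sqr_sqrtr ?ltW// /x.
      by field; rewrite !gt_eqF.
    apply: le_trans hpk _; rewrite ler_wpM2l//.
      by rewrite ltW// normal_peak_gt0.
    by rewrite le_eqVlt /t /a mulrBl eqxx.
by apply: le_trans risk_g _; rewrite lee_fin; lra.
Qed.

End deterministic.

(** * Passage to the limit *)

Section eventually.
Context {R : realType}.
Implicit Types (x C r : R).

Lemma near_ln_ge C : \forall p \near \oo, C <= ln (p%:R : R).
Proof.
apply: filterS (nbhs_infty_ger (expR C)) => p Cp.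
by rewrite -[leLHS]expRK ler_ln ?posrE ?expR_gt0// (lt_le_trans _ Cp) ?expR_gt0.
Qed.

Lemma near_expR_ge x C : 0 < x -> \forall p \near \oo, C <= expR (x * ln (p%:R : R)).
Proof.
move=> x0; apply: filterS (near_ln_ge (C / x)) => p.
rewrite ler_pdivrMr// => h; apply: le_trans (expR_ge1Dx _).
by rewrite mulrC; lra.
Qed.

(** With dl <= 1/8 and r < 1, both effective parameters differ from r by at most 8 dl / 3, so dl <=
    d / 8 keeps them in the ball of radius d. *)
Lemma scale_near r (Q : R -> Prop) : 0 < r -> r < 1 -> (\forall x \near r, Q x) ->
  exists dl, [/\ 0 < dl, dl < 1 / 2, Q (r / (1 - 2 * dl)) & Q (r / (1 + 2 * dl))].
Proof.
move=> r0 r1 /nbhs_ballP[d /= d0 dQ].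
pose dl := Num.min (1 / 8) (d / 8).
have dl0 : 0 < dl by rewrite lt_min !divr_gt0.
have dl8 : dl <= 1 / 8 by rewrite /dl ge_min lexx.
have dld : dl <= d / 8 by rewrite /dl ge_min lexx orbT.
have m0 : 0 < 1 - 2 * dl by lra.
have p0 : 0 < 1 + 2 * dl by lra.
exists dl; split => //; [by lra| |]; apply: dQ; rewrite /ball /= ltr_distlC.
  by rewrite ltr_pdivlMr// ltr_pdivrMr//; apply/andP; split; nra.
by rewrite ltr_pdivlMr// ltr_pdivrMr//; apply/andP; split; nra.
Qed.

End eventually.

Section asymptotics.
Context {R : realType} (alpha r : R) (n s : nat -> nat)
  {dO : nat -> measure_display} {O : forall p : nat, measurableType (dO p)}
  (P : forall p : nat, probability (O p) R)
  (X : forall p : nat, O p -> 'M[R]_(n p, p))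
  (eps : forall p : nat, O p -> (n p).-tuple R).
Hypotheses (alpha0 : 1 / 2 < alpha) (alpha1 : alpha < 1) (r0 : 0 < r) (r_rho : r < rho_star alpha).
Hypothesis s_near : forall p, `|(s p)%:R - p%:R `^ (1 - alpha)| < 1.
Hypothesis gn : forall p, gauss_noise (P p) (@eps p).
Hypothesis ind : forall p, indep2 (P p) (sigma_of (@eps p)) (sigma_of (fun w => mxtup (X w))).
Hypothesis mX : forall p, measurable_fun setT (fun w : O p => mxtup (X w)).
Hypothesis n_gt0 : \forall p \near \oo, (0 < n p)%N.
Hypothesis good : forall dl M, 0 < dl -> dl < 1 / 2 -> 0 < M ->
  \forall p \near \oo, (P p (~` [set w | good_design dl (X w)]) <=
    (expR (- M * ln p%:R))%:E)%E.
Let L (p : nat) : R := ln p%:R.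
Let A (p : nat) := Num.sqrt (2 * r * L p / (n p)%:R).
Let Risk (p : nat) := minimax_risk (P p) (@X p) (@eps p) (s p) (A p).
Let c := if 4 * r <= 1 then r - (alpha - 1 / 2) else 1 - alpha - (1 - Num.sqrt r) ^+ 2.

Let r1 : r < 1.
Proof.
apply: lt_trans r_rho _; rewrite /rho_star; case: ifP => ha; first by lra.
have h0 : 0 < Num.sqrt (1 - alpha) by rewrite sqrtr_gt0; have := alpha1; lra.
have h1 : Num.sqrt (1 - alpha) <= 1.
  by rewrite -[leRHS]sqrtr1 ler_wsqrtr//; have := alpha0; lra.
by rewrite expr_lt1//; lra.
Qed.

Let y := Num.sqrt r.
Let y0 : 0 < y. Proof. by rewrite sqrtr_gt0. Qed.
Let y2 : y ^+ 2 = r. Proof. by rewrite sqr_sqrtr// ltW. Qed.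
Let y1 : y < 1. Proof. by have := y0; have := y2; have := r1; nra. Qed.

(** [rho_star] is the value of r at which the exponent vanishes. The two case distinctions, alpha
    against 3/4 and 4 r against 1, have to be matched. *)
Let c_lt0 : c < 0.
Proof.
have hr := r_rho; rewrite /c -/y; rewrite /rho_star in hr.
pose z := Num.sqrt (1 - alpha).
have z0 : 0 < z by rewrite sqrtr_gt0; have := alpha1; lra.
have z2 : z ^+ 2 = 1 - alpha by rewrite sqr_sqrtr//; have := alpha1; lra.
rewrite -/z in hr; move: hr; case: ifP => ha hr; case: ifP => hb.
- by lra.
- by move/negbT: hb; rewrite -ltNge; have := alpha0; have := alpha1; lra.
- move/negbT: ha; rewrite -leNgt => ha.
  (* With 4 r <= 1 and alpha >= 3/4 strictness could fail only at alpha = 3/4 and r = 1/4; but there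
     [rho_star] is 1/4, so r < 1/4. *)
  have [e|ne] := eqVneq alpha (3 / 4); last first.
    by have : 3 / 4 < alpha by [rewrite lt_neqAle eq_sym ne]; lra.
  have z12 : z = 1 / 2.
    by apply/eqP; rewrite -(@eqrXn2 _ 2)//; [rewrite z2 e; apply/eqP; field|exact: ltW].
  by move: hr; rewrite z12 e; lra.
- have zl1 : z <= 1 by rewrite -[leRHS]sqrtr1 ler_wsqrtr//; have := alpha0; lra.
  by rewrite -z2; have := y0; have := y1; have := y2; nra.
Qed.

Let s_bounds : \forall p \near \oo, [/\ (1 < p)%N, (0 < s p)%N, (s p <= p)%N,
  (s p)%:R <= 2 * expR ((1 - alpha) * L p) & expR ((1 - alpha) * L p) <= 2 * (s p)%:R].
Proof.
have a1 : 0 < 1 - alpha by have := alpha1; lra.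
have a0 : 0 < alpha by have := alpha0; lra.
near=> p.
have p1 : (1 < p)%N by near: p; exact: nbhs_infty_gt.
have p0 : (0 < p%:R :> R) by rewrite ltr0n (ltn_trans _ p1).
have S2 : 2 <= expR ((1 - alpha) * L p) by near: p; exact: near_expR_ge.
have T2 : 2 <= expR (alpha * L p) by near: p; exact: near_expR_ge.
have pE : p%:R = expR ((1 - alpha) * L p) * expR (alpha * L p).
  by rewrite -expRD -mulrDl subrK mul1r lnK// posrE.
have := s_near p; rewrite /powR gt_eqF// -/(L p) ltr_distlC => /andP[h1 h2].
have su : (s p)%:R <= 2 * expR ((1 - alpha) * L p) by lra.
split => //.
- by rewrite -(ltr0n R); lra.
- by rewrite -(ler_nat R) pE; apply: le_trans su _; rewrite mulrC ler_wpM2l// expR_ge0.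
- by lra.
Unshelve. all: by end_near. Qed.

Lemma near_risk_ge e : 0 < e ->
  \forall p \near \oo, ((1 - expR ((c + e) * L p))%:E <= Risk p)%E.
Proof.
move=> e0.
pose v (x : R) := if 4 * r <= 1 then 2 * x else 4 * Num.sqrt x - 2 * x - 1.
pose cf x := (1 - 2 * alpha + v x) / 2.
have cE : cf r = c.
  rewrite /cf /c /v; case: ifP => _; first by field.
  by rewrite -/y -y2; field.
(* At most e / 2, so that constants and the change of r fit into e; at most - c / 2, so that 2
   [cf x] stays below c and the smallness condition of [risk_ge_expR] holds for large p. *)
pose e' := Num.min e (- c) / 2.
have e'0 : 0 < e' by rewrite divr_gt0// lt_min e0 oppr_gt0.
have e'e : 2 * e' <= e.
  by have : Num.min e (- c) <= e by [rewrite ge_min lexx]; rewrite /e'; lra.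
have e'c : 2 * e' <= - c.
  by have : Num.min e (- c) <= - c by [rewrite ge_min lexx orbT]; rewrite /e'; lra.
have ccf : cf x @[x --> r] --> cf r.
  rewrite /cf /v; case: ifP => _; apply: cvgM; try exact: cvg_cst; apply: cvgD; try exact: cvg_cst.
    by apply: cvgM; [exact: cvg_cst|exact: cvg_id].
  apply: cvgB; last exact: cvg_cst; apply: cvgB.
    by apply: cvgM; [exact: cvg_cst|exact: sqrt_continuous].
  by apply: cvgM; [exact: cvg_cst|exact: cvg_id].
have [dl [dl0 dl1 [cx x1] _]] : exists dl, [/\ 0 < dl, dl < 1 / 2,
    (cf (r / (1 - 2 * dl)) < c + e' /\ r / (1 - 2 * dl) < 1) &
    (cf (r / (1 + 2 * dl)) < c + e' /\ r / (1 + 2 * dl) < 1)].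
  apply: (scale_near (Q := fun x => cf x < c + e' /\ x < 1) r0 r1); near=> x; split; near: x.
    by apply: (cvgr_lt _ ccf); rewrite cE; lra.
  by apply: (cvgr_lt r) => //; exact: cvg_id.
have m0 : 0 < 1 - 2 * dl by lra.
set x := r / (1 - 2 * dl) in cx x1.
have rx : r <= x by rewrite ler_pdivlMr//; have := r0; nra.
have c0 : 0 < - c by rewrite oppr_gt0.
near=> p.
have [p1 s0 sp su sl] : [/\ (1 < p)%N, (0 < s p)%N, (s p <= p)%N,
  (s p)%:R <= 2 * expR ((1 - alpha) * L p) & expR ((1 - alpha) * L p) <= 2 * (s p)%:R].
  by near: p; exact: s_bounds.
have np : (0 < n p)%N by near: p.
have Lp : 0 <= L p by near: p; exact: near_ln_ge.
(* The order - c makes bad designs cost no more than p^(c + e'). *)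
have bad : (P p (~` [set w | good_design dl (X w)]) <= (expR (- - c * L p))%:E)%E.
  by near: p; exact: good.
have h16 : 16 <= expR (- c * L p) by near: p; exact: near_expR_ge.
have h7 : 7 <= expR (e' * L p) by near: p; exact: near_expR_ge.
have h := risk_ge_expR np (ltW dl0) dl1 (@gn p) (@ind p) (@mX p) p1 s0 sp su r0
  (v := v x) (ltW x1) _ _ bad.
apply: le_trans (h _ _); clear h.
- rewrite lee_fin lerD2l lerN2 -/(L p) -/(cf x).
  have h1 : expR (cf x * L p) <= expR ((c + e') * L p) by rewrite ler_expR ler_wpM2r// ltW.
  have h2 : expR (- - c * L p) <= expR ((c + e') * L p).
    by rewrite ler_expR ler_wpM2r// opprK lerDl ltW.
  apply: (@le_trans _ _ (expR (e' * L p) * expR ((c + e') * L p))); last first.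
    by rewrite -expRD -mulrDl ler_expR ler_wpM2r//; lra.
  apply: (@le_trans _ _ (7 * expR ((c + e') * L p))); first lra.
  by rewrite ler_wpM2r// expR_ge0.
- rewrite /v; case: ifP => hr; [by left|right; split => //].
  have hr4 : 1 < 4 * r by rewrite ltNge hr.
  by apply: le_trans rx; lra.
- apply: (@le_trans _ _ (expR (- c * L p) * expR (c * L p))).
    apply: ler_pM => //; rewrite ?expR_ge0// ler_expR ler_wpM2r//.
    by have : 2 * cf x = 1 - 2 * alpha + v x by [rewrite /cf; field]; lra.
  by rewrite -expRD -mulrDl addNr mul0r expR0.
Unshelve. all: by end_near. Qed.

Lemma near_risk_le e : 0 < e ->
  \forall p \near \oo, (Risk p <= (1 - expR ((c - e) * L p))%:E)%E.
Proof.
move=> e0.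
pose kap := if 4 * r <= 1 then 4 * r else 1.
have rk : r <= kap by rewrite /kap; case: ifP => _; have := r0; have := r1; lra.
have k1 : kap <= 1 by rewrite /kap; case: ifP.
have k0 : 0 < kap by exact: lt_le_trans rk.
pose g x := (Num.sqrt kap - Num.sqrt x) ^+ 2.
have gr : g r < kap /\ c = 1 - alpha - g r - (1 - kap) / 2.
  rewrite /g /c /kap -/y; case: ifP => _.
    have -> : Num.sqrt (4 * r) = 2 * y.
      by rewrite -y2 (_ : 4 * y ^+ 2 = (2 * y) ^+ 2) ?sqrtr_sqr ?ger0_norm// ?mulr_ge0 ?ltW//; ring.
    have -> : (2 * y - y) ^+ 2 = r by rewrite -[RHS]y2; ring.
    by split; [have := r0; lra|field].
  rewrite sqrtr1; split; last by field.
  by have := y0; have := y1; nra.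
have [gk cE] := gr.
(* A quarter of e leaves room for the losses in the exponent. A quarter of the gap kap - g r keeps
   xi + 2 eta <= kap, so that a spike exceeds the threshold more often than pure noise does. *)
pose eta := Num.min (e / 4) ((kap - g r) / 4).
have eta0 : 0 < eta by rewrite lt_min !divr_gt0// subr_gt0.
have eta_e : eta <= e / 4 by rewrite ge_min lexx.
have eta_k : eta <= (kap - g r) / 4 by rewrite ge_min lexx orbT.
have cg : g x @[x --> r] --> g r.
  rewrite /g; apply: (cvgM (f := fun x => Num.sqrt kap - Num.sqrt x)
     (g := fun x => Num.sqrt kap - Num.sqrt x)).
    by apply: cvgB; [exact: cvg_cst|exact: sqrt_continuous].
  by apply: cvgB; [exact: cvg_cst|exact: sqrt_continuous].
have [dl [dl0 dl1 _ gx]] : exists dl, [/\ 0 < dl, dl < 1 / 2,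
    g (r / (1 - 2 * dl)) < g r + eta & g (r / (1 + 2 * dl)) < g r + eta].
  apply: (scale_near (Q := fun x => g x < g r + eta) r0 r1).
  by apply: (cvgr_lt _ cg); lra.
set x := r / (1 + 2 * dl) in gx.
pose del := Num.sqrt kap - Num.sqrt x.
pose xi := g r + 2 * eta.
pose pk := normal_peak (1 : R).
have pk0 : 0 < pk by exact: normal_peak_gt0.
have xi0 : 0 <= xi by rewrite addr_ge0 ?sqr_ge0// mulr_ge0// ltW.
have hc : 0 < 2 * eta - c by have := c_lt0; lra.
near=> p.
have [p1 s0 sp su sl] : [/\ (1 < p)%N, (0 < s p)%N, (s p <= p)%N,
  (s p)%:R <= 2 * expR ((1 - alpha) * L p) & expR ((1 - alpha) * L p) <= 2 * (s p)%:R].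
  by near: p; exact: s_bounds.
have np : (0 < n p)%N by near: p.
have Lp : 0 <= L p by near: p; exact: near_ln_ge.
have bad : (P p (~` [set w | good_design dl (X w)]) <= (expR (- 1 * L p))%:E)%E.
  by near: p; exact: good.
have h2 : 2 <= expR (1 * L p) by near: p; exact: near_expR_ge.
have h4 : 4 <= expR (2 * eta * L p) by near: p; apply: near_expR_ge; rewrite mulr_gt0.
have h2' : 2 <= expR ((2 * eta - c) * L p) by near: p; exact: near_expR_ge.
have h256 : 256 <= expR ((e - 2 * eta) * L p) by near: p; apply: near_expR_ge; lra.
have hL : 2 / eta * (del ^+ 2 / eta + 1 / 2 - ln pk) <= L p by near: p; exact: near_ln_ge.
have mulE (a b : R) : expR (a * L p) * expR (b * L p) = expR ((a + b) * L p).
  by rewrite -expRD mulrDl.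
apply: le_trans (risk_le_expR np (ltW dl0) dl1 (@gn p) (@ind p) (@mX p) p1 s0 su r0 sl
  rk k1 xi0 _ _ _ _) _.
- rewrite -/x -/del -/pk -[pk]lnK// -expRD ler_expR.
  set w := Num.sqrt _.
  have w2 : w ^+ 2 = 2 * L p by rewrite sqr_sqrtr// mulr_ge0.
  have hL' : del ^+ 2 / eta + 1 / 2 - ln pk <= eta / 2 * L p.
    rewrite -(@ler_pM2l _ (2 / eta)) ?divr_gt0//.
    by rewrite (_ : 2 / eta * (eta / 2 * L p) = L p)//; field; rewrite gt_eqF.
  (* The cross term is of order sqrt(log p) and is absorbed into eta log p. *)
  have amgm : del * w <= eta * L p / 2 + del ^+ 2 / eta.
    have : 0 <= (eta * w / 2 - del) ^+ 2 / eta by rewrite divr_ge0 ?sqr_ge0// ltW.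
    rewrite (_ : _ / eta = eta * w ^+ 2 / 4 + del ^+ 2 / eta - del * w); last by field; rewrite gt_eqF.
    by rewrite w2; lra.
  have d2 : del ^+ 2 * L p <= (g r + eta) * L p by rewrite ler_wpM2r// ltW.
  have -> : (del * w + 1) ^+ 2 = del ^+ 2 * w ^+ 2 + 2 * (del * w) + 1 by ring.
  by rewrite w2 -/(L p) /xi; lra.
- apply: (@le_trans _ _ (expR (2 * eta * L p) * expR (- kap * L p))).
    by rewrite ler_wpM2r// expR_ge0.
  by rewrite mulE ler_expR ler_wpM2r// /xi; lra.
- apply: (@le_trans _ _ (expR ((2 * eta - c) * L p) * expR ((1 - alpha - xi) * L p))).
    by rewrite ler_wpM2r// expR_ge0.
  by rewrite mulE ler_expR ler_wpM2r// /xi; lra.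
- apply: le_trans bad _; rewrite lee_fin.
  have := mulE (- 1) 1; rewrite addNr mul0r expR0 => h; have := expR_gt0 (- 1 * L p); nra.
- rewrite lee_fin lerD2l lerN2 -/(L p) ler_pdivlMr//.
  apply: (@le_trans _ _ (expR ((c - e) * L p) * expR ((e - 2 * eta) * L p))).
    by rewrite ler_wpM2l// expR_ge0.
  by rewrite mulE ler_expR ler_wpM2r// /xi cE; lra.
Unshelve. all: by end_near. Qed.

Lemma risk_exponent : (\forall p \near \oo, (Risk p < 1)%E) /\
  (fun p : nat => ln (1 - fine (Risk p)) / ln p%:R) @ \oo --> c.
Proof.
split.
  apply: filterS (near_risk_le ltr01) => p /le_lt_trans; apply.
  by rewrite lte_fin; have := expR_gt0 ((c - 1) * L p); lra.
apply/cvgrPdist_le => e e0; near=> p.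
have lo : ((1 - expR ((c + e) * L p))%:E <= Risk p)%E by near: p; exact: near_risk_ge.
have up : (Risk p <= (1 - expR ((c - e) * L p))%:E)%E by near: p; exact: near_risk_le.
have Lp : 0 < L p by apply: (@lt_le_trans _ _ 1) => //; near: p; exact: near_ln_ge.
move: lo up; case: (Risk p) => //= x; rewrite !lee_fin => lo up.
have x0 : 0 < 1 - x by apply: (@lt_le_trans _ _ (expR ((c - e) * L p))); [exact: expR_gt0|lra].
rewrite ler_distlC -/(L p) ler_pdivlMr// ler_pdivrMr//; apply/andP; split.
  by rewrite -[leLHS]expRK ler_ln ?posrE ?expR_gt0//; lra.
by rewrite -[leRHS]expRK ler_ln ?posrE ?expR_gt0//; lra.
Unshelve. all: by end_near. Qed.

End asymptotics.

Lemma orth_good {R : realType} {d} {Om : measurableType d} n p (X : Om -> 'M[R]_(n, p)) dl w :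
  orth_design X -> (0 < n)%N -> 0 <= dl -> good_design dl (X w).
Proof.
move=> [_ XX] n0 dl0 i j; rewrite /gram XX !mxE mulrnAr mulVf; last first.
  by rewrite pnatr_eq0 -lt0n.
by rewrite subrr normr0 divr_ge0.
Qed.

Section subG_near.
Context {R : realType} (sigma2 : R) (n : nat -> nat)
  {dO : nat -> measure_display} {O : forall p : nat, measurableType (dO p)}
  (P : forall p : nat, probability (O p) R)
  (X : forall p : nat, O p -> 'M[R]_(n p, p)).
Hypothesis sub : forall p, subG_design (P p) (@X p) sigma2.
Hypothesis nq : (fun p : nat => (n p)%:R / (p%:R ^+ 2 * ln p%:R) : R) @ \oo --> +oo.

Lemma near_nge K : \forall p \near \oo, K * (p%:R ^+ 2 * ln p%:R) <= (n p)%:R :> R.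
Proof.
near=> p.
have Lp : 1 <= ln (p%:R : R) by near: p; exact: near_ln_ge.
have p0 : (0 < p)%N by near: p; exact: nbhs_infty_gt.
have : K <= (n p)%:R / (p%:R ^+ 2 * ln p%:R) by near: p; move/cvgryPge : nq; exact.
by rewrite ler_pdivlMr// mulr_gt0 ?exprn_gt0 ?ltr0n//; lra.
Unshelve. all: by end_near. Qed.

Lemma near_n_gt0 : \forall p \near \oo, (0 < n p)%N.
Proof.
near=> p.
have Lp : 1 <= ln (p%:R : R) by near: p; exact: near_ln_ge.
have p0 : (0 < p)%N by near: p; exact: nbhs_infty_gt.
rewrite -(ltr0n R); apply: (@lt_le_trans _ _ (1 * (p%:R ^+ 2 * ln p%:R))).
  by rewrite mul1r mulr_gt0 ?exprn_gt0 ?ltr0n//; lra.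
by near: p; exact: near_nge.
Unshelve. all: by end_near. Qed.

Lemma subG_near_good dl M : 0 < dl -> dl < 1 / 2 -> 0 < M ->
  \forall p \near \oo, (P p (~` [set w | good_design dl (X w)]) <=
    (expR (- M * ln p%:R))%:E)%E.
Proof.
move=> dl0 _ M0.
have C0 : 0 < concC sigma2 by exact: concC_gt0.
have k0 : 0 < conck sigma2 by rewrite invr_gt0 mulr_gt0// lt_max ltr01 orbT.
near=> p.
have np : (0 < n p)%N by near: p; exact: near_n_gt0.
have Lp : 4 <= ln (p%:R : R) by near: p; exact: near_ln_ge.
have p0 : (0 < p)%N by near: p; exact: nbhs_infty_gt.
have pR : 0 < p%:R :> R by rewrite ltr0n.
have hp : dl / (conck sigma2 * concC sigma2) <= p%:R by near: p; exact: nbhs_infty_ger.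
(* In M + 3, two powers of p pay for the p^2 of the union bound and one for the constant 4. *)
have hn : (M + 3) * (4 * concC sigma2 / dl ^+ 2) * (p%:R ^+ 2 * ln p%:R) <= (n p)%:R.
  by near: p; exact: near_nge.
have u0 : 0 < dl / p%:R by rewrite divr_gt0.
have uk : dl / p%:R <= conck sigma2 * concC sigma2.
  by rewrite ler_pdivrMr// mulrC -ler_pdivrMr// mulr_gt0.
have := gram_tail (@sub p) np u0 uk; rewrite divfK ?gt_eqF// => /le_trans; apply.
rewrite lee_fin.
have -> : 4 * p%:R ^+ 2 = 4 * expR (2 * ln (p%:R : R)).
  by rewrite (expRM_natl 2) lnK// posrE.
apply: (@le_trans _ _ (expR (ln p%:R) * expR (2 * ln p%:R) * expR (- (M + 3) * ln p%:R))).
  apply: ler_pM => //; rewrite ?mulr_ge0 ?expR_ge0//.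
    by rewrite ler_wpM2r ?expR_ge0//; have := expR_ge1Dx (ln (p%:R : R)); lra.
  rewrite ler_expR mulNr lerN2 ler_pdivlMr ?mulr_gt0//.
  have h : (M + 3) * ln p%:R * (4 * concC sigma2) * (p%:R ^+ 2 / dl ^+ 2) <= (n p)%:R.
    by apply: le_trans hn; rewrite le_eqVlt; apply/orP; left; apply/eqP; ring.
  rewrite -ler_pdivlMr ?divr_gt0 ?exprn_gt0// in h; apply: le_trans h _.
  by rewrite exprMn exprVn invf_div mulrC -mulrA mulrC mulrA.
by rewrite -!expRD ler_expR; nra.
Unshelve. all: by end_near. Qed.

End subG_near.

Lemma cvg_ratio_weaken {R : realType} (n : nat -> nat) :
  (fun p : nat => (n p)%:R / (p%:R `^ (13 / 6) * ln p%:R) : R) @ \oo --> +oo ->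
  (fun p : nat => (n p)%:R / (p%:R ^+ 2 * ln p%:R) : R) @ \oo --> +oo.
Proof.
move=> h; apply/cvgryPge => K; near=> p.
have Lp : 1 <= ln (p%:R : R) by near: p; exact: near_ln_ge.
have p0 : (0 < p)%N by near: p; exact: nbhs_infty_gt.
have p1 : 1 <= p%:R :> R by rewrite ler1n.
have pR : 0 < p%:R :> R by rewrite ltr0n.
apply: (@le_trans _ _ ((n p)%:R / (p%:R `^ (13 / 6) * ln p%:R))).
  by near: p; move/cvgryPge : h; exact.
rewrite ler_wpM2l// lef_pV2 ?posrE ?mulr_gt0 ?exprn_gt0 ?powR_gt0//; [|lra|lra].
rewrite ler_wpM2r//; first by lra.
by rewrite -powR_mulrn ?ler0n// ler_powR//; lra.
Unshelve. all: by end_near. Qed.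

Unset Implicit Arguments.

Theorem mainTheorem2 (R : realType) (alpha r sigma2 : R)
  (n : nat -> nat) (s : nat -> nat)
  (dO : nat -> measure_display) (O : forall p : nat, measurableType (dO p))
  (P : forall p : nat, probability (O p) R)
  (X : forall p : nat, O p -> 'M[R]_(n p, p))
  (eps : forall p : nat, O p -> (n p).-tuple R) :
  1 / 2 < alpha < 1 ->
  0 < r < rho_star alpha ->
  (forall p : nat, `| (s p)%:R - p%:R `^ (1 - alpha) | < 1) ->
  (forall p : nat, gauss_noise (P p) (eps p)) ->
  (forall p : nat, indep2 (P p) (sigma_of (eps p))
                            (sigma_of (fun w => mxtup (X p w)))) ->
  ( ( (forall p : nat, subG_design (P p) (X p) sigma2)
      /\ (4 * r <= 1 ->
          (fun p : nat => (n p)%:R / (p%:R `^ (13 / 6) * ln p%:R) : R) @ \oo --> +oo)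
      /\ (1 < 4 * r ->
          (fun p : nat => (n p)%:R / (p%:R ^+ 2 * ln p%:R) : R) @ \oo --> +oo) )
    \/
    ( (forall p : nat, orth_design (X p)) /\ (forall p : nat, (p <= n p)%N ) ) ) ->
  let A := fun p : nat => Num.sqrt (2 * r * ln p%:R / (n p)%:R) in
  let Risk := fun p : nat =>
    minimax_risk (P p) (X p) (eps p) (s p) (A p) in
  let c := if 4 * r <= 1 then r - (alpha - 1 / 2)
           else 1 - alpha - (1 - Num.sqrt r) ^+ 2 in
  (\forall p \near \oo, (Risk p < 1)%E) /\
  (fun p : nat => ln (1 - fine (Risk p)) / ln p%:R) @ \oo --> c.
Proof.
move=> /andP[alpha0 alpha1] /andP[r0 r_rho] sn gn ind designs A Risk c.
(* Both design classes enter through three facts: measurability, n > 0 eventually, and bad designs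
   of probability below any given power of p. *)
suff [mX [n0 good]] : (forall p, measurable_fun setT (fun w => mxtup (X p w))) /\
    (\forall p \near \oo, (0 < n p)%N) /\
    (forall dl M, 0 < dl -> dl < 1 / 2 -> 0 < M ->
      \forall p \near \oo, (P p (~` [set w | good_design dl (X p w)]) <=
        (expR (- M * ln p%:R))%:E)%E).
  exact: (risk_exponent alpha0 alpha1 r0 r_rho sn gn ind mX n0 good).
case: designs => [[sub [n4 n1]]|[orth pn]].
  have nq : (fun p : nat => (n p)%:R / (p%:R ^+ 2 * ln p%:R) : R) @ \oo --> +oo.
    by have [r4|r4] := leP (4 * r) 1; [exact/cvg_ratio_weaken/n4|exact: n1].
  split; [|split]; first by move=> p; case: (sub p).
    exact: (near_n_gt0 nq).
  by move=> dl M; exact: (subG_near_good sub nq).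
have np : \forall p \near \oo, (0 < n p)%N.
  by apply: filterS (nbhs_infty_gt 0) => p p0; exact: leq_trans (pn p).
split; [|split] => //; first by move=> p; case: (orth p).
move=> dl M dl0 _ _; apply: filterS np => p np.
rewrite (_ : ~` _ = set0) ?measure0 ?lee_fin ?expR_ge0//.
by apply/seteqP; split => // w; apply; apply: orth_good => //; exact: ltW.
Qed.
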